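(* Let $\Omega \subset \mathbb{C}$ be a bounded open convex set with smooth boundary $\partial \Omega$. Let $T$ be an operator on a finite-dimensional Hilbert space $H$ with $W(T) \subset \Omega$ and let $\mathcal{A} \subset A(\Omega)$ be a finite-dimensional subspace. Then there exist a finite-dimensional Hilbert space $K \supset H$ and a normal operator $N$ on $K$ with $\sigma(N) \subset \partial \Omega$ such that $$ f(T) + (C\overline{f})(T)^* = 2 P_H f(N) \big|_H $$ for all $f \in \mathcal{A}$.
   Context: $W(T) = \{ \langle T\xi,\xi\rangle : \xi \in H, \|\xi\|=1\}$ is the numerical range of $T$; one has $\sigma(T) \subset \overline{W(T)}$, and $W(T)$ is compact when $\dim H<\infty$. $A(\Omega)$ is the algebra of all holomorphic functions on $\Omega$ that extend continuously to $\overline{\Omega}$. For $f \in A(\Omega)$, the Cauchy transform of $\overline f$ is the holomorphic function $(C\overline f)(z) = \frac{1}{2\pi i}\int_{\partial\Omega} \frac{\overline{f(\zeta)}}{\zeta - z}\, d\zeta$ for $z \in \Omega$ (with $\partial\Omega$ positively oriented). $f(T)$ and $(C\overline f)(T)$ are defined by the holomorphic functional calculus (as $\sigma(T)\subset\Omega$), and $f(N)$ by the continuous functional calculus applied to the continuous extension of $f$ restricted to $\partial\Omega$. $K \supset H$ means $H$ is a subspace of $K$, and $P_H$ is the orthogonal projection onto $H$. *)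

(* Defs.v *)
From HB Require Import structures.
From mathcomp Require Import all_boot all_order all_algebra.
From mathcomp Require Import complex.
From mathcomp Require Import all_classical all_reals all_analysis.

Set Implicit Arguments.
Unset Strict Implicit.
Unset Printing Implicit Defensive.

Import Order.TTheory GRing.Theory Num.Theory.
Import numFieldNormedType.Exports.

Local Open Scope classical_set_scope.
Local Open Scope ring_scope.
Local Open Scope complex_scope.

(* Packing R[i] as a numClosedFieldType makes the library find its usual
   topology, norm and normed-module structure over itself. *)
Definition Cx (R : realType) : numClosedFieldType := R[i].

Section ComplexAnalysis.
Variable R : realType.
Local Notation C := (Cx R).
Implicit Types (Omega : set C) (gamma : R -> C) (f : C -> C).

Definition boundary Omega : set C := closure Omega `\` Omega°.

Definition integral01 (F : R -> C) : C :=
  (\int[lebesgue_measure]_(t in `[0, 1]) complex.Re (F t))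
  +i* (\int[lebesgue_measure]_(t in `[0, 1]) complex.Im (F t)).

(* Coordinatewise integral; by linearity of integral01 on integrable functions
   the choice of the basis is irrelevant. *)
Definition vintegral01 (V : vectType C) (F : R -> V) : V :=
  \sum_(i < \dim {:V})
    integral01 (fun t => coord (vbasis {:V}) i (F t)) *: (vbasis {:V})`_i.

(* A closed curve is a 1-periodic function on the whole line, integrated over
   one period. *)
Definition re_part gamma : R -> R := fun t => complex.Re (gamma t).
Definition im_part gamma : R -> R := fun t => complex.Im (gamma t).

Definition curve_deriv gamma (t : R) : C :=
  derive1 (re_part gamma) t +i* derive1 (im_part gamma) t.

Definition periodic1 gamma := forall t, gamma (t + 1) = gamma t.

Definition C1_closed_curve gamma :=
  [/\ periodic1 gamma,
      forall t, derivable (re_part gamma) t 1 /\ derivable (im_part gamma) t 1,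
      continuous (derive1 (re_part gamma)) &
      continuous (derive1 (im_part gamma))].

Definition smooth_closed_curve gamma :=
  periodic1 gamma /\
  forall (n : nat) t, derivable (derive1n n (re_part gamma)) t 1 /\
                      derivable (derive1n n (im_part gamma)) t 1.

Definition contour_int gamma (g : C -> C) : C :=
  integral01 (fun t => g (gamma t) * curve_deriv gamma t).

Definition vcontour_int (V : vectType C) gamma (G : C -> V) : V :=
  vintegral01 (fun t => curve_deriv gamma t *: G (gamma t)).

Definition two_pi_i : C := 0 +i* (pi *+ 2).

Definition winding gamma (z : C) : C :=
  two_pi_i^-1 * contour_int gamma (fun zeta => (zeta - z)^-1).

(* gamma is a regular smooth Jordan parametrization of the boundary of Omega;
   positive orientation means winding number +1 around the points of Omega. *)
Definition boundary_param Omega gamma :=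
  [/\ smooth_closed_curve gamma,
      forall t, curve_deriv gamma t != 0,
      set_inj `[0, 1[ gamma,
      gamma @` `[0, 1[ = boundary Omega &
      forall z, Omega z -> winding gamma z = 1].

Definition holomorphic_on Omega f := forall z, Omega z -> derivable f z 1.

(* An element of A(Omega) is represented by its continuous extension to
   closure Omega; the values of f off closure Omega are irrelevant. *)
Definition in_A Omega f :=
  holomorphic_on Omega f /\ {within closure Omega, continuous f}.

Definition fin_dim_subspace_of_A Omega (A : set (C -> C)) :=
  [/\ A `<=` in_A Omega,
      A (fun=> 0),
      forall (a : C) f g, A f -> A g -> A (fun z => a * f z + g z) &
      exists n (b : 'I_n -> C -> C), (forall k, A (b k)) /\
        forall f, A f -> exists c : 'I_n -> C,
          forall z, closure Omega z -> f z = \sum_(k < n) c k * b k z].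

(* The Cauchy transform of the complex conjugate of f. *)
Definition cauchy_conj gamma f (z : C) : C :=
  two_pi_i^-1 * contour_int gamma (fun zeta => (f zeta)^* / (zeta - z))%R.

End ComplexAnalysis.

Section Operators.
Variables (R : realType) (V : vectType (Cx R)).
Local Notation C := (Cx R).
Implicit Types (form : {dot V for Num.conj}) (T : 'End(V)).

Definition spectrum T : set C := [set z | passmx.leigenvalue T z].

Definition numerical_range form T : set C :=
  [set z | exists2 u : V, form u u = 1 & z = form (T u) u].

Definition adjoint form T : 'End(V) :=
  xget 0 [set S : 'End(V) | forall u v, form (T u) v = form u (S v)].

Definition normal_op form T :=
  (T \o adjoint form T)%VF = (adjoint form T \o T)%VF.

Definition orth_proj form (U : {vspace V}) : 'End(V) :=
  daddv_pi U (orthov form U).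

Definition resolvent T (z : C) : 'End(V) := ((z *: \1 - T)^-1)%VF.

(* A cycle in Omega surrounding the spectrum of T. *)
Definition surrounding_cycle (Omega : set C) T n (Gamma : 'I_n -> R -> C) :=
  [/\ forall k, C1_closed_curve (Gamma k),
      forall k t, Omega (Gamma k t) /\ ~ spectrum T (Gamma k t),
      forall z, spectrum T z -> \sum_(k < n) winding (Gamma k) z = 1 &
      forall z, ~ Omega z -> \sum_(k < n) winding (Gamma k) z = 0].

(* Riesz-Dunford calculus.  By Cauchy's theorem, for f holomorphic on Omega the
   integral does not depend on the cycle, so xget picks its common value. *)
Definition hol_calculus (Omega : set C) (f : C -> C) T : 'End(V) :=
  xget 0 [set S : 'End(V) |
    exists n (Gamma : 'I_n -> R -> C), surrounding_cycle Omega T Gamma /\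
      S = (two_pi_i R)^-1 *: \sum_(k < n)
            vcontour_int (Gamma k) (fun zeta => f zeta *: resolvent T zeta)].

(* Continuous functional calculus of a normal operator on a finite-dimensional
   space: integral of f against the spectral measure. *)
Definition cont_calculus form (f : C -> C) N : 'End(V) :=
  \sum_(z \in spectrum N) f z *: orth_proj form (passmx.leigenspace N z).

End Operators.

(* Main.v *)
(* With [k(t) = gamma'(t) / (2 pi i)] and [M_t(u, v) = <(gamma t - T)^-1 u, v> k(t)
   + conj(<(gamma t - T)^-1 v, u> k(t))], both calculi are boundary integrals:
   [<(f(T) + (C conj f)(T)^* ) u, v>] is the integral of [f(gamma t) M_t(u, v)].
   Convexity of Omega and W(T) inside Omega make every form [M_t] positive
   definite, and the integral of [M_t(u, v)] is [2 <u, v>].  As [A] and [H] are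
   finite-dimensional, finitely many points [t_i] with weights [w_i > 0]
   integrate [M_t] and all [f(gamma t) M_t] exactly; then [K = H^n] with
   [<x, y> = sum_i w_i / 2 M_{t_i}(x_i, y_i)], the diagonal embedding of [H] and
   [N = diag(gamma t_i)] form the dilation.

   The Cauchy formula for [f] in A(Omega) comes from Goursat's bisection argument
   in the coordinates [(s, t)] of [w = z + s (gamma t - z)]: the form
   [f dw / (w - z)] is closed, so its integral over the curve of parameter [s]
   does not depend on [s] in [[0, 1]], which reaches the boundary at [s = 1]. *)

Require Import Defs.
From HB Require Import structures.
From mathcomp Require Import all_boot all_order all_algebra.
From mathcomp Require Import complex.
From mathcomp Require Import all_classical all_reals all_analysis.
From mathcomp Require Import ring lra.

Set Implicit Arguments.
Unset Strict Implicit.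
Unset Printing Implicit Defensive.

Import Order.TTheory GRing.Theory Num.Theory.
Import numFieldNormedType.Exports.

Local Open Scope classical_set_scope.
Local Open Scope ring_scope.

(** * Topology of the complex plane *)

Section ComplexTopology.
Variable R : realType.
Local Notation C := (Cx R).
Local Notation re := (@complex.Re R).
Local Notation im := (@complex.Im R).
Local Notation rc := (real_complex R : R -> C).
Implicit Types z w : C.

(** The calculi are defined by cycles inside [Omega], whereas positivity shows only on the boundary
    curve, which is not an admissible cycle and where [f] is merely continuous. The transfer does
    not deform cycles: a function that is the Cauchy integral of continuous boundary data is
    inserted in the interior integral, the order of integration is exchanged, and only the explicit
    kernel meets the resolvent. This treats [f] and its Cauchy transform alike, the data being [f]
    and its conjugate. The adjoint turns the conjugate data back into [f], so the sum carries a
    hermitian density, while a single Cauchy term has no sign. Positivity at [u] is read at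
    [v = (gamma t - T)^-1 u]: the Rayleigh quotient of [v] is a point of [Omega], and convexity puts
    it strictly to the left of the tangent at [gamma t]. A dilation of the continuous density would
    in general live on an infinite-dimensional space. Quadrature replaces it by finitely many atoms;
    the constant 1 is adjoined to the integrated family so that the embedding of [H] is
    isometric. *)

Definition modulus (z : C) : R := Num.sqrt (re z ^+ 2 + im z ^+ 2).

(** The norm of [C] takes its values in [C]; this bridge moves every estimate to the ordered field
    [R]. *)
Lemma normCE z : `|z| = rc (modulus z).
Proof. exact: normc_def. Qed.

Lemma modulus_ge0 z : 0 <= modulus z. Proof. exact: sqrtr_ge0. Qed.

Lemma modulusD z w : modulus (z + w) <= modulus z + modulus w.
Proof. by rewrite -lecR rmorphD /= -!normCE; exact: ler_normD. Qed.

Lemma modulusM z w : modulus (z * w) = modulus z * modulus w.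
Proof. by apply: complexI; rewrite rmorphM /= -!normCE normrM. Qed.

Lemma modulusN z : modulus (- z) = modulus z.
Proof. by apply: complexI; rewrite -!normCE normrN. Qed.

Lemma modulusB z w : modulus (z - w) = modulus (w - z).
Proof. by rewrite -opprB modulusN. Qed.

Lemma modulusV z : modulus z^-1 = (modulus z)^-1.
Proof. by apply: complexI; rewrite fmorphV/= -!normCE normfV. Qed.

Lemma modulus_eq0 z : (modulus z == 0) = (z == 0).
Proof.
apply/eqP/eqP=> [h|->]; last by rewrite /modulus/= expr0n addr0 sqrtr0.
by apply: normr0_eq0; rewrite normCE h.
Qed.

Lemma modulus_gt0 z : (0 < modulus z) = (z != 0).
Proof. by rewrite lt_def modulus_ge0 andbT modulus_eq0. Qed.

Lemma modulus_rc (x : R) : modulus (rc x) = `|x|.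
Proof. by rewrite /modulus /= expr0n addr0 sqrtr_sqr. Qed.

Lemma normr_Re_le z : `|re z| <= modulus z.
Proof. by rewrite -sqrtr_sqr ler_wsqrtr// lerDl sqr_ge0. Qed.

Lemma normr_Im_le z : `|im z| <= modulus z.
Proof. by rewrite -sqrtr_sqr ler_wsqrtr// lerDr sqr_ge0. Qed.

Lemma modulus_le z : modulus z <= `|re z| + `|im z|.
Proof.
rewrite -(ler_pXn2r (n := 2)) ?nnegrE ?modulus_ge0 ?addr_ge0//.
rewrite sqr_sqrtr ?addr_ge0 ?sqr_ge0// -(real_normK (num_real (re z))).
rewrite -(real_normK (num_real (im z))) sqrrD -addrA.
by rewrite lerD2l lerDr mulrn_wge0// mulr_ge0.
Qed.

Lemma cReD z w : re (z + w) = re z + re w.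
Proof. by case: z w => [a b] [c d]. Qed.
Lemma cImD z w : im (z + w) = im z + im w.
Proof. by case: z w => [a b] [c d]. Qed.
Lemma cReN z : re (- z) = - re z. Proof. by case: z. Qed.
Lemma cImN z : im (- z) = - im z. Proof. by case: z. Qed.
Lemma cReM z w : re (z * w) = re z * re w - im z * im w.
Proof. by case: z w => [a b] [c d]. Qed.
Lemma cImM z w : im (z * w) = re z * im w + im z * re w.
Proof. by case: z w => [a b] [c d]. Qed.

Lemma complex_eq z w : re z = re w -> im z = im w -> z = w.
Proof. by case: z w => [a b] [c d] /= -> ->. Qed.

Lemma gt0_rc (e : C) : 0 < e -> exists2 d : R, 0 < d & e = rc d.
Proof. by case: e => a b; rewrite ltcE /= => /andP[/eqP-> a0]; exists a. Qed.

Lemma cvgCP (T : Type) (F : set_system T) (FF : Filter F) (f : T -> C) (l : C) :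
  f @ F --> l <-> forall e : R, 0 < e -> \forall t \near F, modulus (l - f t) < e.
Proof.
split=> [/cvgrPdist_lt cf e e0|cf].
  have /cf : 0 < rc e by rewrite ltcR.
  by apply: filterS => t; rewrite normCE ltcR.
apply/cvgrPdist_lt => _ /gt0_rc[d d0 ->].
by apply: filterS (cf _ d0) => t; rewrite normCE ltcR.
Qed.

Lemma near_modulus z (e : R) : 0 < e -> \forall w \near z, modulus (z - w) < e.
Proof.
by move=> e0; have /cvgCP := @cvg_id C (nbhs z); apply.
Qed.

Lemma Re_continuous : continuous (re : C -> R).
Proof.
move=> z; apply/(@cvgrPdist_lt _ _ _ (nbhs z) (nbhs_filter z)) => e e0; near=> w.
rewrite -cReN -cReD; apply: le_lt_trans (normr_Re_le _) _; near: w.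
exact: near_modulus.
Unshelve. all: by end_near. Qed.

Lemma Im_continuous : continuous (im : C -> R).
Proof.
move=> z; apply/(@cvgrPdist_lt _ _ _ (nbhs z) (nbhs_filter z)) => e e0; near=> w.
rewrite -cImN -cImD; apply: le_lt_trans (normr_Im_le _) _; near: w.
exact: near_modulus.
Unshelve. all: by end_near. Qed.

Lemma rc_continuous : continuous rc.
Proof.
move=> x; apply/cvgCP => e e0; near=> y.
rewrite -rmorphB modulus_rc; near: y.
exact: cvgr_dist_lt.
Unshelve. all: by end_near. Qed.

Lemma complexEri z : z = rc (re z) + ('i%C : C) * rc (im z).
Proof. exact: complexE. Qed.

Lemma cvgC_ReIm (T : Type) (F : set_system T) (FF : Filter F) (f : T -> C) (l : C) :
  (re \o f) @ F --> re l -> (im \o f) @ F --> im l -> f @ F --> l.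
Proof.
move=> fr fi.
rewrite (_ : f = fun t => rc (re (f t)) + ('i%C : C) * rc (im (f t))); last first.
  by apply/funext => t; rewrite -complexEri.
rewrite [l]complexEri; apply: cvgD.
  exact: (@cvg_comp _ _ _ _ rc F _ _ fr (@rc_continuous _)).
apply: cvgM; first exact: cvg_cst.
exact: (@cvg_comp _ _ _ _ rc F _ _ fi (@rc_continuous _)).
Qed.

Lemma continuousC (T : topologicalType) (f : T -> C) :
  continuous (re \o f) -> continuous (im \o f) -> continuous f.
Proof. by move=> fr fi x; apply: cvgC_ReIm; [exact: fr|exact: fi]. Qed.

Lemma continuous_Re (T : topologicalType) (f : T -> C) :
  continuous f -> continuous (re \o f).
Proof. by move=> cf x; apply: continuous_comp (cf x) _; exact: Re_continuous. Qed.

Lemma continuous_Im (T : topologicalType) (f : T -> C) :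
  continuous f -> continuous (im \o f).
Proof. by move=> cf x; apply: continuous_comp (cf x) _; exact: Im_continuous. Qed.

Lemma conjc_continuous : continuous (@conjc R : C -> C).
Proof.
apply: continuousC.
  by rewrite (_ : _ \o _ = re); [exact: Re_continuous|apply/funext; case].
rewrite (_ : _ \o _ = fun z => - im z); last by apply/funext; case.
by move=> z; exact: (cvgN (@Im_continuous z)).
Qed.

Lemma continuous_modulus (T : topologicalType) (f : T -> C) :
  continuous f -> continuous (modulus \o f).
Proof.
move=> cf x; rewrite (_ : modulus \o f = re \o (fun t => `|f t|)).
  apply: continuous_comp; last exact: Re_continuous.
  by apply: cvg_norm; exact: cf.
by apply/funext => t; exact: (esym (congr1 re (normCE (f t)))).
Qed.

End ComplexTopology.

(** * Integration of continuous functions *)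

Section RealIntegral.
Variable R : realType.
Implicit Types (f g : R -> R) (a b c : R).

Definition rint a b f : R := \int[lebesgue_measure]_(t in `[a, b]) f t.

(** Integrands are taken continuous on the whole line throughout; a function given only on a segment
    is later extended by clipping its argument. *)
Lemma integrable_continuous a b f : continuous f ->
  lebesgue_measure.-integrable `[a, b] (EFin \o f).
Proof.
move=> cf; apply: continuous_compact_integrable; first exact: segment_compact.
exact: continuous_subspaceT.
Qed.

Lemma eq_rint a b f g : (forall t, a <= t <= b -> f t = g t) ->
  rint a b f = rint a b g.
Proof. by move=> fg; apply: eq_Rintegral => t; rewrite inE/= in_itv/=; exact: fg. Qed.

Lemma rintD a b f g : continuous f -> continuous g ->
  rint a b (fun t => f t + g t) = rint a b f + rint a b g.
Proof. by move=> cf cg; rewrite /rint RintegralD//; exact: integrable_continuous. Qed.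

Lemma rintB a b f g : continuous f -> continuous g ->
  rint a b (fun t => f t - g t) = rint a b f - rint a b g.
Proof. by move=> cf cg; rewrite /rint RintegralB//; exact: integrable_continuous. Qed.

Lemma rintZ a b k f : continuous f -> rint a b (fun t => k * f t) = k * rint a b f.
Proof. by move=> cf; rewrite /rint RintegralZl//; exact: integrable_continuous. Qed.

Lemma rint_cst a b k : a <= b -> rint a b (fun=> k) = k * (b - a).
Proof.
move=> ab; rewrite /rint Rintegral_cst//= lebesgue_measure_itv/= lte_fin.
by move: ab; rewrite le_eqVlt => /predU1P[->|->//]; rewrite ltxx subrr.
Qed.

Lemma ler_rint a b f g : continuous f -> continuous g ->
  (forall t, a <= t <= b -> f t <= g t) -> rint a b f <= rint a b g.
Proof.
move=> cf cg fg; rewrite /rint le_Rintegral//; try exact: integrable_continuous.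
Qed.

Lemma rint_split a b c f : continuous f -> a <= c -> c <= b ->
  rint a b f = rint a c f + rint c b f.
Proof.
move=> cf ac cb; rewrite /rint -(Rintegral_itv_obnd_cbnd (r := c)).
  rewrite -(@Rintegral_itvB _ _ (BLeft a) (BRight b) c) ?bnd_simp//.
    by rewrite addrC subrK.
  exact: integrable_continuous.
apply: integrableS (integrable_continuous c b cf) => //.
by apply: subset_itvr; rewrite bnd_simp.
Qed.

Lemma rint_bound a b f M : continuous f -> a <= b ->
  (forall t, a <= t <= b -> `|f t| <= M) -> `|rint a b f| <= M * (b - a).
Proof.
move=> cf ab fM; rewrite ler_norml -mulNr -!rint_cst//.
by apply/andP; split; apply: ler_rint => //; try exact: cst_continuous;
  move=> t /fM; rewrite ler_norml => /andP[].
Qed.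

Lemma rint_FTC a b f g : a <= b -> continuous f ->
  (forall t : R, is_derive t (1 : R) g (f t)) -> rint a b f = g b - g a.
Proof.
rewrite le_eqVlt => /predU1P[<-|ab] cf dg.
  by rewrite /rint set_itv1 Rintegral_set1 subrr.
have cg : continuous g.
  by move=> t; apply: differentiable_continuous; apply/derivable1_diffP; apply: ex_derive.
rewrite /rint /Rintegral (@continuous_FTC2 _ f g)//.
- exact: continuous_subspaceT.
- split=> //.
  + by apply: cvg_at_right_filter; exact: cg.
  + by apply: cvg_at_left_filter; exact: cg.
- by move=> x _; rewrite derive1E; apply: derive_val.
Qed.

(** A value [f t > 0] keeps [f] above [f t / 2] on a short interval to the right of [t], which
    already contributes a positive amount. This is what makes the Gram matrix of the quadrature
    nonsingular. *)
Lemma rint_ge0_eq0 a b f : continuous f -> (forall t, a <= t <= b -> 0 <= f t) ->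
  rint a b f = 0 -> forall t, a < t < b -> f t = 0.
Proof.
move=> cf f0 If t /andP[ta tb]; apply: contrapT => /eqP ft.
have ft0 : 0 < f t by rewrite lt_neqAle eq_sym ft f0// !ltW.
have [d d0 fd] : exists2 d, 0 < d & forall s, `|t - s| < d -> f t / 2 < f s.
  have /cvgrPdist_lt/(_ _ (divr_gt0 ft0 (ltr0Sn _ 1)))[d/= d0 fd] := cf t.
  by exists d => // s /fd; rewrite ltr_norml => /andP[_]; lra.
pose r := Num.min (d / 2) (b - t).
have r0 : 0 < r by rewrite lt_min divr_gt0//= subr_gt0.
have rd : r <= d / 2 by rewrite ge_min lexx.
have rb : r <= b - t by rewrite ge_min lexx orbT.
have : 0 < rint a b f.
  rewrite (rint_split cf (ltW ta) (ltW tb)).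
  rewrite (@rint_split t b (t + r)) ?lerDl ?(ltW r0)//; last lra.
  have h c e : a <= c -> c <= e -> e <= b -> 0 <= rint c e f.
    move=> ac ce eb; rewrite -[0](mul0r (e - c)) -rint_cst//.
    apply: ler_rint => //; first exact: cst_continuous.
    by move=> s /andP[cs se]; apply: f0; rewrite (le_trans ac)//= (le_trans se).
  have h1 := h a t (lexx _) (ltW ta) (ltW tb).
  have h2 := h (t + r) b.
  have /h2 {}h2 : a <= t + r by rewrite (le_trans (ltW ta))// lerDl ltW.
  have {}h2 : 0 <= rint (t + r) b f by apply: h2 => //; lra.
  have : 0 < rint t (t + r) f.
    apply: (@lt_le_trans _ _ (rint t (t + r) (fun=> f t / 2))).
      by rewrite rint_cst ?lerDl ?ltW// addrAC subrr add0r mulr_gt0// divr_gt0.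
    apply: ler_rint => //; first exact: cst_continuous.
    move=> s /andP[ts sr]; apply/ltW/fd; rewrite ltr_norml; lra.
  by move=> h3; rewrite ltr_wpDl// ltr_pwDl.
by rewrite If ltxx.
Qed.

End RealIntegral.

Lemma continuous_bigsum (T : topologicalType) (K : numFieldType) n
    (f : 'I_n -> T -> K) :
  (forall i, continuous (f i)) -> continuous (fun t => \sum_(i < n) f i t).
Proof.
elim: n f => [|n IH] f cf.
  rewrite (_ : (fun _ => _) = fun=> 0); first exact: cst_continuous.
  by apply/funext => t; rewrite big_ord0.
rewrite (_ : (fun _ => _) = fun t => f ord0 t + \sum_(i < n) f (lift ord0 i) t).
  by move=> t; apply: cvgD; [exact: cf|exact: IH].
by apply/funext => t; rewrite big_ord_recl.
Qed.

(** * Riemann sums, uniform continuity and Fubini for continuous integrands *)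

Section RiemannFubini.
Variable R : realType.
Implicit Types (f g : R -> R) (a b c : R) (F : R * R -> R).

Lemma rint_sum a b n (f : 'I_n -> R -> R) : (forall i, continuous (f i)) ->
  rint a b (fun t => \sum_(i < n) f i t) = \sum_(i < n) rint a b (f i).
Proof.
elim: n f => [|n IH] f cf.
  rewrite big_ord0 -[RHS](mul0r (rint a b (fun=> 0))) -rintZ; last exact: cst_continuous.
  by apply: eq_rint => t _; rewrite big_ord0 mul0r.
rewrite big_ord_recl -IH// -rintD//; last exact: continuous_bigsum.
by apply: eq_rint => t _; rewrite big_ord_recl.
Qed.

(** Left-endpoint sum over [n.+1] cells; the shift keeps the step invertible. *)
Definition riemann n f : R := n.+1%:R^-1 * \sum_(i < n.+1) f (i%:R / n.+1%:R).

(** On each cell [f] stays within [e] of its left value, and the cells have total length 1. The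
    bound depends on [f] only through its oscillation, hence is uniform over families with a common
    modulus of continuity. *)
Lemma riemann_err n f e : continuous f ->
  (forall s t, 0 <= s <= 1 -> 0 <= t <= 1 -> `|s - t| <= n.+1%:R^-1 ->
     `|f s - f t| <= e) ->
  `|rint 0 1 f - riemann n f| <= e.
Proof.
move=> cf fe; pose x k : R := k%:R / n.+1%:R.
have n0 : 0 < n.+1%:R :> R by rewrite ltr0n.
have xS k : x k.+1 - x k = n.+1%:R^-1.
  by rewrite /x -mulrBl -natrB// subSnn mul1r.
have xle k l : (k <= l)%N -> x k <= x l.
  by move=> kl; rewrite ler_pM2r ?invr_gt0// ler_nat.
have x0 : x 0 = 0 by rewrite /x mul0r.
have x1 : x n.+1 = 1 by rewrite /x divff// pnatr_eq0.
have xb k : (k <= n.+1)%N -> 0 <= x k <= 1.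
  by move=> kn; rewrite -x0 -x1 !xle.
have split k : rint 0 (x k) f = \sum_(i < k) rint (x i) (x i.+1) f.
  elim: k => [|k IH].
    by rewrite big_ord0 x0 /rint set_itv1 Rintegral_set1.
  rewrite big_ord_recr/= -IH -rint_split//; last exact: xle.
  by rewrite -x0; exact: xle.
rewrite -x1 split /riemann mulr_sumr -sumrB.
apply: le_trans (ler_norm_sum _ _ _) _.
have -> : e = \sum_(i < n.+1) e * n.+1%:R^-1.
  by rewrite sumr_const card_ord -[RHS]mulr_natr mulfVK// pnatr_eq0.
apply: ler_sum => i _; rewrite -[X in _ <= e * X](xS i) -/(x i).
rewrite [X in `|_ - X|](_ : _ = rint (x i) (x i.+1) (fun=> f (x i))); last first.
  by rewrite rint_cst ?xle// xS mulrC.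
rewrite -rintB//; last exact: cst_continuous.
apply: rint_bound; [|exact: xle|].
  by move=> t; apply: cvgB; [exact: cf|exact: cvg_cst].
move=> t /andP[it ti]; have /andP[xi0 xi1] := xb i (ltnW (ltn_ord i)).
have /andP[yi0 yi1] := xb i.+1 (ltn_ord i).
apply: fe; rewrite ?xi0 ?xi1//.
  by rewrite (le_trans xi0 it) (le_trans ti yi1).
by rewrite ger0_norm ?subr_ge0// -(xS i) lerB.
Qed.

(** Compactness of the rectangle, in its near-covering form, merges the pointwise radii into one.
    Only [t] is confined to [[a, b]], so the degenerate case [a = b] gives continuity at a parameter
    value, uniformly in [u]. *)
Lemma uniform_continuous2 F (a b c d e : R) : continuous F -> 0 < e ->
  exists2 r, 0 < r & forall s t u, a <= t <= b -> c <= u <= d ->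
    `|s - t| <= r -> `|F (s, u) - F (t, u)| < e.
Proof.
move=> cF e0.
have K := compact_setX (@segment_compact _ a b) (@segment_compact _ c d).
pose P (r : R) (p : R * R) := forall s, `|s - p.1| <= r -> `|F (s, p.2) - F p| < e.
have cov := proj1 (compact_near_coveringP _) K R ((0 : R)^'+) P _.
have : \forall r \near (0 : R)^'+, `[a, b] `*` `[c, d] `<=` P r.
  apply: cov => p _.
  have /cvgrPdist_lt/(_ (e / 2)) := cF p.
  rewrite divr_gt0// => /(_ isT) /nbhs_ballP[r/= r0 rF].
  exists (ball p (r / 2), [set x | x < r / 2]).
    split; first by apply: nbhsx_ballx; rewrite divr_gt0.
    exists (r / 2) => /=; first by rewrite divr_gt0.
    by move=> x /=; rewrite sub0r normrN => xr x0; rewrite (le_lt_trans (ler_norm _)).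
  move=> [q x] [/= pq xr]; rewrite /P => s sq.
  case: q pq sq => q1 q2 [/= b1 b2] sq.
  have h1 : `|F p - F (q1, q2)| < e / 2.
    apply: rF; split; rewrite /ball/=; [move: b1|move: b2]; rewrite /ball/=.
      by move=> h; apply: lt_le_trans h _; lra.
    by move=> h; apply: lt_le_trans h _; lra.
  have h2 : `|F p - F (s, q2)| < e / 2.
    apply: rF; split; rewrite /ball/=; [move: b1|move: b2]; rewrite /ball/=.
      move=> h; rewrite -(subrKA q1); apply: le_lt_trans (ler_normD _ _) _.
      by rewrite (distrC q1 s); lra.
    by move=> h; apply: lt_le_trans h _; lra.
  rewrite /= (_ : F (s, q2) - F (q1, q2) = (F p - F (q1, q2)) - (F p - F (s, q2))).
    by apply: le_lt_trans (ler_normB _ _) _; lra.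
  by ring.
case=> r/= r0 H; exists (r / 2); first by rewrite divr_gt0.
move=> s t u tab ucd st.
have := H (r / 2); rewrite /= sub0r normrN gtr0_norm ?divr_gt0//.
move=> /(_ _ _ (t, u)) /=; apply => //.
by lra.
Qed.

Lemma continuous_pair1 (T : topologicalType) (F : R * R -> T) t : continuous F -> continuous (fun s => F (s, t)).
Proof.
move=> cF s; apply: (@continuous_comp _ _ _ (fun s => (s, t)) F); last exact: cF.
by apply: (@cvg_pair R R R (nbhs s) (nbhs s) (nbhs t)); [exact: cvg_id|exact: cvg_cst].
Qed.

Lemma continuous_pair2 (T : topologicalType) (F : R * R -> T) s : continuous F -> continuous (fun t => F (s, t)).
Proof.
move=> cF t; apply: (@continuous_comp _ _ _ (fun t => (s, t)) F); last exact: cF.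
by apply: (@cvg_pair R R R (nbhs t) (nbhs s) (nbhs t)); [exact: cvg_cst|exact: cvg_id].
Qed.

Lemma continuous_swap F : continuous F -> continuous (fun p => F (p.2, p.1)).
Proof.
move=> cF p; apply: (@continuous_comp _ _ _ (@unstable.swap R R) F).
  exact: swap_continuous.
exact: cF.
Qed.

Lemma continuous_rint2 F : continuous F ->
  continuous (fun s => rint 0 1 (fun t => F (s, t))).
Proof.
move=> cF s; apply/cvgrPdist_lt => e e0.
have e20 : 0 < e / 2 by rewrite divr_gt0.
have [r r0 rF] := @uniform_continuous2 F s s 0 1 (e / 2) cF e20.
near=> s'.
have ss' : `|s' - s| <= r.
  by rewrite distrC; near: s'; apply: cvgr_dist_le => //; exact: cvg_id.
rewrite -rintB; [|exact: continuous_pair2|exact: continuous_pair2].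
have -> : e = (e / 2 + e / 2) * (1 - 0) by rewrite subr0 mulr1; lra.
apply: (@le_lt_trans _ _ (e / 2 * (1 - 0))); last by rewrite subr0 !mulr1; lra.
apply: rint_bound => //.
  by move=> t; apply: cvgB; exact: continuous_pair2.
move=> t t01; rewrite distrC; apply/ltW/rF => //.
by rewrite lexx.
Unshelve. all: by end_near. Qed.

(** Only [s] is discretized: one Riemann sum in [s], accurate uniformly in [t], is close to both
    iterated integrals, because a finite sum commutes with the integral in [t]. *)
Lemma rint_fubini F : continuous F ->
  rint 0 1 (fun s => rint 0 1 (fun t => F (s, t))) =
  rint 0 1 (fun t => rint 0 1 (fun s => F (s, t))).
Proof.
move=> cF; have cF' := continuous_swap cF.
apply/eqP; rewrite -subr_eq0 -normr_le0; apply/ler_addgt0Pr => e e0.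
have e20 : 0 < e / 2 by rewrite divr_gt0.
have [r r0 rF] := @uniform_continuous2 F 0 1 0 1 (e / 2) cF e20.
have [n nr] : exists n, n.+1%:R^-1 <= r.
  exists (Num.bound r^-1); rewrite invf_ple ?posrE//.
  apply: ltW; apply: lt_trans (_ : (Num.bound r^-1)%:R < _); last by rewrite ltr_nat.
  by have := archi_boundP (ltW (_ : 0 < r^-1)); rewrite invr_gt0; apply.
pose Phi s := rint 0 1 (fun t => F (s, t)).
have cPhi : continuous Phi by exact: continuous_rint2.
have cR : continuous (fun t => riemann n (fun s => F (s, t))).
  move=> t; apply: cvgM; first exact: cvg_cst.
  apply: (@continuous_bigsum _ _ _ (fun i t => F (i%:R / n.+1%:R, t))) => i.
  exact: continuous_pair2.
have h1 : `|rint 0 1 Phi - riemann n Phi| <= e / 2.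
  apply: riemann_err => // s t s01 t01 st.
  rewrite /Phi -rintB; [|exact: continuous_pair2|exact: continuous_pair2].
  rewrite -[e / 2]mulr1 -[X in _ * X](subr0 (1 : R)).
  apply: rint_bound => //.
    by move=> u; apply: cvgB; exact: continuous_pair2.
  by move=> u u01; apply/ltW/rF => //; exact: le_trans st nr.
have h2 : `|rint 0 1 (fun t => rint 0 1 (fun s => F (s, t))) - riemann n Phi| <= e / 2.
  have -> : riemann n Phi = rint 0 1 (fun t => riemann n (fun s => F (s, t))).
    rewrite rintZ; last first.
      apply: (@continuous_bigsum _ _ _ (fun i t => F (i%:R / n.+1%:R, t))) => i.
      exact: continuous_pair2.
    rewrite rint_sum// => i; exact: continuous_pair2.
  rewrite -rintB//; last exact: (continuous_rint2 cF').
  rewrite -[e / 2]mulr1 -[X in _ * X](subr0 (1 : R)).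
  apply: rint_bound => //.
    by move=> t; apply: cvgB; [exact: (continuous_rint2 cF')|exact: cR].
  move=> t t01; apply: riemann_err; first exact: continuous_pair1.
  by move=> s u s01 u01 su; apply/ltW/rF => //; exact: le_trans su nr.
rewrite add0r -(subrKA (riemann n Phi)).
apply: le_trans (ler_normD _ _) _; rewrite [X in _ + X]distrC.
by apply: le_trans (lerD h1 h2) _; lra.
Qed.

Lemma cvg_riemann f : continuous f -> riemann n f @[n --> \oo] --> rint 0 1 f.
Proof.
move=> cf; apply/cvgrPdist_le => e e0.
have cF : continuous (fun p : R * R => f p.1).
  by move=> p; apply: continuous_comp; [exact: cvg_fst|exact: cf].
have [r r0 rF] := @uniform_continuous2 _ 0 1 0 1 e cF e0.
near=> n; apply: riemann_err => // s t s01 t01 st.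
apply/ltW/(rF s t 0); rewrite ?lexx ?ler01//.
apply: le_trans st _.
rewrite invf_ple ?posrE//; apply: le_trans (_ : n%:R <= _); last by rewrite ler_nat.
by near: n; exact: nbhs_infty_ger.
Unshelve. all: by end_near. Qed.

End RiemannFubini.

(** * Integration and differentiation of complex functions of a real variable *)

Section ComplexIntegral.
Variable R : realType.
Local Notation C := (Cx R).
Local Notation re := (@complex.Re R).
Local Notation im := (@complex.Im R).
Local Notation rc := (real_complex R : R -> C).
Implicit Types (F G : R -> C) (a b c : R).

Lemma continuous_cstC (T : topologicalType) (k : C) : continuous (fun _ : T => k).
Proof. by move=> t; exact: cvg_cst. Qed.

Lemma continuousD_C (T : topologicalType) (f g : T -> C) :
  continuous f -> continuous g -> continuous (fun t => f t + g t).
Proof. by move=> cf cg t; apply: cvgD; [exact: cf|exact: cg]. Qed.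

Lemma continuousB_C (T : topologicalType) (f g : T -> C) :
  continuous f -> continuous g -> continuous (fun t => f t - g t).
Proof. by move=> cf cg t; apply: cvgB; [exact: cf|exact: cg]. Qed.

Lemma continuousM_C (T : topologicalType) (f g : T -> C) :
  continuous f -> continuous g -> continuous (fun t => f t * g t).
Proof. by move=> cf cg t; apply: cvgM; [exact: cf|exact: cg]. Qed.

Lemma continuousV_C (T : topologicalType) (f : T -> C) :
  continuous f -> (forall t, f t != 0) -> continuous (fun t => (f t)^-1).
Proof. by move=> cf f0 t; apply: cvgV; [exact: f0|exact: cf]. Qed.

Lemma conjCE (z : C) : (z^*)%R = conjc z. Proof. by []. Qed.

Lemma continuous_conj (T : topologicalType) (f : T -> C) :
  continuous f -> continuous (fun t => (f t)^*%R).
Proof.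
move=> cf t; have h := @conjc_continuous R (f t).
exact: (@continuous_comp _ _ _ f (@conjc R : C -> C) _ (cf t) h).
Qed.

(** Convertible to [integral01] for the bounds 0 and 1; general bounds serve the subdivisions of
    Goursat's argument. *)
Definition cint a b F : C := Complex (rint a b (re \o F)) (rint a b (im \o F)).

Lemma eq_cint a b F G : (forall t, a <= t <= b -> F t = G t) ->
  cint a b F = cint a b G.
Proof. by move=> FG; apply: complex_eq => /=; apply: eq_rint => t /FG /= ->. Qed.

Lemma cintD a b F G : continuous F -> continuous G ->
  cint a b (fun t => F t + G t) = cint a b F + cint a b G.
Proof.
move=> cF cG; apply: complex_eq; rewrite ?cReD ?cImD /=.
  rewrite -(rintD _ _ (continuous_Re cF) (continuous_Re cG)).
  by apply: eq_rint => t _ /=; rewrite cReD.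
rewrite -(rintD _ _ (continuous_Im cF) (continuous_Im cG)).
by apply: eq_rint => t _ /=; rewrite cImD.
Qed.

Lemma cintZ a b (k : C) F : continuous F ->
  cint a b (fun t => k * F t) = k * cint a b F.
Proof.
move=> cF; have cr := continuous_Re cF; have ci := continuous_Im cF.
have cZ (x : R) (f : R -> R) : continuous f -> continuous (fun t => x * f t).
  by move=> cf t; apply: cvgM; [exact: cvg_cst|exact: cf].
apply: complex_eq; rewrite ?cReM ?cImM /=.
  rewrite -(rintZ a b (re k) cr) -(rintZ a b (im k) ci).
  rewrite -(rintB _ _ (cZ _ _ cr) (cZ _ _ ci)).
  by apply: eq_rint => t _ /=; rewrite cReM.
rewrite -(rintZ a b (re k) ci) -(rintZ a b (im k) cr).
rewrite -(rintD _ _ (cZ _ _ ci) (cZ _ _ cr)).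
by apply: eq_rint => t _ /=; rewrite cImM.
Qed.

Lemma cintZr a b (k : C) F : continuous F ->
  cint a b (fun t => F t * k) = cint a b F * k.
Proof. by move=> cF; rewrite mulrC -cintZ//; apply: eq_cint => t _; rewrite mulrC. Qed.

Lemma cintN a b F : continuous F -> cint a b (fun t => - F t) = - cint a b F.
Proof. by move=> cF; rewrite -mulN1r -cintZ//; apply: eq_cint => t _; rewrite mulN1r. Qed.

Lemma cintB a b F G : continuous F -> continuous G ->
  cint a b (fun t => F t - G t) = cint a b F - cint a b G.
Proof.
move=> cF cG; have cN : continuous (fun t => - G t) by move=> t; apply: cvgN; exact: cG.
by rewrite (cintD a b cF cN) (cintN a b cG).
Qed.

Lemma cint0 a b : cint a b (fun=> 0) = 0.
Proof.
rewrite -[RHS](mul0r (cint a b (fun=> 0))) -(cintZ a b 0 (@continuous_cstC R 0)).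
by apply: eq_cint => t _; rewrite mul0r.
Qed.

Lemma cint_sum a b n (F : 'I_n -> R -> C) : (forall i, continuous (F i)) ->
  cint a b (fun t => \sum_(i < n) F i t) = \sum_(i < n) cint a b (F i).
Proof.
elim: n F => [|n IH] F cF.
  by rewrite big_ord0 -[RHS](cint0 a b); apply: eq_cint => t _; rewrite big_ord0.
have c1 : continuous (fun t => \sum_(i < n) F (lift ord0 i) t).
  by apply: continuous_bigsum => i; exact: cF.
rewrite big_ord_recl -IH; last by move=> i; exact: cF.
rewrite -(cintD a b (cF ord0) c1).
by apply: eq_cint => t _; rewrite big_ord_recl.
Qed.

Lemma cint_conj a b F : continuous F ->
  cint a b (fun t => (F t)^*%R) = (cint a b F)^*%R.
Proof.
move=> cF; apply: complex_eq => /=; first by apply: eq_rint => t _ /=; case: (F t).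
rewrite -mulN1r -(rintZ a b (-1) (continuous_Im cF)).
by apply: eq_rint => t _ /=; case: (F t) => x y /=; rewrite mulN1r.
Qed.

Lemma cint_cst a b (k : C) : a <= b -> cint a b (fun=> k) = k * rc (b - a).
Proof.
move=> ab; apply: complex_eq; rewrite ?cReM ?cImM /= (rint_cst _ ab) mulr0.
  by rewrite subr0.
by rewrite add0r.
Qed.

Lemma cint_split a b c F : continuous F -> a <= c -> c <= b ->
  cint a b F = cint a c F + cint c b F.
Proof.
move=> cF ac cb; apply: complex_eq; rewrite ?cReD ?cImD /=; apply: rint_split => //.
  exact: continuous_Re.
exact: continuous_Im.
Qed.

(** The factor 2 is the price of bounding real and imaginary parts separately. *)
Lemma cint_bound a b F M : continuous F -> a <= b ->
  (forall t, a <= t <= b -> modulus (F t) <= M) ->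
  modulus (cint a b F) <= 2 * M * (b - a).
Proof.
move=> cF ab FM; apply: le_trans (modulus_le _) _ => /=.
rewrite -mulrA mulr_natl mulr2n; apply: lerD; apply: rint_bound => //.
- exact: continuous_Re.
- by move=> t /FM; apply: le_trans; exact: normr_Re_le.
- exact: continuous_Im.
- by move=> t /FM; apply: le_trans; exact: normr_Im_le.
Qed.

Lemma cint_fubini (F : R * R -> C) : continuous F ->
  cint 0 1 (fun s => cint 0 1 (fun t => F (s, t))) =
  cint 0 1 (fun t => cint 0 1 (fun s => F (s, t))).
Proof.
move=> cF; apply: complex_eq => /=.
  exact: (rint_fubini (continuous_Re cF)).
exact: (rint_fubini (continuous_Im cF)).
Qed.

Lemma continuous_cint2 (F : R * R -> C) : continuous F ->
  continuous (fun s => cint 0 1 (fun t => F (s, t))).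
Proof.
move=> cF; apply: continuousC.
  exact: (continuous_rint2 (continuous_Re cF)).
exact: (continuous_rint2 (continuous_Im cF)).
Qed.

(** Coordinatewise, in agreement with [curve_deriv], so that the real derivation rules and the real
    fundamental theorem apply. *)
Definition cderiv F G := forall t : R,
  is_derive t (1 : R) (re \o F) (re (G t)) /\ is_derive t (1 : R) (im \o F) (im (G t)).

Lemma eq_cderiv F G H : (forall t, G t = H t) -> cderiv F G -> cderiv F H.
Proof. by move=> GH dF t; rewrite -GH; exact: dF. Qed.

Lemma is_derive_continuous (f g : R -> R) :
  (forall t : R, is_derive t (1 : R) f (g t)) -> continuous f.
Proof.
move=> df t; apply: differentiable_continuous; apply/derivable1_diffP.
exact: ex_derive.
Qed.

Lemma cderiv_continuous F G : cderiv F G -> continuous F.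
Proof.
move=> dF; apply: continuousC.
  exact: (@is_derive_continuous _ (fun t => re (G t)) (fun t => proj1 (dF t))).
exact: (@is_derive_continuous _ (fun t => im (G t)) (fun t => proj2 (dF t))).
Qed.

Lemma cint_FTC a b F G : a <= b -> continuous G -> cderiv F G ->
  cint a b G = F b - F a.
Proof.
move=> ab cG dF; apply: complex_eq; rewrite ?cReD ?cImD ?cReN ?cImN /=.
  exact: (rint_FTC ab (continuous_Re cG) (fun t => proj1 (dF t))).
exact: (rint_FTC ab (continuous_Im cG) (fun t => proj2 (dF t))).
Qed.

Lemma cderiv_cst (k : C) : cderiv (fun=> k) (fun=> 0).
Proof. by move=> t; split; exact: is_derive_cst. Qed.

Lemma cderivD F G dF dG : cderiv F dF -> cderiv G dG ->
  cderiv (fun t => F t + G t) (fun t => dF t + dG t).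
Proof.
move=> hF hG t; rewrite cReD cImD; have [F1 F2] := hF t; have [G1 G2] := hG t; split.
  rewrite (_ : _ \o _ = (re \o F) + (re \o G)); first exact: is_deriveD.
  by apply/funext => s /=; rewrite cReD.
rewrite (_ : _ \o _ = (im \o F) + (im \o G)); first exact: is_deriveD.
by apply/funext => s /=; rewrite cImD.
Qed.

Lemma cderivM F G dF dG : cderiv F dF -> cderiv G dG ->
  cderiv (fun t => F t * G t) (fun t => dF t * G t + F t * dG t).
Proof.
move=> hF hG t; rewrite cReD cImD !cReM !cImM.
have [F1 F2] := hF t; have [G1 G2] := hG t; split.
  rewrite (_ : _ \o _ = (re \o F) * (re \o G) - (im \o F) * (im \o G)).
    by apply: is_derive_eq; rewrite /GRing.scale/=; ring.
  by apply/funext => s /=; rewrite cReM.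
rewrite (_ : _ \o _ = (re \o F) * (im \o G) + (im \o F) * (re \o G)).
  by apply: is_derive_eq; rewrite /GRing.scale/=; ring.
by apply/funext => s /=; rewrite cImM.
Qed.

(** With [N = |F|^2], the inverse of [F] is its conjugate divided by [N]: only a real function has
    to be inverted, and the product rule does the rest. *)
Lemma cderivV F dF : (forall t, F t != 0) -> cderiv F dF ->
  cderiv (fun t => (F t)^-1) (fun t => - dF t * (F t)^-1 ^+ 2).
Proof.
move=> F0 hF.
pose N t : R := re (F t) ^+ 2 + im (F t) ^+ 2.
pose dN t : R := 2 * (re (F t) * re (dF t) + im (F t) * im (dF t)).
have N0 t : N t != 0.
  move: (F0 t); rewrite -modulus_gt0 /modulus sqrtr_gt0.
  by move=> /lt0r_neq0.
have hN t : is_derive t (1 : R) (fun t => (N t)^-1) (- (N t) ^- 2 * dN t).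
  have [F1 F2] := hF t.
  have h : is_derive t (1 : R) N (dN t).
    rewrite (_ : N = (re \o F) * (re \o F) + (im \o F) * (im \o F)).
      apply: is_derive_eq (is_deriveD (is_deriveM F1 F1) (is_deriveM F2 F2)) _.
      by rewrite /dN /GRing.scale/=; ring.
    by apply/funext => s /=; rewrite /N !expr2.
  exact: (@is_deriveV _ _ _ _ _ (N0 t) h).
have E t : (F t)^-1 = rc (N t)^-1 * (F t)^*%R.
  rewrite (_ : (N t) = re (F t) ^+ 2 + im (F t) ^+ 2)//.
  by case: (F t) => x y; apply: complex_eq; rewrite ?cReM ?cImM /=; ring.
have hC : cderiv (fun t => (F t)^*%R) (fun t => (dF t)^*%R).
  move=> t; have [F1 F2] := hF t; split.
    rewrite (_ : _ \o _ = re \o F); last by apply/funext => s /=; case: (F s).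
    by case: (dF t) F1 F2.
  rewrite (_ : _ \o _ = fun s => - im (F s)); last by apply/funext => s /=; case: (F s).
  have -> : im (dF t)^*%R = - im (dF t) by case: (dF t).
  exact: (is_deriveN F2).
have hNC : cderiv (fun t => rc (N t)^-1) (fun t => rc (- (N t) ^- 2 * dN t)).
  by move=> t; split=> /=; [exact: hN|exact: is_derive_cst].
have := cderivM hNC hC.
rewrite (_ : (fun t => rc (N t)^-1 * _) = (fun t => (F t)^-1)); last first.
  by apply/funext => t; rewrite E.
apply: eq_cderiv => t; rewrite E.
apply: complex_eq; rewrite ?cReD ?cImD ?cReM ?cImM ?cReN ?cImN /=.
  move: (N0 t); rewrite /N /dN; case: (F t) => x y; case: (dF t) => x' y' /=.
  by move=> n0; field.
move: (N0 t); rewrite /N /dN; case: (F t) => x y; case: (dF t) => x' y' /=.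
by move=> n0; field.
Qed.

End ComplexIntegral.

(** * Resolvents and cycles *)

Section OperatorAlgebra.
Variables (F : closedFieldType) (V : vectType F).
Implicit Types (T X Y : 'End(V)) (s : seq F).

(** The seed [X] lets the last factor of the product be absorbed into it, which is the form in which
    the resolvent recursion consumes factors. *)
Definition apply_factors T s X : 'End(V) :=
  foldr (fun l Y => ((T - l *: \1) \o Y)%VF) X s.

Lemma apply_factors_rcons T l s X :
  apply_factors T (rcons s l) X = apply_factors T s ((T - l *: \1) \o X)%VF.
Proof. by rewrite /apply_factors foldr_rcons. Qed.

(** Cayley-Hamilton, the characteristic polynomial being split into linear factors over the closed
    field; its roots are eigenvalues. *)
Lemma matrix_annihilator n (A : 'M[F]_n) : exists2 s : seq F,
  {in s, forall l, eigenvalue A l} & foldr (fun l B => B *m (A - l%:M)) 1%:M s = 0.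
Proof.
case: n A => [|n] A; first by exists [::] => //; apply/matrixP => -[].
have [s sE] := closed_field_poly_normal (char_poly A).
move: sE; rewrite (monicP (char_poly_monic A)) scale1r => sE.
exists s => [l ls|]; first by rewrite eigenvalue_root_char sE root_prod_XsubC.
have := Cayley_Hamilton A; rewrite sE rmorph_prod /= => <-.
elim: s {sE} => [|l s IH]; first by rewrite big_nil.
rewrite big_cons /= IH rmorphB /= horner_mx_X horner_mx_C mulmxE.
rewrite -!rmorph_prod.
have -> : A - l%:M = horner_mx A ('X - l%:P) by rewrite rmorphB /= horner_mx_X horner_mx_C.
by rewrite -!rmorphM mulrC.
Qed.

Lemma operator_annihilator T : exists2 s : seq F,
  {in s, forall l, passmx.leigenvalue T l} & apply_factors T s \1%VF = 0.
Proof.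
pose e := vbasis {:V}; have eb : basis_of {:V} e by exact: vbasisP.
have [s sev s0] := matrix_annihilator (passmx.mxof e e T).
exists s => [l /sev|].
  by rewrite /passmx.leigenvalue (passmx.leigenspaceE eb) passmx.vsof_eq0.
apply/eqP; rewrite -(passmx.mxof_eq0 eb eb); apply/eqP; rewrite -[RHS]s0.
elim: s {sev s0} => [|l s IH] /=; first by rewrite passmx.mxof1// (basis_free eb).
rewrite (passmx.mxof_comp e e eb) IH; congr (_ *m _).
rewrite addrC -scaleNr passmx.mxof_linear passmx.mxof1 ?(basis_free eb)//.
by rewrite scaleNr scalemx1 addrC.
Qed.

Section Resolvent.
Variables (T : 'End(V)) (z : F).
Hypothesis Tz : ~~ passmx.leigenvalue T z.

Lemma lker_resolvent : lker (z *: \1 - T)%VF == 0%VS.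
Proof.
move: Tz; rewrite negbK => /eqP kz; apply/eqP/vspaceP => v.
rewrite -kz !memv_ker !add_lfunE !opp_lfunE !scale_lfunE !id_lfunE.
by rewrite -opprB oppr_eq0.
Qed.

Lemma resolventK : ((z *: \1 - T)^-1 \o (z *: \1 - T) = \1)%VF.
Proof. exact: lker0_compVf lker_resolvent. Qed.

Lemma resolventVK : ((z *: \1 - T) \o (z *: \1 - T)^-1 = \1)%VF.
Proof. exact: lker0_compfV lker_resolvent. Qed.

(** From [T - l = (z - l) - (z - T)]. Iterated along an annihilating product it stops, and writes
    the resolvent as a finite sum of fixed operators with rational scalar coefficients in [z]. *)
Lemma resolvent_recursion l X : z != l ->
  ((z *: \1 - T)^-1 \o X)%VF =
  (z - l)^-1 *: (X + ((z *: \1 - T)^-1 \o ((T - l *: \1) \o X)))%VF.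
Proof.
rewrite -subr_eq0 => zl; apply: (canRL (scalerK zl)).
have -> : (T - l *: \1 = (z - l) *: \1 - (z *: \1 - T))%VF.
  by rewrite scalerBl opprB [RHS]addrC subrKA.
rewrite comp_lfunA comp_lfunDr comp_lfunNr resolventK comp_lfunDl comp_lfunNl.
by rewrite -comp_lfunZr comp_lfun1r comp_lfun1l -comp_lfunZl addrCA subrr addr0.
Qed.

End Resolvent.

Lemma resolvent_identity T z w : ~~ passmx.leigenvalue T z ->
  ~~ passmx.leigenvalue T w ->
  (w - z) *: ((w *: \1 - T)^-1 \o (z *: \1 - T)^-1)%VF =
  (z *: \1 - T)^-1%VF - (w *: \1 - T)^-1%VF.
Proof.
move=> hz hw.
have E : (w - z) *: \1%VF = ((w *: \1 - T) - (z *: \1 - T))%VF.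
  by rewrite opprB subrKA scalerBl.
rewrite comp_lfunZl -[((w *: \1 - T)^-1)%VF in LHS]comp_lfun1r comp_lfunZr E.
rewrite comp_lfunDr comp_lfunNr comp_lfunDl comp_lfunNl resolventK// comp_lfun1l.
by rewrite -comp_lfunA resolventVK// comp_lfun1r.
Qed.

End OperatorAlgebra.

(** * Contour integrals, winding numbers and products of simple poles *)

Section Curves.
Variable R : realType.
Local Notation C := (Cx R).
Local Notation re := (@complex.Re R).
Local Notation im := (@complex.Im R).
Local Notation rc := (real_complex R : R -> C).
Implicit Types (gamma : R -> C).

Lemma C1_cderiv gamma : C1_closed_curve gamma -> cderiv gamma (curve_deriv gamma).
Proof.
move=> [_ dg _ _] t; have [d1 d2] := dg t; split => /=.
  by rewrite derive1E; exact: (derivableP d1).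
by rewrite derive1E; exact: (derivableP d2).
Qed.

Lemma continuous_curve_deriv gamma : C1_closed_curve gamma ->
  continuous (curve_deriv gamma).
Proof. by move=> [_ _ c1 c2]; apply: continuousC; [exact: c1|exact: c2]. Qed.

Lemma continuous_C1_curve gamma : C1_closed_curve gamma -> continuous gamma.
Proof. by move=> /C1_cderiv; exact: cderiv_continuous. Qed.

Lemma smooth_C1_closed_curve gamma :
  smooth_closed_curve gamma -> C1_closed_curve gamma.
Proof.
move=> [pg dg]; split=> //; first exact: (dg 0%N).
  move=> t; apply: differentiable_continuous; apply/derivable1_diffP.
  exact: (proj1 (dg 1%N t)).
move=> t; apply: differentiable_continuous; apply/derivable1_diffP.
exact: (proj2 (dg 1%N t)).
Qed.

Lemma two_pi_i_neq0 : two_pi_i R != 0.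
Proof.
apply/eqP => -[] /eqP; rewrite mulrn_eq0 /= gt_eqF//; exact: pi_gt0.
Qed.

Lemma contour_intE gamma (h : C -> C) :
  contour_int gamma h = cint 0 1 (fun t => h (gamma t) * curve_deriv gamma t).
Proof. by []. Qed.

Lemma contour_winding gamma z :
  contour_int gamma (fun w => (w - z)^-1) = two_pi_i R * winding gamma z.
Proof. by rewrite /winding mulrA mulfV ?mul1r// two_pi_i_neq0. Qed.

Lemma contour_int_primitive gamma (f : R -> C) (h : C -> C) :
  C1_closed_curve gamma -> f 1 = f 0 ->
  cderiv f (fun t => h (gamma t) * curve_deriv gamma t) ->
  continuous (fun t => h (gamma t)) -> contour_int gamma h = 0.
Proof.
move=> gC f10 df ch; rewrite contour_intE.
have cG := continuousM_C ch (continuous_curve_deriv gC).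
by rewrite (cint_FTC ler01 cG df) f10 subrr.
Qed.

Definition factors (s : seq C) (z : C) : C := \prod_(l <- s) (z - l)^-1.

Lemma factors_cons l s z : factors (l :: s) z = (z - l)^-1 * factors s z.
Proof. by rewrite /factors big_cons. Qed.

Lemma continuous_inv_sub gamma (l : C) : continuous gamma ->
  (forall t, gamma t != l) -> continuous (fun t => (gamma t - l)^-1).
Proof.
move=> cg gl; apply: continuousV_C => [|t]; last by rewrite subr_eq0.
exact: (continuousB_C cg (@continuous_cstC _ _ l)).
Qed.

Lemma continuous_factors gamma (s : seq C) : continuous gamma ->
  (forall l t, l \in s -> gamma t != l) -> continuous (fun t => factors s (gamma t)).
Proof.
move=> cg; elim: s => [|l s IH] gs.
  rewrite (_ : (fun _ => _) = fun=> 1); first exact: continuous_cstC.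
  by apply/funext => t; rewrite /factors big_nil.
rewrite (_ : (fun _ => _) = fun t => (gamma t - l)^-1 * factors s (gamma t)).
  apply: (@continuousM_C R R).
    by apply: continuous_inv_sub => // t; rewrite gs// mem_head.
  by apply: IH => m t ms; rewrite gs// in_cons ms orbT.
by apply/funext => t; rewrite factors_cons.
Qed.

(** The exponent is at least 2, so [- (z - l)^-(n+1) / (n+1)] is a primitive along the curve, and
    the curve is closed. *)
Lemma contour_int_pole_power gamma (l : C) n : C1_closed_curve gamma ->
  (forall t, gamma t != l) ->
  contour_int gamma (fun z => (z - l)^-1 ^+ n.+2) = 0.
Proof.
move=> gC gl; have [pg _ _ _] := gC.
have cg := continuous_C1_curve gC.
pose h t := (gamma t - l)^-1.
have dh : cderiv h (fun t => - curve_deriv gamma t * h t ^+ 2).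
  apply: cderivV => [t|]; first by rewrite subr_eq0.
  apply: eq_cderiv (cderivD (C1_cderiv gC) (cderiv_cst (- l))) => t.
  by rewrite addr0.
have dhn m : cderiv (fun t => h t ^+ m.+1)
    (fun t => - m.+1%:R * (h t ^+ m.+2 * curve_deriv gamma t)).
  elim: m => [|m IH]; first by apply: eq_cderiv dh => t; ring.
  rewrite (_ : (fun t => _ ^+ _) = fun t => h t * h t ^+ m.+1); last first.
    by apply/funext => t; rewrite exprS.
  apply: eq_cderiv (cderivM dh IH) => t.
  by rewrite -[m.+2%:R]natr1 !exprS; ring.
have chn : continuous (fun t => h t ^+ n.+2).
  elim: (n.+2) => [|m IH]; first exact: continuous_cstC.
  rewrite (_ : (fun t => _ ^+ _) = fun t => h t * h t ^+ m).
    exact: (continuousM_C (continuous_inv_sub cg gl) IH).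
  by apply/funext => t; rewrite exprS.
apply: (@contour_int_primitive gamma (fun t => - (n.+1%:R)^-1 * h t ^+ n.+1) _ gC _ _ chn).
  by rewrite /h -[X in gamma X](add0r 1) pg.
apply: eq_cderiv (cderivM (cderiv_cst (- n.+1%:R^-1)) (dhn n)) => t.
by rewrite mul0r add0r mulrA mulrNN mulVf ?pnatr_eq0// mul1r.
Qed.

Section Cycle.
Variables (n : nat) (Gamma : 'I_n -> R -> C) (S : C -> Prop).
Hypothesis GammaC : forall k, C1_closed_curve (Gamma k).
Hypothesis GammaS : forall l, S l -> forall k t, Gamma k t != l.
Hypothesis Gamma1 : forall l, S l -> \sum_(k < n) winding (Gamma k) l = 1.

Definition cycle_int (h : C -> C) : C := \sum_(k < n) contour_int (Gamma k) h.

Lemma eq_cycle_int (g h : C -> C) : (forall k t, g (Gamma k t) = h (Gamma k t)) ->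
  cycle_int g = cycle_int h.
Proof.
move=> gh; apply: eq_bigr => k _; rewrite !contour_intE.
by apply: eq_cint => t _; rewrite gh.
Qed.

Lemma cycle_intZ (a : C) (h : C -> C) :
  (forall k, continuous (fun t => h (Gamma k t))) ->
  cycle_int (fun z => a * h z) = a * cycle_int h.
Proof.
move=> ch; rewrite mulr_sumr; apply: eq_bigr => k _; rewrite !contour_intE.
rewrite -(cintZ 0 1 a (continuousM_C (ch k) (continuous_curve_deriv (GammaC k)))).
by apply: eq_cint => t _; rewrite mulrA.
Qed.

Lemma cycle_intB (g h : C -> C) :
  (forall k, continuous (fun t => g (Gamma k t))) ->
  (forall k, continuous (fun t => h (Gamma k t))) ->
  cycle_int (fun z => g z - h z) = cycle_int g - cycle_int h.
Proof.
move=> cg ch; rewrite -sumrB; apply: eq_bigr => k _; rewrite !contour_intE.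
have cd := continuous_curve_deriv (GammaC k).
rewrite -(cintB 0 1 (continuousM_C (cg k) cd) (continuousM_C (ch k) cd)).
by apply: eq_cint => t _; rewrite mulrBl.
Qed.

Lemma cycle_intD (g h : C -> C) :
  (forall k, continuous (fun t => g (Gamma k t))) ->
  (forall k, continuous (fun t => h (Gamma k t))) ->
  cycle_int (fun z => g z + h z) = cycle_int g + cycle_int h.
Proof.
move=> cg ch; rewrite -big_split/=; apply: eq_bigr => k _; rewrite !contour_intE.
have cd := continuous_curve_deriv (GammaC k).
rewrite -(cintD 0 1 (continuousM_C (cg k) cd) (continuousM_C (ch k) cd)).
by apply: eq_cint => t _; rewrite mulrDl.
Qed.

Lemma continuous_cycle_factors (s : seq C) : (forall l, l \in s -> S l) ->
  forall k, continuous (fun t => factors s (Gamma k t)).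
Proof.
move=> sS k; apply: continuous_factors => [|l t /sS/GammaS]; last exact.
exact: continuous_C1_curve.
Qed.

Lemma cycle_int_factors1 l : S l -> cycle_int (factors [:: l]) = two_pi_i R.
Proof.
move=> Sl; rewrite -[RHS]mulr1 -(Gamma1 Sl) mulr_sumr; apply: eq_bigr => k _.
rewrite -contour_winding !contour_intE; apply: eq_cint => t _.
by rewrite /factors big_seq1.
Qed.

(* Two distinct poles split by partial fractions; a single repeated pole has a
   primitive. *)
Lemma cycle_int_factors (s : seq C) : (1 < size s)%N -> (forall l, l \in s -> S l) ->
  cycle_int (factors s) = 0.
Proof.
move: {2}(size s) (leqnn (size s)) => m; elim: m s => [|m IH] s.
  by rewrite leqn0 => /eqP ->.
case: s => [|a [|b s]]// sm _ sS.
case: (altP (@allP _ (pred1 a) (b :: s))) => [al|/allPn[c cbs /= ca]].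
  have -> : b :: s = nseq (size s).+1 a by apply/all_pred1P/allP.
  rewrite /cycle_int big1// => k _.
  rewrite -[RHS](@contour_int_pole_power (Gamma k) a (size s)) //; last first.
    by move=> t; apply: GammaS; apply: sS; rewrite mem_head.
  rewrite !contour_intE; apply: eq_cint => t _; congr (_ * _).
  by rewrite /factors big_cons big_nseq iter_mulr_1 -exprS.
pose r := rem c (b :: s).
have pr : perm_eq (a :: b :: s) [:: a, c & r] by rewrite perm_cons perm_to_rem.
have rS l : l \in r -> S l.
  by move=> lr; apply: sS; rewrite (perm_mem pr) !in_cons lr !orbT.
have Sa : S a by apply: sS; rewrite mem_head.
have Sc : S c by apply: sS; rewrite (perm_mem pr) !in_cons eqxx orbT.
have sr : size r = size s by rewrite size_rem.
have xS x : S x -> forall l, l \in x :: r -> S l.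
  by move=> Sx l; rewrite in_cons => /predU1P[->//|/rS].
have ac : a - c != 0 by rewrite subr_eq0 eq_sym.
have E k t : factors (a :: b :: s) (Gamma k t) =
   (a - c)^-1 * (factors (a :: r) (Gamma k t) - factors (c :: r) (Gamma k t)).
  have -> : factors (a :: b :: s) (Gamma k t) = factors [:: a, c & r] (Gamma k t).
    exact: perm_big.
  have za : Gamma k t - a != 0 by rewrite subr_eq0 GammaS.
  have zc : Gamma k t - c != 0 by rewrite subr_eq0 GammaS.
  by rewrite !factors_cons; field; rewrite za zc ac.
apply: etrans (eq_cycle_int (h := fun z => (a - c)^-1 * (factors (a :: r) z - factors (c :: r) z)) E) _.
have ca' := continuous_cycle_factors (xS _ Sa).
have cc' := continuous_cycle_factors (xS _ Sc).
rewrite cycle_intZ; last by move=> k; exact: (continuousB_C (ca' k) (cc' k)).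
rewrite (cycle_intB ca' cc').
suff -> : cycle_int (factors (a :: r)) = cycle_int (factors (c :: r)).
  by rewrite subrr mulr0.
(* With no other factor left, both terms are simple poles; they cancel because the cycle winds once
   around each of them. *)
have [r0|r0] := posnP (size r).
  by rewrite (size0nil r0) !cycle_int_factors1.
rewrite !IH//=; try (by rewrite sr); try exact: xS.
Qed.

End Cycle.
End Curves.

(** * Cycle integrals of the resolvent *)

Section ResolventIntegral.
Variables (R : realType) (V : vectType (Cx R)) (T : 'End(V)).
Local Notation C := (Cx R).

Lemma spectrumNP z : ~ spectrum T z -> ~~ passmx.leigenvalue T z.
Proof. by move=> h; apply/negP. Qed.

Lemma spectrum_annihilator : exists2 s : seq C,
  (forall l, l \in s -> spectrum T l) & apply_factors T s \1%VF = 0.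
Proof. exact: operator_annihilator. Qed.

Section Functional.
(** Operators are tested against an arbitrary linear functional, so that all the analysis stays
    scalar. *)
Variable ell : 'End(V) -> C.
Hypothesis ellD : forall X Y, ell (X + Y) = ell X + ell Y.
Hypothesis ellZ : forall a X, ell (a *: X) = a * ell X.

Let ell0 : ell 0 = 0. Proof. by rewrite -(scale0r 0) ellZ mul0r. Qed.

Lemma functional_resolvent_recursion (X : 'End(V)) z l :
  spectrum T l -> ~ spectrum T z ->
  ell (resolvent T z \o X)%VF =
  (z - l)^-1 * (ell X + ell (resolvent T z \o ((T - l *: \1) \o X))%VF).
Proof.
move=> Tl Tz; rewrite -ellD -ellZ.
have zl : z != l by apply/eqP => zl; apply: Tz; rewrite zl.
exact: (congr1 ell (resolvent_recursion (spectrumNP Tz) X zl)).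
Qed.

(** Induction along an annihilating product of [X]: the recursion expresses the resolvent at [X]
    through the resolvent at [(T - l) X], which is annihilated by one factor less; with no factor
    left, [X] is 0. *)
Lemma continuous_functional_resolvent (gamma : R -> C) (X : 'End(V)) :
  continuous gamma -> (forall t, ~ spectrum T (gamma t)) ->
  continuous (fun t => ell (resolvent T (gamma t) \o X)%VF).
Proof.
move=> cg gT; have [s sT s1] := spectrum_annihilator.
have {s1} : apply_factors T s X = 0.
  suff h : forall Y, apply_factors T s (Y \o X)%VF = (apply_factors T s Y \o X)%VF.
    by rewrite -[X]comp_lfun1l h s1 comp_lfun0l.
  by move=> Y; elim: s {sT s1} => //= l s ->; rewrite comp_lfunA.
elim/last_ind: s X sT => [|s l IH] X sT.
  rewrite /apply_factors/= => ->; rewrite (_ : (fun _ => _) = fun=> 0).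
    exact: continuous_cstC.
  by apply/funext => t; rewrite comp_lfun0r ell0.
have Tl : spectrum T l by apply: sT; rewrite mem_rcons mem_head.
rewrite apply_factors_rcons => /IH IH'.
have sT' m : m \in s -> spectrum T m by move=> ms; apply: sT; rewrite mem_rcons in_cons ms orbT.
rewrite (_ : (fun _ => _) = fun t => (gamma t - l)^-1 *
    (ell X + ell (resolvent T (gamma t) \o ((T - l *: \1) \o X))%VF)); last first.
  by apply/funext => t; apply: functional_resolvent_recursion.
have c1 : continuous (fun t => (gamma t - l)^-1).
  by apply: (continuous_inv_sub cg) => t; apply/eqP => gl; apply: (gT t); rewrite gl.
exact: (continuousM_C c1 (continuousD_C (@continuous_cstC _ _ (ell X)) (IH' sT'))).
Qed.

Variables (n : nat) (Gamma : 'I_n -> R -> C).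
Hypothesis GammaC : forall k, C1_closed_curve (Gamma k).
Hypothesis GammaT : forall k t, ~ spectrum T (Gamma k t).
Hypothesis Gamma1 : forall l, spectrum T l -> \sum_(k < n) winding (Gamma k) l = 1.

Let GammaS : forall l, spectrum T l -> forall k t, Gamma k t != l.
Proof. by move=> l Tl k t; apply/eqP => gl; apply: (@GammaT k t); rewrite gl. Qed.

(* Peeling the factors of an annihilating product of the T - l turns the
   resolvent into a Newton sum, only whose first term has a residue. *)
Lemma cycle_int_resolvent :
  cycle_int Gamma (fun z => ell (resolvent T z)) = two_pi_i R * ell \1%VF.
Proof.
have cR X k := @continuous_functional_resolvent _ X (continuous_C1_curve (GammaC k)) (@GammaT k).
have [s sT s1] := spectrum_annihilator.
(* [p] collects the poles peeled off so far; once it is nonempty, every further term has at least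
   two poles and integrates to 0. *)
suff H : forall X p, (forall l, l \in p -> spectrum T l) -> apply_factors T s X = 0 ->
  cycle_int Gamma (fun z => factors p z * ell (resolvent T z \o X)%VF) =
  if p is [::] then two_pi_i R * ell X else 0.
  rewrite -(H \1%VF [::])//; apply: eq_cycle_int => k t.
  by rewrite comp_lfun1r /factors big_nil mul1r.
elim/last_ind: s sT {s1} => [|s l IH] sT X p pT.
  rewrite /apply_factors/= => ->.
  rewrite (eq_cycle_int (h := fun=> 0 * 0)).
    rewrite cycle_intZ//; last by move=> k; exact: continuous_cstC.
    by rewrite mul0r ell0 mulr0; case: p pT.
  by move=> k t; rewrite comp_lfun0r ell0 !mulr0.
have Tl : spectrum T l by apply: sT; rewrite mem_rcons mem_head.
have sT' m : m \in s -> spectrum T m by move=> ms; apply: sT; rewrite mem_rcons in_cons ms orbT.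
have lpT m : m \in l :: p -> spectrum T m by rewrite in_cons => /predU1P[->//|/pT].
rewrite apply_factors_rcons => /(IH sT' _ (l :: p) lpT) /= IH'.
pose Y := ((T - l *: \1) \o X)%VF.
rewrite (eq_cycle_int (h := fun z => ell X * factors (l :: p) z +
   factors (l :: p) z * ell (resolvent T z \o Y)%VF)); last first.
  move=> k t; rewrite (functional_resolvent_recursion _ Tl (@GammaT k t)).
  by rewrite factors_cons mulrCA mulrA mulrDr [ell X * _]mulrC.
have cf := continuous_cycle_factors GammaC GammaS lpT.
have cX k := continuousM_C (@continuous_cstC R R (ell X)) (cf k).
have cY k := continuousM_C (cf k) (cR Y k).
rewrite (cycle_intD GammaC cX cY) IH' addr0 (cycle_intZ GammaC _ cf).
case: p pT lpT {IH' cf cX cY} => [|m p] pT lpT.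
  by rewrite (cycle_int_factors1 Gamma1 Tl) mulrC.
by rewrite (cycle_int_factors GammaC GammaS Gamma1 _ lpT) ?mulr0.
Qed.

End Functional.
End ResolventIntegral.

(** * Cauchy's formula up to the boundary *)

Section Bisection.
Variable R : realType.
Implicit Types (s t : R).

(** The left ends increase and stay below every right end, so their supremum lies in all the
    intervals. *)
Lemma nested_halves (x : nat -> R) (L : R) : 0 <= L ->
  (forall n, x n <= x n.+1 /\ x n.+1 + L * 2 ^- n.+1 <= x n + L * 2 ^- n) ->
  exists c, forall n, x n <= c <= x n + L * 2 ^- n.
Proof.
move=> L0 hx.
have p0 n : 0 <= L * 2 ^- n by rewrite mulr_ge0// invr_ge0 exprn_ge0.
have up n m : x n <= x (n + m)%N /\ x (n + m)%N + L * 2 ^- (n + m) <= x n + L * 2 ^- n.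
  elim: m => [|m [h1 h2]]; first by rewrite addn0.
  have [h3 h4] := hx (n + m)%N; rewrite addnS.
  by split; [exact: le_trans h1 h3|exact: le_trans h4 h2].
have xy n m : x n <= x m + L * 2 ^- m.
  have [nm|/ltnW mn] := leqP n m.
    have [h _] := up n (m - n)%N; rewrite subnKC// in h.
    by apply: le_trans h _; rewrite lerDl.
  have [_ h] := up m (n - m)%N; rewrite subnKC// in h.
  by apply: le_trans h; rewrite lerDl.
exists (sup (range x)) => n; apply/andP; split.
  apply: ub_le_sup; last by exists n.
  by exists (x 0%N + L * 2 ^- 0) => _ [m _ <-]; exact: xy.
by apply: ge_sup => [|_ [m _ <-]]; [exists (x n), n|exact: xy].
Qed.

(** [Q s t n] speaks of the rectangle with lower corner [(s, t)] and sides [L / 2^n], [M / 2^n]. If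
    [Q] failed on the whole, a failing quarter could be chosen at each stage; these shrink to a
    point [(c, d)], around which [Q] holds on all small rectangles. *)
Lemma bisection_principle (Q : R -> R -> nat -> Prop) (s0 t0 L M : R) :
  0 <= L -> 0 <= M ->
  (forall s t n, (forall i j : bool,
     Q (s + i%:R * (L * 2 ^- n.+1)) (t + j%:R * (M * 2 ^- n.+1)) n.+1) -> Q s t n) ->
  (forall c d, s0 <= c <= s0 + L -> t0 <= d <= t0 + M ->
     \forall n \near \oo, forall s t, s <= c <= s + L * 2 ^- n ->
       t <= d <= t + M * 2 ^- n -> s0 <= s -> s + L * 2 ^- n <= s0 + L ->
       t0 <= t -> t + M * 2 ^- n <= t0 + M -> Q s t n) ->
  Q s0 t0 0%N.
Proof.
move=> L0 M0 sub loc; apply: contrapT => nQ.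
pose child (p : R * R) n (q : bool * bool) : R * R :=
  (p.1 + q.1%:R * (L * 2 ^- n.+1), p.2 + q.2%:R * (M * 2 ^- n.+1)).
have /choice[q hq] : forall pn : (R * R) * nat, exists q : bool * bool,
    ~ Q pn.1.1 pn.1.2 pn.2 ->
    ~ Q (child pn.1 pn.2 q).1 (child pn.1 pn.2 q).2 pn.2.+1.
  move=> [p n] /=; apply: contrapT => h.
  have npQ : ~ Q p.1 p.2 n by move=> Qp; apply: h; exists (true, true).
  apply: npQ; apply: sub => i j; apply: contrapT => nq.
  by apply: h; exists (i, j).
pose x := fix x n := if n is m.+1 then child (x m) m (q (x m, m)) else (s0, t0).
have nQx n : ~ Q (x n).1 (x n).2 n by elim: n => //= n IH; exact: (hq (x n, n)).
have step (i : bool) N n : 0 <= N -> forall y : R,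
    y <= y + i%:R * (N * 2 ^- n.+1) /\
    y + i%:R * (N * 2 ^- n.+1) + N * 2 ^- n.+1 <= y + N * 2 ^- n.
  move=> N0 y; have h : N * 2 ^- n = N * 2 ^- n.+1 + N * 2 ^- n.+1.
    by rewrite exprS invfM -mulrDr; congr (_ * _); field; rewrite expf_neq0.
  have h0 : 0 <= N * 2 ^- n.+1 by rewrite mulr_ge0// invr_ge0 exprn_ge0.
  by rewrite h; case: i; rewrite ?mul1r ?mul0r; split; lra.
have h1 n : (x n).1 <= (x n.+1).1 /\
    (x n.+1).1 + L * 2 ^- n.+1 <= (x n).1 + L * 2 ^- n by exact: step.
have h2 n : (x n).2 <= (x n.+1).2 /\
    (x n.+1).2 + M * 2 ^- n.+1 <= (x n).2 + M * 2 ^- n by exact: step.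
have [c hc] := nested_halves L0 h1.
have [d hd] := nested_halves M0 h2.
have in1 n : s0 <= (x n).1 /\ (x n).1 + L * 2 ^- n <= s0 + L.
  elim: n => [|n [a1 a2]]; first by rewrite expr0 invr1 mulr1.
  have [b1 b2] := h1 n.
  by split; [exact: le_trans a1 b1|exact: le_trans b2 a2].
have in2 n : t0 <= (x n).2 /\ (x n).2 + M * 2 ^- n <= t0 + M.
  elim: n => [|n [a1 a2]]; first by rewrite expr0 invr1 mulr1.
  have [b1 b2] := h2 n.
  by split; [exact: le_trans a1 b1|exact: le_trans b2 a2].
have c0 : s0 <= c <= s0 + L by have := hc 0%N; rewrite /= expr0 invr1 mulr1.
have d0 : t0 <= d <= t0 + M by have := hd 0%N; rewrite /= expr0 invr1 mulr1.
have [n _ hn] := loc c d c0 d0.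
have [i1 i2] := in1 n; have [j1 j2] := in2 n.
exact: (nQx n (hn n (leqnn n) _ _ (hc n) (hd n) i1 i2 j1 j2)).
Qed.

End Bisection.

(** * Goursat's theorem in star-shaped coordinates around [z] *)

Section Goursat.
Variable R : realType.
Local Notation C := (Cx R).
Local Notation re := (@complex.Re R).
Local Notation im := (@complex.Im R).
Local Notation rc := (real_complex R : R -> C).

Lemma modulus_bounded (F : R -> C) a b : continuous F ->
  exists2 M, 0 < M & forall t, a <= t <= b -> modulus (F t) <= M.
Proof.
move=> cF; have [ab|ba] := leP a b; last first.
  by exists 1 => // t /andP[at_ tb]; have := lt_le_trans ba (le_trans at_ tb); rewrite ltxx.
have cm : {within `[a, b], continuous (@modulus R \o F)}.
  by apply: continuous_subspaceT; exact: continuous_modulus.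
have [c cab hc] := EVT_max ab cm.
exists (modulus (F c) + 1); first by rewrite ltr_wpDl// modulus_ge0.
move=> t tab; apply: (le_trans (hc t _)); first by rewrite in_itv.
by rewrite /= lerDl.
Qed.

Variables (gamma : R -> C) (z : C) (g : R -> R -> C) (a b : R).
Hypothesis gammaC : C1_closed_curve gamma.
Hypothesis gammaz : forall t, gamma t != z.
Hypothesis a0 : 0 < a.
Hypothesis ab : a <= b.
Hypothesis b1 : b <= 1.
Let w s t : C := z + rc s * (gamma t - z).
Let k t : C := curve_deriv gamma t * (gamma t - z)^-1.
Hypothesis cg : continuous (fun p : R * R => g p.1 p.2).
Hypothesis g10 : forall s, g s 1 = g s 0.
(** [g] stands for a function of [w] read in the coordinates [(s, t)]. Increments are compared with
    those of [w], with a complex factor [B]: this is complex differentiability, not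
    differentiability in [(s, t)]. *)
Hypothesis g_diff : forall s t, a <= s <= b -> exists B : C, forall e, 0 < e ->
  exists2 d, 0 < d & forall s' t', a <= s' <= b -> modulus (w s' t' - w s t) < d ->
    modulus (g s' t' - g s t - B * (w s' t' - w s t)) <= e * modulus (w s' t' - w s t).

Let cgamma := continuous_C1_curve gammaC.
Let cdg := continuous_curve_deriv gammaC.

Let ck : continuous k.
Proof. exact: (continuousM_C cdg (continuous_inv_sub cgamma gammaz)). Qed.

(* The boundary integral of h (dw / (w - z)) in the coordinates (s, t), where
   w - z = s (gamma t - z). *)
Let D (h : R -> R -> C) s1 s2 t1 t2 : C :=
  cint t1 t2 (fun t => (h s2 t - h s1 t) * k t) -
  cint s1 s2 (fun s => (h s t2 - h s t1) * (rc (Num.max a s))^-1).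

(** [Num.max a s] equals [s] on the strip and keeps the denominator away from 0 elsewhere, which
    makes the integrand continuous on the whole line. *)
Let cinv : continuous (fun s => (rc (Num.max a s))^-1).
Proof.
apply: continuousV_C => [|s].
  move=> s; apply: (@continuous_comp _ _ _ (fun s => Num.max a s) rc).
    by apply: continuous_max; [exact: cvg_cst|exact: cvg_id].
  exact: rc_continuous.
have : Num.max a s != 0 by rewrite gt_eqF// lt_max a0.
by apply: contra => /eqP[/eqP].
Qed.

(** Each side of a rectangle freezes one variable, so separate continuity is what the side integrals
    ask for. *)
Definition sep_continuous (h : R -> R -> C) :=
  (forall s, continuous (h s)) /\ (forall t, continuous (h^~ t)).

Let cD1 h s1 s2 : sep_continuous h -> continuous (fun t => (h s2 t - h s1 t) * k t).
Proof. by move=> [c1 c2]; exact: (continuousM_C (continuousB_C (c1 s2) (c1 s1)) ck). Qed.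

Let cD2 h t1 t2 : sep_continuous h ->
  continuous (fun s => (h s t2 - h s t1) * (rc (Num.max a s))^-1).
Proof. by move=> [c1 c2]; exact: (continuousM_C (continuousB_C (c2 t2) (c2 t1)) cinv). Qed.

Let D_split1 h s1 s2 s3 t1 t2 : sep_continuous h -> s1 <= s2 -> s2 <= s3 ->
  D h s1 s3 t1 t2 = D h s1 s2 t1 t2 + D h s2 s3 t1 t2.
Proof.
move=> ch s12 s23; rewrite /D (cint_split (@cD2 h t1 t2 ch) s12 s23).
rewrite opprD addrACA -(cintD _ _ (@cD1 h s1 s2 ch) (@cD1 h s2 s3 ch)).
by congr (_ + _); apply: eq_cint => t _; ring.
Qed.

Let D_split2 h s1 s2 t1 t2 t3 : sep_continuous h -> t1 <= t2 -> t2 <= t3 ->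
  D h s1 s2 t1 t3 = D h s1 s2 t1 t2 + D h s1 s2 t2 t3.
Proof.
move=> ch t12 t23; rewrite /D (cint_split (@cD1 h s1 s2 ch) t12 t23).
rewrite addrACA; congr (_ + _); rewrite -opprD; congr (- _).
rewrite -(cintD _ _ (@cD2 h t1 t2 ch) (@cD2 h t2 t3 ch)).
by apply: eq_cint => s _; ring.
Qed.

Let DB h1 h2 s1 s2 t1 t2 : sep_continuous h1 -> sep_continuous h2 ->
  D (fun s t => h1 s t - h2 s t) s1 s2 t1 t2 = D h1 s1 s2 t1 t2 - D h2 s1 s2 t1 t2.
Proof.
move=> c1 c2; rewrite /D.
have -> : cint t1 t2 (fun t => (h1 s2 t - h2 s2 t - (h1 s1 t - h2 s1 t)) * k t) =
    cint t1 t2 (fun t => (h1 s2 t - h1 s1 t) * k t) -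
    cint t1 t2 (fun t => (h2 s2 t - h2 s1 t) * k t).
  rewrite -(cintB _ _ (@cD1 h1 s1 s2 c1) (@cD1 h2 s1 s2 c2)).
  by apply: eq_cint => t _; ring.
have -> : cint s1 s2 (fun s => (h1 s t2 - h2 s t2 - (h1 s t1 - h2 s t1)) *
      (rc (Num.max a s))^-1) =
    cint s1 s2 (fun s => (h1 s t2 - h1 s t1) * (rc (Num.max a s))^-1) -
    cint s1 s2 (fun s => (h2 s t2 - h2 s t1) * (rc (Num.max a s))^-1).
  rewrite -(cintB _ _ (@cD2 h1 t1 t2 c1) (@cD2 h2 t1 t2 c2)).
  by apply: eq_cint => t _; ring.
ring.
Qed.

Let sep_w : sep_continuous w.
Proof.
split=> [s|t].
  exact: (continuousD_C (@continuous_cstC _ _ z) (continuousM_C (@continuous_cstC _ _ (rc s)) (continuousB_C cgamma (@continuous_cstC _ _ z)))).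
exact: (continuousD_C (@continuous_cstC _ _ z) (continuousM_C (@rc_continuous R) (@continuous_cstC _ _ (gamma t - z)))).
Qed.

(** The constant [A] cancels in the differences, and both pairs of opposite sides yield
    [B (s2 - s1) (gamma t2 - gamma t1)]. *)
Let D_affine A B s1 s2 t1 t2 : a <= s1 -> s1 <= s2 -> t1 <= t2 ->
  D (fun s t => A + B * w s t) s1 s2 t1 t2 = 0.
Proof.
move=> as1 s12 t12; rewrite /D.
rewrite (@eq_cint _ t1 t2 _ (fun t => (B * rc (s2 - s1)) * curve_deriv gamma t)); last first.
  move=> t _; rewrite /w /k rmorphB /=.
  have gz : gamma t - z != 0 by rewrite subr_eq0.
  by field.
rewrite (@eq_cint _ s1 s2 _ (fun=> B * (gamma t2 - gamma t1))); last first.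
  move=> s /andP[s1s _]; rewrite max_r ?(le_trans as1)// /w.
  have s0 : rc s != 0.
    apply/eqP => -[s0]; have := lt_le_trans a0 (le_trans as1 s1s).
    by rewrite s0 ltxx.
  by field.
rewrite cint_cst// (cintZ _ _ _ cdg) (cint_FTC t12 cdg (C1_cderiv gammaC)).
by rewrite mulrAC subrr.
Qed.

(** As [g] agrees at [t = 0] and [t = 1], the difference of the two integrals is [D] over [[a, b] x
    [0, 1]]. On a cell of scale [h] an affine approximation of [g] contributes nothing, and the
    remainder is small against [h] on sides of length [O(h)], so [D] is at most [eta h^2]. This
    bound scales like the area, so those of the four quarters add up to that of the whole. *)
Lemma goursat : cint 0 1 (fun t => g b t * k t) = cint 0 1 (fun t => g a t * k t).
Proof.
have sg : sep_continuous g.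
  split=> [s|t]; first exact: (@continuous_pair2 R C (fun p => g p.1 p.2) s cg).
  exact: (@continuous_pair1 R C (fun p => g p.1 p.2) t cg).
apply/eqP; rewrite -subr_eq0; apply/eqP.
have -> : cint 0 1 (fun t => g b t * k t) - cint 0 1 (fun t => g a t * k t) = D g a b 0 1.
  rewrite -(cintB _ _ (continuousM_C (sg.1 b) ck) (continuousM_C (sg.1 a) ck)) /D.
  rewrite [X in _ = _ - X](_ : _ = 0) ?subr0.
    by apply: eq_cint => t _; rewrite mulrBl.
  rewrite -[RHS](cint0 a b); apply: eq_cint => s _.
  by rewrite g10 subrr mul0r.
have [M0 M00 hM0] := @modulus_bounded (fun t => gamma t - z) 0 1 (continuousB_C cgamma (@continuous_cstC _ _ z)).
have [M1 M10 hM1] := @modulus_bounded _ 0 1 cdg.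
have [M2 M20 hM2] := @modulus_bounded _ 0 1 ck.
(* [K h] bounds the distance of any two values of [w] on a cell of scale [h]: [M0 L] accounts for
   the variation in [s], [2 M1] for that in [t]. *)
pose L := b - a; pose K := M0 * L + 2 * M1.
have L0 : 0 <= L by rewrite subr_ge0.
have K0 : 0 < K by rewrite ltr_wpDl ?mulr_ge0// ?mulr_gt0// ltW.
(* The product collects the constants of the two side integrals of the remainder; approximating [g]
   with precision [eta / E] absorbs them. The added 1 keeps [E] positive. *)
pose E := K * (4 * M2 + 4 * L / a) + 1.
have X0 : 0 <= 4 * M2 + 4 * L / a.
  apply: addr_ge0; first by apply: mulr_ge0 => //; exact: ltW.
  by apply: divr_ge0; [exact: mulr_ge0|exact: ltW].
have E0 : 0 < E by rewrite ltr_wpDl// mulr_ge0// ltW.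
apply/eqP; rewrite -modulus_eq0; apply/eqP/le_anti; rewrite modulus_ge0 andbT.
apply/ler_addgt0Pr => eta eta0; rewrite add0r.
pose Q s t n := modulus (D g s (s + L * 2 ^- n) t (t + 1 * 2 ^- n)) <= eta * (2 ^- n) ^+ 2.
have : Q a 0 0%N.
  apply: (@bisection_principle R Q a 0 L 1) => //.
    move=> s t n hQ; rewrite /Q.
    pose h : R := 2 ^- n.+1.
    have h0 : 0 <= h by rewrite invr_ge0 exprn_ge0.
    have hh : 2 ^- n = h + h :> R.
      by rewrite /h exprS invfM; field; rewrite expf_neq0.
    have Lh0 : 0 <= L * h by rewrite mulr_ge0.
    have q00 := hQ false false; have q01 := hQ false true.
    have q10 := hQ true false; have q11 := hQ true true.
    move: q00 q01 q10 q11; rewrite /Q -/h !mul0r !addr0 !mul1r.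
    move=> q00 q01 q10 q11; rewrite hh mulrDr !addrA.
    rewrite (@D_split1 g s (s + L * h)) ?lerDl//.
    rewrite (@D_split2 g s (s + L * h) t (t + h) (t + h + h)) ?lerDl//.
    rewrite (@D_split2 g (s + L * h) (s + L * h + L * h) t (t + h) (t + h + h)) ?lerDl//.
    have -> : eta * (h + h) ^+ 2 =
        (eta * h ^+ 2 + eta * h ^+ 2) + (eta * h ^+ 2 + eta * h ^+ 2) by ring.
    apply: le_trans (modulusD _ _) _; apply: lerD;
      by apply: le_trans (modulusD _ _) _; apply: lerD.
  move=> c d cab d01.
  have {}cab : a <= c <= b by move: cab; rewrite /L addrC subrK.
  have {}d01 : 0 <= d <= 1 by move: d01; rewrite add0r.
  have [B hB] := g_diff d cab.
  have eE0 : 0 < eta / E by rewrite divr_gt0.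
  have [d0 d00 {}hB] := hB _ eE0.
  near=> n => s t; set h : R := 2 ^- n; rewrite !mul1r add0r => sc td as_ sb t0 t1.
  have h0 : 0 < h by rewrite invr_gt0 exprn_gt0.
  have Khd : K * h < d0.
    rewrite ltr_pdivrMr ?exprn_gt0// mulrC -ltr_pdivrMr//.
    apply: (@lt_le_trans _ _ n%:R); first by near: n; exact: nbhs_infty_gtr.
    by rewrite -natrX ler_nat ltnW// ltn_expl.
  have sb' : s + L * h <= b by apply: le_trans sb _; rewrite /L addrC subrK.
  pose r s' t' := g s' t' - (g c d - B * w c d + B * w s' t').
  have wK s' t' : s <= s' <= s + L * h -> t <= t' <= t + h ->
      modulus (w s' t' - w c d) <= K * h.
    move=> /andP[ss' s's] /andP[tt' t't].
    have -> : w s' t' - w c d = rc (s' - c) * (gamma t' - z) + rc c * (gamma t' - gamma d).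
      by rewrite /w rmorphB /=; ring.
    apply: le_trans (modulusD _ _) _; rewrite !modulusM !modulus_rc.
    move/andP: sc => [sc cs]; move/andP: td => [td dt]; move/andP: cab => [ac cb].
    have c1 : `|c| <= 1 by rewrite ger0_norm ?(le_trans cb)// (le_trans (ltW a0)).
    have -> : K * h = (L * h) * M0 + 1 * (2 * M1 * h) by rewrite /K; ring.
    have t'01 : 0 <= t' <= 1 by rewrite (le_trans t0)// (le_trans t't).
    apply: lerD; apply: ler_pM; rewrite ?normr_ge0 ?modulus_ge0//.
    - by rewrite ler_norml; apply/andP; split; lra.
    - exact: hM0.
    have gbd x y : 0 <= x -> x <= y -> y <= 1 -> y - x <= h -> modulus (gamma y - gamma x) <= 2 * M1 * h.
      move=> x0 xy y1 yxh; rewrite -(cint_FTC xy cdg (C1_cderiv gammaC)).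
      apply: le_trans (cint_bound (M := M1) cdg xy _) _.
        by move=> u /andP[xu uy]; apply: hM1; rewrite (le_trans x0)// (le_trans uy).
      by rewrite ler_pM2l// mulr_gt0.
    have [dt'|/ltW t'd] := leP d t'.
      by apply: gbd => //; lra.
    by rewrite modulusB; apply: gbd => //; lra.
  have rK s' t' : s <= s' <= s + L * h -> t <= t' <= t + h ->
      modulus (r s' t') <= eta / E * (K * h).
    move=> hs ht; have wk := wK _ _ hs ht.
    rewrite (_ : r s' t' = g s' t' - g c d - B * (w s' t' - w c d)); last by rewrite /r; ring.
    apply: le_trans (hB s' t' _ _) _; last by rewrite ler_pM2l.
      by move/andP: hs => [h1 h2]; rewrite (le_trans as_ h1) (le_trans h2).
    exact: le_lt_trans wk Khd.
  have sA : sep_continuous (fun s' t' => g c d - B * w c d + B * w s' t').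
    split=> x.
      exact: (continuousD_C (@continuous_cstC _ _ _) (continuousM_C (@continuous_cstC _ _ B) (sep_w.1 x))).
    exact: (continuousD_C (@continuous_cstC _ _ _) (continuousM_C (@continuous_cstC _ _ B) (sep_w.2 x))).
  have sr : sep_continuous r.
    split=> x.
      exact: (continuousB_C (sg.1 x) (sA.1 x)).
    exact: (continuousB_C (sg.2 x) (sA.2 x)).
  have sLh : s <= s + L * h by rewrite lerDl mulr_ge0// ltW.
  have th : t <= t + h by rewrite lerDl ltW.
  rewrite /Q !mul1r -/h.
  have -> : D g s (s + L * h) t (t + h) = D r s (s + L * h) t (t + h).
    by rewrite (DB _ _ _ _ sg sA) D_affine// subr0.
  set e := eta / E * (K * h) in rK.
  have e0 : 0 <= e by rewrite !mulr_ge0// ?invr_ge0 ltW.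
  have b1' : modulus (cint t (t + h) (fun t' => (r (s + L * h) t' - r s t') * k t'))
      <= 2 * ((e + e) * M2) * (t + h - t).
    apply: (cint_bound (@cD1 r s (s + L * h) sr) th).
    move=> u /andP[tu uth]; rewrite modulusM; apply: ler_pM; rewrite ?modulus_ge0//.
      apply: le_trans (modulusD _ _) _; rewrite modulusN; apply: lerD; apply: rK;
        by rewrite ?lexx ?sLh ?tu.
    by apply: hM2; rewrite (le_trans t0 tu) (le_trans uth).
  have b2' : modulus (cint s (s + L * h) (fun s' => (r s' (t + h) - r s' t) * (rc (Num.max a s'))^-1))
      <= 2 * ((e + e) * a^-1) * (s + L * h - s).
    apply: (cint_bound (@cD2 r t (t + h) sr) sLh).
    move=> u /andP[su ush]; rewrite modulusM modulusV modulus_rc.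
    apply: ler_pM; rewrite ?modulus_ge0 ?invr_ge0//.
      apply: le_trans (modulusD _ _) _; rewrite modulusN; apply: lerD; apply: rK;
        by rewrite ?lexx ?th ?su.
    have au : a <= u by exact: le_trans as_ su.
    rewrite max_r// ger0_norm ?(le_trans (ltW a0))//.
    by rewrite lef_pV2 ?posrE// (lt_le_trans a0).
  apply: le_trans (modulusD _ _) _; rewrite modulusN.
  apply: le_trans (lerD b1' b2') _.
  have -> : 2 * ((e + e) * M2) * (t + h - t) + 2 * ((e + e) / a) * (s + L * h - s) =
    (eta * h ^+ 2) * (K * (4 * M2 + 4 * L / a) / E).
    by rewrite /e; field; rewrite gt_eqF//= gt_eqF.
  rewrite -[leRHS]mulr1 ler_pM2l ?mulr_gt0 ?exprn_gt0//.
  by rewrite ler_pdivrMr// mul1r /E lerDl.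
rewrite /Q expr0 invr1 !mulr1 expr1n mulr1 add0r.
by rewrite /L addrC subrK.
Unshelve. all: by end_near. Qed.

End Goursat.

(** * Segments in convex domains and the Cauchy formula *)

Section Cauchy.
Variable R : realType.
Local Notation C := (Cx R).
Local Notation re := (@complex.Re R).
Local Notation im := (@complex.Im R).
Local Notation rc := (real_complex R : R -> C).
Implicit Types (Omega : set C) (f : C -> C) (gamma : R -> C).

Lemma nbhs_modulusP (z : C) (P : set C) : nbhs z P <->
  exists2 d, 0 < d & forall w, modulus (z - w) < d -> P w.
Proof.
split=> [/nbhs_ballP[_ /gt0_rc[d d0 ->] dP]|[d d0 dP]].
  by exists d => // w zw; apply: dP; rewrite /ball/= normCE ltcR.
by apply: filterS (near_modulus z d0) => w; exact: dP.
Qed.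

Lemma open_modulusP Omega z : open Omega -> Omega z ->
  exists2 d, 0 < d & forall w, modulus (z - w) < d -> Omega w.
Proof. by move=> oO Oz; apply/nbhs_modulusP; exact: open_nbhs_nbhs. Qed.

Lemma closure_modulus Omega p d : closure Omega p -> 0 < d ->
  exists2 q, Omega q & modulus (p - q) < d.
Proof.
move=> cp d0; have [q [Oq pq]] := cp _ (near_modulus p d0).
by exists q.
Qed.

Lemma convex_setC Omega x y (r : R) : @convex_set _ C^o Omega ->
  Omega x -> Omega y -> 0 <= r <= 1 -> Omega (rc r * x + rc (1 - r) * y).
Proof.
move=> cO Ox Oy /andP[r0 r1].
have h0 : 0 <= rc r by rewrite ler0c.
have h1 : rc r <= 1 by rewrite -[1]/(rc 1) lecR.
have := cO x y (Itv01 h0 h1); rewrite !inE => /(_ Ox Oy) xy.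
by rewrite rmorphB; exact: xy.
Qed.

(** Replace [p] by a nearby [q] in [Omega] and move the error to the other end: the point equals
    [s q + (1 - s) z'] with [z' = z + s (p - q) / (1 - s)], which stays in [Omega] once
    [|p - q| < d (1 - s)]. *)
Lemma convex_closure_segment Omega p z (s : R) : open Omega ->
  @convex_set _ C^o Omega -> closure Omega p -> Omega z -> 0 <= s < 1 ->
  Omega (z + rc s * (p - z)).
Proof.
move=> oO cO cp Oz /andP[s0 s1].
have [d d0 dO] := open_modulusP oO Oz.
have s10 : 0 < 1 - s by rewrite subr_gt0.
have [q Oq pq] := closure_modulus cp (mulr_gt0 d0 s10).
have rs1 : rc (1 - s) != 0.
  by apply/eqP => -[h]; move: s10; rewrite h ltxx.
have Oz' : Omega (z + rc s / rc (1 - s) * (p - q)).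
  apply: dO; rewrite opprD addrA subrr add0r modulusN modulusM -fmorphV -rmorphM.
  rewrite modulus_rc ger0_norm ?divr_ge0 ?(ltW s10)//.
  rewrite mulrAC ltr_pdivrMr//; apply: le_lt_trans pq.
  by rewrite ler_piMl ?modulus_ge0// ltW.
have := convex_setC cO Oq Oz' (_ : 0 <= s <= 1); rewrite s0 (ltW s1) => /(_ isT).
congr (Omega _); rewrite mulrDr mulrA mulrCA mulfV// mulr1 rmorphB /=; ring.
Qed.

(** Scalars are complex, so derivability along 1 is holomorphy, recast here as a first-order
    expansion in the form used by Goursat's argument. *)
Lemma derivable_local f z : derivable f z 1 -> exists B : C, forall e : R, 0 < e ->
  exists2 d : R, 0 < d & forall w, modulus (w - z) < d ->
    modulus (f w - f z - B * (w - z)) <= e * modulus (w - z).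
Proof.
move=> df; exists (lim (h^-1 *: (f (h *: 1 + z) - f z) @[h --> 0^'])) => e e0.
set B := lim _.
have /(_ (dnbhs_filter _)) h := @cvgCP R C (0 : C)^' _ (fun h => h^-1 *: (f (h *: 1 + z) - f z)) B.
have [d d0 hd] := proj1 (nbhs_modulusP _ _) (proj1 h df e e0).
exists d => // w wd; have [->|wz] := eqVneq w z.
  by rewrite !subrr mulr0 subr0 /modulus/= expr0n addr0 sqrtr0 mulr0.
have t0 : w - z != 0 by rewrite subr_eq0.
have h0 : modulus (0 - (w - z)) < d by rewrite sub0r modulusN.
have : modulus (B - (w - z)^-1 * (f ((w - z) * 1 + z) - f z)) < e := hd _ h0 t0.
rewrite mulr1 subrK => {}hd.
have -> : f w - f z - B * (w - z) = - (w - z) * (B - (w - z)^-1 * (f w - f z)).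
  by field.
by rewrite modulusM modulusN mulrC ler_wpM2r ?modulus_ge0// ltW.
Qed.

Lemma continuous_comp_within (T : topologicalType) (w : T -> C) (D : set C) f :
  continuous w -> (forall p, D (w p)) -> {within D, continuous f} ->
  continuous (f \o w).
Proof.
move=> cw Dw /subspace_continuousP cf p U /(cf (w p) (Dw p)) U'.
have /cw := U'; rewrite /= /nbhs/= => h.
by apply: filterS h => q; apply.
Qed.


Lemma continuous_clip01 : continuous (fun s : R => Num.max 0 (Num.min 1 s)).
Proof.
move=> s; apply: continuous_max; first exact: cvg_cst.
by apply: continuous_min; [exact: cvg_cst|exact: cvg_id].
Qed.

Section CauchyFormula.
Variables (Omega : set C) (gamma : R -> C) (f : C -> C) (z : C).
Hypothesis Oopen : open Omega.
Hypothesis Oconvex : @convex_set _ C^o Omega.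
Hypothesis gammaC : C1_closed_curve gamma.
Hypothesis gamma_closure : forall t, closure Omega (gamma t).
Hypothesis gamma_out : forall t, ~ Omega (gamma t).
Hypothesis Oz : Omega z.
Hypothesis fA : in_A Omega f.

Let gammaz t : gamma t != z.
Proof. by apply/eqP => gz; apply: (@gamma_out t); rewrite gz. Qed.

(** Clipping extends the parameter to the whole line while [f] is still evaluated only on the
    closure of [Omega]. *)
Let clip (s : R) : R := Num.max 0 (Num.min 1 s).
Let w (s t : R) : C := z + rc s * (gamma t - z).
Let g (s t : R) : C := f (w (clip s) t).
Let k (t : R) : C := curve_deriv gamma t * (gamma t - z)^-1.

Let clip01 s : 0 <= clip s <= 1.
Proof. by rewrite /clip le_max lexx/= ge_max ler01/= ge_min lexx. Qed.

Let clipE s : 0 <= s <= 1 -> clip s = s.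
Proof. by move=> /andP[s0 s1]; rewrite /clip min_r// max_r. Qed.

Let w_Omega s t : 0 <= s < 1 -> Omega (w s t).
Proof. by move=> s01; exact: convex_closure_segment. Qed.

Let w_closure s t : 0 <= s <= 1 -> closure Omega (w s t).
Proof.
move=> /andP[s0]; rewrite le_eqVlt => /predU1P[->|s1].
  by rewrite /w rmorph1 mul1r addrC subrK.
by apply: subset_closure; apply: w_Omega; rewrite s0.
Qed.

Let cg : continuous (fun p : R * R => g p.1 p.2).
Proof.
apply: (@continuous_comp_within _ (fun p : R * R => w (clip p.1) p.2) (closure Omega) f); last exact: fA.2.
  have c1 : continuous (fun p : R * R => rc (clip p.1)).
    move=> p; apply: (@continuous_comp _ _ _ (fun p : R * R => clip p.1) rc); last exact: rc_continuous.
    by apply: (@continuous_comp _ _ _ fst clip); [exact: cvg_fst|exact: continuous_clip01].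
  have c2 : continuous (fun p : R * R => gamma p.2).
    move=> p; apply: (@continuous_comp _ _ _ snd gamma); first exact: cvg_snd.
    exact: (continuous_C1_curve gammaC).
  have cz := @continuous_cstC R (R * R)%type z.
  exact: (continuousD_C cz (continuousM_C c1 (continuousB_C c2 cz))).
by move=> p; exact: w_closure.
Qed.

Let ck : continuous k.
Proof.
exact: (continuousM_C (continuous_curve_deriv gammaC)
  (continuous_inv_sub (continuous_C1_curve gammaC) gammaz)).
Qed.

Let phi (s : R) : C := cint 0 1 (fun t => g s t * k t).

Let cphi : continuous phi.
Proof.
apply: (@continuous_cint2 R (fun p => g p.1 p.2 * k p.2)).
apply: (continuousM_C cg) => p.
by apply: (@continuous_comp _ _ _ snd k); [exact: cvg_snd|exact: ck].
Qed.

(** Both ends are left out: at [s = 0] the form has its pole, and at [s = 1] the curve reaches the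
    boundary, where [f] is only continuous. *)
Let phi_const a b : 0 < a -> a <= b -> b < 1 -> phi b = phi a.
Proof.
move=> a0 ab b1.
have E s : a <= s <= b -> clip s = s.
  by move=> /andP[as_ sb]; rewrite clipE// (le_trans (ltW a0))//= (le_trans sb)// ltW.
apply: (@goursat R gamma z g a b gammaC gammaz a0 ab (ltW b1) cg).
  by move=> s; rewrite /g /w -[X in gamma X](add0r 1); have [-> _ _ _] := gammaC.
move=> s t sab.
have Ow : Omega (w s t).
  by move: sab => /andP[as_ sb]; apply: w_Omega; rewrite (le_trans (ltW a0))//= (le_lt_trans sb).
have [B hB] := derivable_local (fA.1 _ Ow).
exists B => e e0; have [d d0 hd] := hB e e0.
exists d => // s' t' s'ab wd.
by rewrite /g E// E//; exact: hd.
Qed.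

(** Continuity of [phi] at the two ends carries over its constancy inside. *)
Let phi01 : phi 1 = phi 0.
Proof.
have hs (x : R) (e : R) : 0 < e -> 0 <= x <= 1 -> exists y, 0 < y < 1 /\ modulus (phi x - phi y) < e.
  move=> e0 x01.
  have /nbhs_ballP[d /= d0 hd] : nbhs x [set y | modulus (phi x - phi y) < e].
    exact: (proj1 (cvgCP _ _ _) (@cphi x) e e0).
  (* Moves [x] a little towards [1 / 2], which serves both ends at once. *)
  pose y := x + Num.min (d / 2) (1 / 4) * (1 - 2 * x).
  have m0 : 0 < Num.min (d / 2) (1 / 4) by rewrite lt_min !divr_gt0.
  have m1 : Num.min (d / 2) (1 / 4) <= d / 2 by rewrite ge_min lexx.
  have m2 : Num.min (d / 2) (1 / 4) <= 1 / 4 by rewrite ge_min lexx orbT.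
  move: m0 m1 m2 @y; set m := Num.min _ _ => m0 m1 m2 y.
  exists y; split; first by rewrite /y; move/andP: x01 => [x0 x1]; apply/andP; split; nra.
  apply: hd; rewrite /ball /= /y opprD addrA subrr add0r normrN normrM gtr0_norm//.
  have : `|1 - 2 * x| <= 1 by rewrite ler_norml; apply/andP; split; lra.
  by move=> h; apply: le_lt_trans (_ : m * 1 < _); [rewrite ler_pM2l|lra].
apply/eqP; rewrite -subr_eq0 -modulus_eq0; apply/eqP/le_anti; rewrite modulus_ge0 andbT.
apply/ler_addgt0Pr => e e0; rewrite add0r.
have e20 : 0 < e / 2 by rewrite divr_gt0.
have [|x [/andP[x0 x1] hx]] := hs 1 (e / 2) e20; first by rewrite ler01 lexx.
have [|y [/andP[y0 y1] hy]] := hs 0 (e / 2) e20; first by rewrite ler01 lexx.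
have xy : phi x = phi y.
  by have [xy|/ltW yx] := leP x y; [rewrite (phi_const x0 xy)|rewrite (phi_const y0 yx)].
have -> : phi 1 - phi 0 = (phi 1 - phi x) - (phi 0 - phi y) by rewrite xy opprB addrA subrK.
apply: le_trans (modulusD _ _) _; rewrite modulusN [e]splitr.
exact: (ltW (ltrD hx hy)).
Qed.

(** At [s = 0] the curve collapses to [z]: the integrand is [f z] times the winding integrand. *)
Lemma cauchy_formula :
  contour_int gamma (fun u => f u * (u - z)^-1) = two_pi_i R * winding gamma z * f z.
Proof.
have -> : contour_int gamma (fun u => f u * (u - z)^-1) = phi 1.
  rewrite contour_intE; apply: eq_cint => t _.
  rewrite /g (clipE (s := 1)) ?ler01 ?lexx// /w rmorph1 mul1r [z + _]addrC subrK.
  by rewrite /k mulrA mulrAC.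
rewrite phi01 -contour_winding contour_intE -cintZr.
  apply: eq_cint => t _; rewrite /g (clipE (s := 0)) ?lexx ?ler01// /w rmorph0 mul0r addr0.
  by rewrite mulrC /k [_^-1 * _]mulrC.
exact: (continuousM_C (continuous_inv_sub (continuous_C1_curve gammaC) gammaz)
  (continuous_curve_deriv gammaC)).
Qed.

End CauchyFormula.

End Cauchy.

(** * The boundary curve and its homothetic copies *)

Section BoundaryCurve.
Variable R : realType.
Local Notation C := (Cx R).
Local Notation re := (@complex.Re R).
Local Notation im := (@complex.Im R).
Local Notation rc := (real_complex R : R -> C).
Implicit Types (Omega : set C) (f : C -> C) (gamma : R -> C).

Lemma cderiv_C1_closed_curve gamma (dgamma : R -> C) : periodic1 gamma ->
  cderiv gamma dgamma -> continuous dgamma ->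
  C1_closed_curve gamma /\ forall t, curve_deriv gamma t = dgamma t.
Proof.
move=> pg dg cdg.
have e1 t : derive1 (re_part gamma) t = re (dgamma t).
  by rewrite derive1E; apply: (@derive_val _ _ _ _ _ _ _ (proj1 (dg t))).
have e2 t : derive1 (im_part gamma) t = im (dgamma t).
  by rewrite derive1E; apply: (@derive_val _ _ _ _ _ _ _ (proj2 (dg t))).
split; last by move=> t; rewrite /curve_deriv e1 e2; case: (dgamma t).
split => //.
- move=> t; split.
    exact: (@ex_derive _ _ _ _ _ _ _ (proj1 (dg t))).
  exact: (@ex_derive _ _ _ _ _ _ _ (proj2 (dg t))).
- by rewrite (funext e1); exact: (continuous_Re cdg).
- by rewrite (funext e2); exact: (continuous_Im cdg).
Qed.

Lemma periodic1_image gamma (P : C -> Prop) : periodic1 gamma ->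
  (forall t, 0 <= t < 1 -> P (gamma t)) -> forall t, P (gamma t).
Proof.
move=> pg hP.
have pn t n : gamma (t + n%:R) = gamma t.
  by elim: n => [|n IH]; rewrite ?addr0// -natr1 addrA pg.
have pz t (m : int) : gamma (t + m%:~R) = gamma t.
  case: m => n; first exact: pn.
  by rewrite NegzE mulrNz -[in RHS](subrK (n.+1%:~R) t) (pn _ n.+1).
move=> t; rewrite -(pz t (- Num.floor t)); apply: hP.
rewrite mulrNz; have h1 := floor_le_tmp t; have h2 := floorD1_gt t.
by rewrite subr_ge0 h1/= ltrBlDl -intrD1.
Qed.

Section Boundary.
Variables (Omega : set C) (gamma : R -> C).
Hypothesis Oopen : open Omega.
Hypothesis Oconvex : @convex_set _ C^o Omega.
Hypothesis Ogamma : boundary_param Omega gamma.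

Lemma boundary_C1 : C1_closed_curve gamma.
Proof. by have [/smooth_C1_closed_curve] := Ogamma. Qed.

Lemma boundary_curve t : boundary Omega (gamma t).
Proof.
have [[pg _] _ _ im _] := Ogamma.
apply: (periodic1_image pg (P := boundary Omega)) => {}t t01.
by rewrite -im; exists t => //=; rewrite in_itv.
Qed.

Lemma boundary_closure t : closure Omega (gamma t).
Proof. by have [] := boundary_curve t. Qed.

Lemma boundary_out t : ~ Omega (gamma t).
Proof.
have [_ h] := boundary_curve t; move=> Og; apply: h.
exact: (open_nbhs_nbhs (conj Oopen Og)).
Qed.

Lemma winding_in z : Omega z -> winding gamma z = 1.
Proof. by have [_ _ _ _] := Ogamma; apply. Qed.

Lemma Omega_nonempty : exists z, Omega z.
Proof.
have [z Oz _] := closure_modulus (@boundary_closure 0) ltr01.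
by exists z.
Qed.

Lemma gamma_neq z t : Omega z -> gamma t != z.
Proof. by move=> Oz; apply/eqP => gz; apply: (@boundary_out t); rewrite gz. Qed.

Lemma gamma_neq_out z t : ~ closure Omega z -> gamma t != z.
Proof. by move=> Oz; apply/eqP => gz; apply: Oz; rewrite -gz; exact: boundary_closure. Qed.

Lemma in_A_inv w : ~ closure Omega w -> in_A Omega (fun z => (z - w)^-1).
Proof.
move=> Ow; have zw z : closure Omega z -> z - w != 0.
  by move=> Oz; rewrite subr_eq0; apply/eqP => zw; apply: Ow; rewrite -zw.
split.
  move=> z Oz; apply: derivableV; first by apply: zw; exact: subset_closure.
  by apply: derivableB; [exact: derivable_id|exact: derivable_cst].
apply: continuous_in_subspaceT => z /set_mem Oz.
have h := @continuousB_C R C id (fun=> w) (fun u => @cvg_id C (nbhs u)) (@continuous_cstC R C w).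
exact: (cvgV (zw _ Oz) (h z)).
Qed.

(** The Cauchy formula for [1 / (u - w)] at a point [z] of [Omega], split into partial fractions,
    reads [(1 - winding gamma w) / (z - w) = 1 / (z - w)]. *)
Lemma winding_out w : ~ closure Omega w -> winding gamma w = 0.
Proof.
move=> Ow; have [z Oz] := Omega_nonempty.
have gC := boundary_C1; have cga := continuous_C1_curve gC.
have := cauchy_formula Oopen Oconvex gC boundary_closure boundary_out Oz (in_A_inv Ow).
rewrite winding_in// mulr1.
have zw : z - w != 0.
  by rewrite subr_eq0; apply/eqP => zw; apply: Ow; rewrite -zw; exact: subset_closure.
have c1 := continuousM_C (continuous_inv_sub cga (fun t => gamma_neq t Oz)) (continuous_curve_deriv gC).
have c2 := continuousM_C (continuous_inv_sub cga (fun t => gamma_neq_out t Ow)) (continuous_curve_deriv gC).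
have -> : contour_int gamma (fun u => (u - w)^-1 * (u - z)^-1) =
    (z - w)^-1 * (contour_int gamma (fun u => (u - z)^-1) - contour_int gamma (fun u => (u - w)^-1)).
  rewrite !contour_intE -(cintB 0 1 c1 c2) -(cintZ 0 1 _ (continuousB_C c1 c2)).
  apply: eq_cint => t _.
  have h1 : gamma t - z != 0 by rewrite subr_eq0 gamma_neq.
  have h2 : gamma t - w != 0 by rewrite subr_eq0 gamma_neq_out.
  by field; rewrite h1 h2 zw.
rewrite !contour_winding winding_in// -mulrBr mulrCA.
move=> /(mulfI (two_pi_i_neq0 R)); rewrite -[RHS]mulr1 => /(mulfI _).
rewrite invr_eq0 => /(_ zw)/eqP; rewrite subr_eq addrC -subr_eq subrr => /eqP <-//.
Qed.

Section Scaled.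
Variables (z0 : C) (r : R).
Hypothesis Oz0 : Omega z0.
Hypothesis r0 : 0 < r.
Hypothesis r1 : r < 1.

(** A homothetic copy of the boundary with centre [z0], admissible as a cycle since it runs inside
    [Omega]. *)
Definition scaled_curve t : C := z0 + rc r * (gamma t - z0).

Let rcr0 : rc r != 0.
Proof. by apply/eqP => -[h]; move: r0; rewrite h ltxx. Qed.

Lemma scaled_curveP : C1_closed_curve scaled_curve /\
  forall t, curve_deriv scaled_curve t = rc r * curve_deriv gamma t.
Proof.
have gC := boundary_C1.
apply: cderiv_C1_closed_curve.
- by move=> t; rewrite /scaled_curve; have [-> _ _ _] := gC.
- have h := cderivD (cderiv_cst z0) (cderivM (cderiv_cst (rc r)) (cderivD (C1_cderiv gC) (cderiv_cst (- z0)))).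
  by apply: eq_cderiv h => t; rewrite mul0r !add0r addr0.
- exact: (continuousM_C (@continuous_cstC _ _ (rc r)) (continuous_curve_deriv gC)).
Qed.

Lemma winding_scaled z : winding scaled_curve z = winding gamma (z0 + (z - z0) / rc r).
Proof.
have [_ dE] := scaled_curveP.
rewrite /winding.
suff -> : contour_int scaled_curve (fun u => (u - z)^-1) =
    contour_int gamma (fun u => (u - (z0 + (z - z0) / rc r))^-1) by [].
rewrite !contour_intE; apply: eq_cint => t _; rewrite dE /scaled_curve.
have -> : z0 + rc r * (gamma t - z0) - z = rc r * (gamma t - (z0 + (z - z0) / rc r)).
  by field.
by rewrite invfM mulrACA mulVf// mul1r.
Qed.

Lemma scaled_in t : Omega (scaled_curve t).
Proof.
by apply: convex_closure_segment => //; [exact: boundary_closure|rewrite ltW].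
Qed.

(** If the blow-up of [z] were in the closure, [z] would lie on the segment from [z0] to it at
    parameter [r < 1], hence in [Omega]. *)
Lemma scaled_out z : ~ Omega z -> ~ closure Omega (z0 + (z - z0) / rc r).
Proof.
move=> nOz h; apply: nOz.
have := convex_closure_segment Oopen Oconvex h Oz0 (_ : 0 <= r < 1).
rewrite (ltW r0) r1 => /(_ isT); congr (Omega _).
by field.
Qed.

End Scaled.
End Boundary.
End BoundaryCurve.

(** * The holomorphic calculus as a boundary integral *)

Section HolCalculus.
Variable R : realType.
Local Notation C := (Cx R).
Local Notation rc := (real_complex R : R -> C).

Lemma functional_vintegral01 (W : vectType C) (ell : W -> C) (F : R -> W) :
  (forall X Y, ell (X + Y) = ell X + ell Y) ->
  (forall a X, ell (a *: X) = a * ell X) ->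
  (forall i, continuous (fun t => coord (vbasis {:W}) i (F t))) ->
  ell (vintegral01 F) = cint 0 1 (fun t => ell (F t)).
Proof.
move=> ellD ellZ cF; have ell0 : ell 0 = 0 by rewrite -(scale0r 0) ellZ mul0r.
have ell_sum n (G : 'I_n -> W) : ell (\sum_(i < n) G i) = \sum_(i < n) ell (G i).
  exact: (big_morph ell ellD ell0).
have -> : (fun t => ell (F t)) = fun t =>
    \sum_(i < \dim {:W}) coord (vbasis {:W}) i (F t) * ell (vbasis {:W})`_i.
  apply/funext => t; rewrite [in LHS](coord_vbasis (memvf (F t))) ell_sum.
  by apply: eq_bigr => i _; rewrite ellZ.
have cM i := continuousM_C (cF i) (@continuous_cstC R R (ell (vbasis {:W})`_i)).
rewrite (cint_sum 0 1 cM) /vintegral01 ell_sum.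
by apply: eq_bigr => i _; rewrite ellZ (cintZr 0 1 _ (cF i)).
Qed.

(** The two curves never meet, so the kernel is jointly continuous and Fubini applies to each curve
    of the cycle. *)
Lemma cycle_int_sum_fubini (n : nat) (Gamma : 'I_n -> R -> C) (gamma : R -> C)
    (a : 'I_n -> R -> C) (b : R -> C) :
  (forall k, continuous (Gamma k)) -> continuous gamma ->
  (forall k, continuous (a k)) -> continuous b ->
  (forall k s t, gamma s != Gamma k t) ->
  \sum_(k < n) cint 0 1 (fun t => a k t * cint 0 1 (fun s => b s * (gamma s - Gamma k t)^-1)) =
  cint 0 1 (fun s => b s * \sum_(k < n) cint 0 1 (fun t => a k t * (gamma s - Gamma k t)^-1)).
Proof.
move=> cG cg ca cb gG.
have cfst (f : R -> C) : continuous f -> continuous (fun p : R * R => f p.1).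
  by move=> cf p; apply: (@continuous_comp _ _ _ fst f); [exact: cvg_fst|exact: cf].
have csnd (f : R -> C) : continuous f -> continuous (fun p : R * R => f p.2).
  by move=> cf p; apply: (@continuous_comp _ _ _ snd f); [exact: cvg_snd|exact: cf].
have cF k : continuous (fun p : R * R => (a k p.1 * b p.2) * (gamma p.2 - Gamma k p.1)^-1).
  apply: (continuousM_C (continuousM_C (cfst _ (ca k)) (csnd _ cb))).
  apply: continuousV_C; first exact: (continuousB_C (csnd _ cg) (cfst _ (cG k))).
  by move=> p; rewrite subr_eq0.
pose H k s := b s * cint 0 1 (fun t => a k t * (gamma s - Gamma k t)^-1).
have HE k s : H k s = cint 0 1 (fun t => (a k t * b s) * (gamma s - Gamma k t)^-1).
  have ckt : continuous (fun t => a k t * (gamma s - Gamma k t)^-1).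
    apply: (continuousM_C (ca k)); apply: continuousV_C.
      exact: (continuousB_C (@continuous_cstC _ _ (gamma s)) (cG k)).
    by move=> t; rewrite subr_eq0.
  by rewrite /H -(cintZ 0 1 (b s) ckt); apply: eq_cint => t _; rewrite mulrCA mulrA.
have cH k : continuous (H k).
  rewrite (funext (HE k)).
  have cF' : continuous (fun p : R * R => (a k p.2 * b p.1) * (gamma p.1 - Gamma k p.2)^-1).
    apply: (continuousM_C (continuousM_C (csnd _ (ca k)) (cfst _ cb))).
    apply: continuousV_C; first exact: (continuousB_C (cfst _ cg) (csnd _ (cG k))).
    by move=> p; rewrite subr_eq0.
  exact: (continuous_cint2 cF').
transitivity (cint 0 1 (fun s => \sum_(k < n) H k s)); last first.
  by apply: eq_cint => s _; rewrite mulr_sumr.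
rewrite (cint_sum 0 1 cH); apply: eq_bigr => k _.
transitivity (cint 0 1 (fun s => cint 0 1 (fun t => (a k t * b s) * (gamma s - Gamma k t)^-1))); last first.
  by apply: eq_cint => s _; rewrite HE.
rewrite -(cint_fubini (cF k)); apply: eq_cint => t _.
have cks : continuous (fun s => b s * (gamma s - Gamma k t)^-1).
  apply: (continuousM_C cb); apply: continuousV_C.
    exact: (continuousB_C cg (@continuous_cstC _ _ (Gamma k t))).
  by move=> s; rewrite subr_eq0.
by rewrite -(cintZ 0 1 (a k t) cks); apply: eq_cint => s _; rewrite mulrA.
Qed.

Section Formula.
Variables (Omega : set C) (gamma : R -> C) (V : vectType C) (T : 'End(V)).
Hypothesis Oopen : open Omega.
Hypothesis Oconvex : @convex_set _ C^o Omega.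
Hypothesis Ogamma : boundary_param Omega gamma.
Hypothesis TO : forall z, spectrum T z -> Omega z.

Let gC : C1_closed_curve gamma := boundary_C1 Ogamma.
Let cg : continuous gamma := continuous_C1_curve gC.
Let cdg : continuous (curve_deriv gamma) := continuous_curve_deriv gC.

Lemma boundary_spectrum t : ~ spectrum T (gamma t).
Proof. by move=> /TO; exact: (boundary_out Oopen Ogamma (t := t)). Qed.

(** On an eigenvector for [l], an annihilating product acts as the scalar product of the [l - m],
    which must therefore vanish. *)
Lemma spectrum_finite : exists s : seq C, forall l, spectrum T l -> l \in s.
Proof.
have [s _ s0] := spectrum_annihilator T; exists s => l Tl.
have [v vl v0] : exists2 v, T v = l *: v & v != 0.
  exists (vpick (passmx.leigenspace T l)); last by rewrite vpick0.
  have := memv_pick (passmx.leigenspace T l).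
  rewrite memv_ker add_lfunE opp_lfunE scale_lfunE id_lfunE subr_eq0.
  by move=> /eqP.
have : apply_factors T s \1%VF v = 0 by rewrite s0 zero_lfunE.
have -> : apply_factors T s \1%VF v = (\prod_(m <- s) (l - m)) *: v.
  elim: s {s0} => [|m s IH] /=; first by rewrite big_nil scale1r id_lfunE.
  rewrite comp_lfunE IH linearZ /= add_lfunE opp_lfunE scale_lfunE id_lfunE vl.
  by rewrite -scalerBl scalerA big_cons mulrC.
move/eqP; rewrite scaler_eq0 (negbTE v0) orbF prodf_seq_eq0 => /hasP[m ms /=].
by rewrite subr_eq0 => /eqP ->.
Qed.

(** A single scaled boundary works: its winding numbers are those of [gamma] at blown-up points, and
    for [r] close to 1 the blow-ups of the finitely many spectral points remain in [Omega]. Hence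
    the [xget] of [hol_calculus] does not fall back to 0. *)
Lemma surrounding_cycle_exists : exists n (Gamma : 'I_n -> R -> C),
  surrounding_cycle Omega T Gamma.
Proof.
have [z0 Oz0] := Omega_nonempty Ogamma.
have [s sT] := spectrum_finite.
pose u (l : C) (r : R) := z0 + (l - z0) / rc r.
have cu l : spectrum T l -> \forall r \near (1 : R)^'-, Omega (u l r).
  move=> /TO Ol; have [d d0 dO] := open_modulusP Oopen Ol.
  have M0 : 0 < modulus (l - z0) + 1 by rewrite ltr_wpDl// modulus_ge0.
  near=> r.
  have r0 : 1 / 2 < r by near: r; apply: nbhs_left_gt; lra.
  have r1 : r < 1 by near: r; exact: nbhs_left_lt.
  (* The blow-up displaces [l] by [|l - z0| (1 - r) / r], at most twice [|l - z0| (1 - r)] for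
     [r > 1 / 2]. *)
  have rd : 1 - r < d / (2 * (modulus (l - z0) + 1)).
    rewrite ltrBlDl addrC -ltrBlDl; near: r; apply: nbhs_left_gt.
    by rewrite ltrBlDl ltrDr divr_gt0// mulr_gt0.
  have rr0 : 0 < r by lra.
  have rcr : rc r != 0 by apply/eqP => -[h]; move: rr0; rewrite h ltxx.
  apply: dO; rewrite /u.
  have -> : l - (z0 + (l - z0) / rc r) = - ((l - z0) * rc ((1 - r) / r)).
    by rewrite rmorphM rmorphB fmorphV /=; field.
  rewrite modulusN modulusM modulus_rc ger0_norm ?divr_ge0 ?subr_ge0 ?(ltW r1) ?(ltW rr0)//.
  rewrite mulrA ltr_pdivrMr//.
  have rd' : (1 - r) * (2 * (modulus (l - z0) + 1)) < d by rewrite -ltr_pdivlMr// mulr_gt0.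
  have m0 := modulus_ge0 (l - z0).
  have : modulus (l - z0) * (1 - r) < d / 2 by nra.
  by move=> h; apply: lt_le_trans h _; rewrite ler_pM2l// ; lra.
have [r [[r0 r1] hr]] : exists r : R, (0 < r /\ r < 1) /\ forall l, spectrum T l -> Omega (u l r).
  have hs : \forall r \near (1 : R)^'-, forall l, l \in s -> spectrum T l -> Omega (u l r).
    elim: s {sT} => [|m s IH]; first by near=> r.
    have [Tm|nTm] := pselect (spectrum T m); last first.
      apply: filterS IH => r IH l; rewrite in_cons => /predU1P[->//|ls]; exact: IH.
    have h := cu m Tm.
    apply: filterS2 h IH => r h IH l; rewrite in_cons => /predU1P[->//|ls]; exact: IH.
  have h0 : \forall r \near (1 : R)^'-, 0 < r by exact: nbhs_left_gt.
  have h1 : \forall r \near (1 : R)^'-, r < 1 by exact: nbhs_left_lt.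
  have [r [[a1 a2] a3]] := filter_ex (filterI (filterI h0 h1) hs).
  by exists r; split=> // l Tl; apply: a3 => //; exact: sT.
exists 1%N, (fun=> scaled_curve gamma z0 r).
have rcr : rc r != 0 by apply/eqP => -[h]; move: r0; rewrite h ltxx.
split.
- by move=> _; exact: (scaled_curveP Ogamma z0 r).1.
- move=> _ t; split; first exact: scaled_in.
  move=> /hr; rewrite /u /scaled_curve.
  have -> : z0 + (z0 + rc r * (gamma t - z0) - z0) / rc r = gamma t by field.
  exact: (boundary_out Oopen Ogamma (t := t)).
- move=> l Tl; rewrite big_ord1 (winding_scaled Ogamma z0 r0).
  exact: (winding_in Ogamma (hr l Tl)).
- move=> z nOz; rewrite big_ord1 (winding_scaled Ogamma z0 r0).
  apply: (winding_out Oopen Oconvex Ogamma).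
  exact: (scaled_out Oopen Oconvex Oz0 r0 r1 nOz).
Unshelve. all: by end_near. Qed.

Variable ell : 'End(V) -> C.
Hypothesis ellD : forall X Y, ell (X + Y) = ell X + ell Y.
Hypothesis ellZ : forall a X, ell (a *: X) = a * ell X.

Let kernel_split (w z x y e : C) : w - z != 0 -> (w - z) * y = x - e ->
  (w - z)^-1 * x = y + - e * (z - w)^-1.
Proof.
move=> wz xy; have -> : x = (w - z) * y + e by rewrite xy subrK.
have zw : z - w != 0 by rewrite -opprB oppr_eq0.
by field; rewrite wz zw.
Qed.

(** The resolvent identity splits the integrand into the resolvent at [gamma s] composed with that
    at [z], whose integral has the residue of the identity, and a multiple of [1 / (z - gamma s)],
    which integrates to 0 as the cycle does not wind around points outside [Omega]. *)
Lemma cycle_int_cauchy_kernel n (Gamma : 'I_n -> R -> C) s :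
  surrounding_cycle Omega T Gamma ->
  cycle_int Gamma (fun z => (gamma s - z)^-1 * ell (resolvent T z)) =
  two_pi_i R * ell (resolvent T (gamma s)).
Proof.
move=> [GC GO G1 G0].
have GT k t : ~ spectrum T (Gamma k t) by have [] := GO k t.
have sT := boundary_spectrum (t := s).
have sG k t : gamma s != Gamma k t.
  apply/eqP => sG; have [+ _] := GO k t; rewrite -sG.
  exact: (boundary_out Oopen Ogamma (t := s)).
pose ell' (X : 'End(V)) := ell (resolvent T (gamma s) \o X)%VF.
have ell'D X Y : ell' (X + Y) = ell' X + ell' Y by rewrite /ell' comp_lfunDr ellD.
have ell'Z a X : ell' (a *: X) = a * ell' X by rewrite /ell' -comp_lfunZr ellZ.
have c1 k : continuous (fun t => ell' (resolvent T (Gamma k t))).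
  have h := @continuous_functional_resolvent _ _ T ell' ell'D ell'Z _ \1%VF (continuous_C1_curve (GC k)) (GT k).
  by rewrite (_ : (fun _ => _) = fun t => ell' (resolvent T (Gamma k t) \o \1)%VF)//;
    apply/funext => t; rewrite comp_lfun1r.
have c2 k : continuous (fun t => (Gamma k t - gamma s)^-1).
  by apply: (continuous_inv_sub (continuous_C1_curve (GC k))) => t; rewrite eq_sym.
have c3 k := continuousM_C (@continuous_cstC R R (- ell (resolvent T (gamma s)))) (c2 k).
rewrite (eq_cycle_int (h := fun z => ell' (resolvent T z) + (- ell (resolvent T (gamma s))) * (z - gamma s)^-1)); last first.
  move=> k t.
  have h := resolvent_identity (spectrumNP (@GT k t)) (spectrumNP sT).
  have h2 : (gamma s - Gamma k t) * ell' (resolvent T (Gamma k t)) =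
      ell (resolvent T (Gamma k t)) - ell (resolvent T (gamma s)).
    by rewrite /ell' -ellZ -[- ell _]mulN1r -ellZ -ellD scaleN1r; exact: (congr1 ell h).
  have n0 : gamma s - Gamma k t != 0 by rewrite subr_eq0.
  exact: kernel_split n0 h2.
rewrite (cycle_intD GC c1 c3) (cycle_intZ GC _ c2).
rewrite (cycle_int_resolvent ell'D ell'Z GC GT G1) /ell' comp_lfun1r.
rewrite [X in _ + _ * X](_ : _ = 0) ?mulr0 ?addr0//.
rewrite -[RHS](mulr0 (two_pi_i R)) -(G0 (gamma s)); last exact: (boundary_out Oopen Ogamma (t := s)).
rewrite mulr_sumr; apply: eq_bigr => k _; exact: contour_winding.
Qed.

Variables (G : R -> C) (h : C -> C).
Hypothesis cG : continuous G.
Hypothesis hE : forall z, Omega z -> h z =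
  (two_pi_i R)^-1 * cint 0 1 (fun s => G s * curve_deriv gamma s * (gamma s - z)^-1).

(** Insert the Cauchy integral of [h], exchange the integrations, and evaluate the inner cycle
    integral of kernel times resolvent. The data [G] are any continuous function on the boundary
    curve, so the statement covers both [f] and the Cauchy transform. *)
Lemma functional_riesz_dunford n (Gamma : 'I_n -> R -> C) :
  surrounding_cycle Omega T Gamma ->
  ell ((two_pi_i R)^-1 *: \sum_(k < n)
         vcontour_int (Gamma k) (fun zeta => h zeta *: resolvent T zeta)) =
  (two_pi_i R)^-1 * cint 0 1 (fun s => G s * curve_deriv gamma s * ell (resolvent T (gamma s))).
Proof.
move=> GG; have [GC GO G1 G0] := GG.
have GT k t : ~ spectrum T (Gamma k t) by have [] := GO k t.
have gG k s t : gamma s != Gamma k t.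
  apply/eqP => sG; have [+ _] := GO k t; rewrite -sG.
  exact: (boundary_out Oopen Ogamma (t := s)).
have cGa k := continuous_C1_curve (GC k).
have cdG k := continuous_curve_deriv (GC k).
have cb := continuousM_C cG cdg.
have cR (l : 'End(V) -> C) : (forall X Y, l (X + Y) = l X + l Y) ->
    (forall a X, l (a *: X) = a * l X) ->
    forall k, continuous (fun t => l (resolvent T (Gamma k t))).
  move=> lD lZ k.
  have hc := @continuous_functional_resolvent _ _ T l lD lZ _ \1%VF (cGa k) (GT k).
  by rewrite (_ : (fun _ => _) = fun t => l (resolvent T (Gamma k t) \o \1)%VF)//;
    apply/funext => t; rewrite comp_lfun1r.
have ch k : continuous (fun t => h (Gamma k t)).
  rewrite (_ : (fun _ => _) = fun t => (two_pi_i R)^-1 *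
      cint 0 1 (fun s => G s * curve_deriv gamma s * (gamma s - Gamma k t)^-1)); last first.
    by apply/funext => t; rewrite hE//; have [] := GO k t.
  have cF : continuous (fun p : R * R => G p.2 * curve_deriv gamma p.2 * (gamma p.2 - Gamma k p.1)^-1).
    apply: (@continuousM_C R (R * R)%type (fun p => G p.2 * curve_deriv gamma p.2)).
      move=> p; apply: (@continuous_comp _ _ _ snd (fun s => G s * curve_deriv gamma s)).
        exact: cvg_snd.
      exact: cb.
    apply: continuousV_C; last by move=> p; rewrite subr_eq0.
    apply: continuousB_C => p.
      by apply: (@continuous_comp _ _ _ snd gamma); [exact: cvg_snd|exact: cg].
    by apply: (@continuous_comp _ _ _ fst (Gamma k)); [exact: cvg_fst|exact: cGa].
  exact: (continuousM_C (@continuous_cstC _ _ _) (continuous_cint2 cF)).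
have ell0 : ell 0 = 0 by rewrite -(scale0r 0) ellZ mul0r.
rewrite ellZ (big_morph ell ellD ell0); apply: (congr1 ( *%R (two_pi_i R)^-1)).
pose a k t := (two_pi_i R)^-1 * (curve_deriv (Gamma k) t * ell (resolvent T (Gamma k t))).
have cK k := continuousM_C (cdG k) (cR ell ellD ellZ k).
have ca k : continuous (a k) := continuousM_C (@continuous_cstC R R (two_pi_i R)^-1) (cK k).
transitivity (\sum_(k < n) cint 0 1 (fun t => a k t *
    cint 0 1 (fun s => (G s * curve_deriv gamma s) * (gamma s - Gamma k t)^-1))).
  apply: eq_bigr => k _.
  have cco i : continuous (fun t => coord (vbasis {:'End(V)}) i
      (curve_deriv (Gamma k) t *: (h (Gamma k t) *: resolvent T (Gamma k t)))).
    have coD X Y : coord (vbasis {:'End(V)}) i (X + Y) =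
        coord (vbasis {:'End(V)}) i X + coord (vbasis {:'End(V)}) i Y by rewrite linearD.
    have coZ b X : coord (vbasis {:'End(V)}) i (b *: X) =
        b * coord (vbasis {:'End(V)}) i X by rewrite linearZ.
    have E t : coord (vbasis {:'End(V)}) i
        (curve_deriv (Gamma k) t *: (h (Gamma k t) *: resolvent T (Gamma k t))) =
      curve_deriv (Gamma k) t * (h (Gamma k t) *
        coord (vbasis {:'End(V)}) i (resolvent T (Gamma k t))).
      by rewrite coZ coZ.
    rewrite (funext E).
    exact: (continuousM_C (cdG k) (continuousM_C (ch k) (cR _ coD coZ k))).
  apply: (etrans (functional_vintegral01 ellD ellZ cco)).
  apply: eq_cint => t _; rewrite !ellZ (hE (GO k t).1) /a.
  by move: (cint 0 1 _) (ell _) (curve_deriv _ _) (_^-1) => I e d i; ring.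
rewrite (cycle_int_sum_fubini cGa cg ca cb gG); apply: eq_cint => s _.
apply: (congr1 ( *%R (G s * curve_deriv gamma s))).
have := cycle_int_cauchy_kernel s GG.
have cE k : continuous (fun t => (gamma s - Gamma k t)^-1 * ell (resolvent T (Gamma k t)) * curve_deriv (Gamma k) t).
  apply: (continuousM_C _ (cdG k)); apply: (continuousM_C _ (cR ell ellD ellZ k)).
  apply: continuousV_C; last by move=> t; rewrite subr_eq0.
  exact: (continuousB_C (@continuous_cstC _ _ (gamma s)) (cGa k)).
move=> E; apply: (mulfI (two_pi_i_neq0 R)); rewrite -E mulr_sumr.
apply: eq_bigr => k _; rewrite contour_intE.
have cE' k' : continuous (fun t => a k' t * (gamma s - Gamma k' t)^-1).
  apply: (continuousM_C (ca k')); apply: continuousV_C; last by move=> t; rewrite subr_eq0.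
  exact: (continuousB_C (@continuous_cstC _ _ (gamma s)) (cGa k')).
rewrite -(cintZ 0 1 _ (cE' k)); apply: eq_cint => t _; rewrite /a.
rewrite -mulrA mulVKf ?two_pi_i_neq0//.
by move: (ell _) (curve_deriv _ _) (_^-1) => e d i; ring.
Qed.

(** The boundary integral mentions no cycle, so it is the value for whichever operator [xget]
    selects. *)
Lemma functional_hol_calculus :
  ell (hol_calculus Omega h T) =
  (two_pi_i R)^-1 * cint 0 1 (fun s => G s * curve_deriv gamma s * ell (resolvent T (gamma s))).
Proof.
rewrite /hol_calculus; set P := [set S | _].
have : P (xget 0 P).
  apply: xgetPex; have [n [Gamma GG]] := surrounding_cycle_exists.
  by eexists; exists n, Gamma; split.
by move=> [n [Gamma [GG ->]]]; exact: functional_riesz_dunford.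
Qed.

End Formula.
End HolCalculus.

(** * Positivity *)

Section Positivity.
Variable R : realType.
Local Notation C := (Cx R).
Local Notation re := (@complex.Re R).
Local Notation im := (@complex.Im R).
Local Notation rc := (real_complex R : R -> C).

Lemma is_derive_local (f : R -> R) (t df e : R) : is_derive t (1 : R) f df -> 0 < e ->
  exists2 d, 0 < d & forall h, `|h| < d -> `|f (t + h) - f t - h * df| <= e * `|h|.
Proof.
move=> dfD e0; have fd : derivable f t 1 by exact: (@ex_derive _ _ _ _ _ _ _ dfD).
have fE : 'D_1 f t = df by exact: (@derive_val _ _ _ _ _ _ _ dfD).
have /cvgrPdist_lt/(_ e e0)/nbhs_ballP[d /= d0 hd] :
    h^-1 *: (f (h *: (1 : R) + t) - f t) @[h --> 0^'] --> df by rewrite -fE; exact: fd.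
exists d => // h hlt; have [->|h0] := eqVneq h 0.
  by rewrite addr0 subrr mul0r subr0 normr0 mulr0.
have : `|df - h^-1 * (f (h * 1 + t) - f t)| < e.
  by apply: hd => //; rewrite /ball/= sub0r normrN.
rewrite mulr1 [h + t]addrC => {}hd.
have -> : f (t + h) - f t - h * df = - h * (df - h^-1 * (f (t + h) - f t)) by field.
by rewrite normrM normrN mulrC ler_wpM2r// ltW.
Qed.

Lemma cderiv_local (F G : R -> C) t e : cderiv F G -> 0 < e ->
  exists2 d, 0 < d & forall h, `|h| < d ->
    modulus (F (t + h) - F t - rc h * G t) <= e * `|h|.
Proof.
move=> dF e0; have e20 : 0 < e / 2 by rewrite divr_gt0.
have [d1 d10 h1] := is_derive_local (dF t).1 e20.
have [d2 d20 h2] := is_derive_local (dF t).2 e20.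
exists (Num.min d1 d2); first by rewrite lt_min d10.
move=> h; rewrite lt_min => /andP[/h1 k1 /h2 k2].
apply: le_trans (modulus_le _) _; rewrite [e]splitr mulrDl; apply: lerD.
  by move: k1; rewrite /= !cReD !cReN cReM /= mul0r subr0.
by move: k2; rewrite /= !cImD !cImN cImM /= mul0r addr0.
Qed.

Lemma same_sign (q : R -> R) t0 : continuous q -> (forall t, q t != 0) -> q t0 < 0 ->
  forall t, q t < 0.
Proof.
move=> cq q0 qt0 t; rewrite ltNge; apply/negP => qt.
have [tt|tt] := leP t0 t.
  have [|c _ qc] := IVT tt (v := 0) (continuous_subspaceT cq).
    by rewrite ge_min le_max (ltW qt0) qt orbT.
  by move: (q0 c); rewrite qc eqxx.
have [|c _ qc] := IVT (ltW tt) (v := 0) (continuous_subspaceT cq).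
  by rewrite ge_min le_max (ltW qt0) qt orbT.
by move: (q0 c); rewrite qc eqxx.
Qed.

Variables (Omega : set C) (gamma : R -> C).
Hypothesis Oopen : open Omega.
Hypothesis Oconvex : @convex_set _ C^o Omega.
Hypothesis Ogamma : boundary_param Omega gamma.

Let gC : C1_closed_curve gamma := boundary_C1 Ogamma.

(** The cross product of [gamma t - w] with the velocity: it vanishes when the tangent at [gamma t]
    passes through [w], and divided by [|gamma t - w|^2] it is the angular velocity about [w]. *)
Let tangent_cross w t := im (curve_deriv gamma t * conjc (gamma t - w)).

(* A tangent passing through w would make the curve leave the closure of Omega,
   as gamma t would become interior to the hull of a later (or earlier) point of
   the curve and a ball around w. *)
Let tangent_avoids w t : Omega w -> tangent_cross w t != 0.
Proof.
move=> Ow; apply/eqP => q0.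
have gw : gamma t - w != 0 by rewrite subr_eq0 (gamma_neq Oopen Ogamma).
have dg0 : curve_deriv gamma t != 0 by have [_ /(_ t)] := Ogamma.
have [c c0 dgE] : exists2 c : R, c != 0 & curve_deriv gamma t = rc c * (gamma t - w).
  pose n := re (gamma t - w) ^+ 2 + im (gamma t - w) ^+ 2.
  have n0 : n != 0 by move: gw; rewrite -modulus_gt0 /modulus sqrtr_gt0 => /lt0r_neq0.
  pose c := re (curve_deriv gamma t * conjc (gamma t - w)) / n.
  have E : curve_deriv gamma t = rc c * (gamma t - w).
    move: q0 n0; rewrite /c /n /tangent_cross.
    case: (gamma t - w) => x y; case: (curve_deriv gamma t) => a b /= q0 n0.
    have yb : b * x = a * y by apply/eqP; rewrite -subr_eq0 -[X in _ == X]q0; apply/eqP; ring.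
    have hx : (a * x - b * - y) * x = a * (x ^+ 2 + y ^+ 2).
      by rewrite (_ : (a * x - b * - y) * x = a * x ^+ 2 + y * (b * x)); [rewrite yb; ring|ring].
    have hy : (a * x - b * - y) * y = b * (x ^+ 2 + y ^+ 2).
      by rewrite (_ : (a * x - b * - y) * y = x * (a * y) + b * y ^+ 2); [rewrite -yb; ring|ring].
    apply: complex_eq => /=; rewrite !mul0r ?subr0 ?addr0.
      by rewrite mulrAC hx mulfK.
    by rewrite mulrAC hy mulfK.
  by exists c => //; apply/eqP => c0; move: dg0; rewrite E c0 mul0r eqxx.
have [rho rho0 rhoO] := open_modulusP Oopen Ow.
(* Precision for which the first-order error at [t + h], divided by [s = |h| |c|], stays below the
   radius [rho] around [w]. *)
have e0 : 0 < `|c| * rho / 2 by rewrite divr_gt0// mulr_gt0// normr_gt0.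
have [d d0 hd] := cderiv_local t (C1_cderiv gC) e0.
(* The sign is chosen so that the curve moves away from [w], whence [h * c > 0]. *)
pose h := Num.sg c * (d / 2).
have hn : `|h| = d / 2 by rewrite normrM normr_sg c0 mul1r gtr0_norm// divr_gt0.
have /hd hh : `|h| < d by rewrite hn; lra.
pose s := h * c.
have sE : s = `|h| * `|c| by rewrite hn /s /h [`|c|]normrEsg; ring.
have s0 : 0 < s by rewrite sE hn !mulr_gt0// normr_gt0.
have rs0 : rc s != 0 by apply/eqP => -[h']; move: s0; rewrite h' ltxx.
pose p := gamma (t + h).
(* The first-order error is shifted from [p] to [w], so that [gamma t] lies exactly on the segment
   from [w'] to [p], at parameter [1 / (1 + s)]. *)
pose w' := w - (p - gamma t - rc h * curve_deriv gamma t) / rc s.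
have Ow' : Omega w'.
  apply: rhoO; rewrite /w' opprB addrC subrK modulusM modulusV modulus_rc.
  rewrite (gtr0_norm s0) ltr_pdivrMr//; apply: le_lt_trans hh _.
  rewrite sE (_ : rho * (`|h| * `|c|) = `|c| * rho * `|h|); last by ring.
  rewrite ltr_pM2r; last by rewrite hn divr_gt0.
  have : 0 < `|c| * rho by rewrite mulr_gt0// normr_gt0.
  by lra.
have s10 : 0 < 1 + s by lra.
have s1 : rc (1 + s) != 0 by apply/eqP => -[h']; move: s10; rewrite h' ltxx.
have := convex_closure_segment Oopen Oconvex (boundary_closure Ogamma (t := t + h)) Ow' (_ : 0 <= (1 + s)^-1 < 1).
rewrite invr_ge0 (ltW s10) invf_lt1// ltrDl s0 => /(_ isT).
suff -> : w' + rc (1 + s)^-1 * (p - w') = gamma t by exact: (boundary_out Oopen Ogamma (t := t)).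
have pE : p - gamma t - rc h * curve_deriv gamma t = rc s * (w - w').
  by rewrite /w' subKr [RHS]mulrC divfK.
have {}pE : p = gamma t + rc s * (gamma t - w) + rc s * (w - w').
  by rewrite -pE dgE /s rmorphM /=; ring.
by rewrite pE fmorphV /= rmorphD /= in s1 *; field.
Qed.

Lemma im_divC (a b : C) : im (a * b^-1) = im (a * conjc b) / (re b ^+ 2 + im b ^+ 2).
Proof. by case: a b => [a1 a2] [b1 b2] /=; ring. Qed.

(** Being continuous and nonzero, the cross product has one sign along the curve; a negative one
    would make the imaginary part of the integral of [du / (u - w)] nonpositive, while positive
    orientation makes it [2 pi]. *)
Lemma tangent_cross_gt0 w t : Omega w ->
  0 < im (curve_deriv gamma t * conjc (gamma t - w)).
Proof.
move=> Ow; rewrite lt_neqAle eq_sym; have -> := tangent_avoids t Ow; rewrite /= leNgt.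
apply/negP => q0.
have cq : continuous (tangent_cross w).
  apply: (@continuous_Im R R (fun t => curve_deriv gamma t * conjc (gamma t - w))).
  apply: (continuousM_C (continuous_curve_deriv gC)).
  exact: (continuous_conj (continuousB_C (continuous_C1_curve gC) (@continuous_cstC _ _ w))).
have qneg := same_sign cq (fun t => tangent_avoids t Ow) q0.
have gw u : gamma u != w by exact: (gamma_neq Oopen Ogamma).
have cf := continuousM_C (continuous_inv_sub (continuous_C1_curve gC) gw) (continuous_curve_deriv gC).
have := contour_winding gamma w; rewrite (winding_in Ogamma Ow) mulr1 contour_intE.
move=> /(congr1 im) /=; apply/eqP; rewrite lt_eqF//.
apply: (@le_lt_trans _ _ 0); last by rewrite pmulrn_lgt0// pi_gt0.
have h0 : rint 0 1 (fun=> 0 : R) = 0 by rewrite rint_cst ?ler01// mul0r.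
rewrite -[X in _ <= X]h0.
have c0 : continuous (fun _ : R => 0 : R) by exact: cst_continuous.
apply: (ler_rint (continuous_Im cf) c0).
move=> u _ /=; rewrite mulrC im_divC; apply: ltW.
rewrite pmulr_llt0; first exact: qneg.
rewrite invr_gt0; have : gamma u - w != 0 by rewrite subr_eq0.
by rewrite -modulus_gt0 /modulus sqrtr_gt0.
Qed.

End Positivity.

(** * Quadrature with positive weights *)

Section Quadrature.
Variable R : realType.

Lemma cvg_det d (A : nat -> 'M[R]_d) (B : 'M[R]_d) :
  (forall i j, A n i j @[n --> \oo] --> B i j) ->
  \det (A n) @[n --> \oo] --> \det B.
Proof.
move=> AB; apply: cvg_big => [|s _]; first exact: add_continuous.
apply: cvgM; first exact: cvg_cst.
apply: cvg_big => [|i _]; last exact: AB.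
exact: mul_continuous.
Qed.

Lemma cvg_adj d (A : nat -> 'M[R]_d) (B : 'M[R]_d) i j :
  (forall i j, A n i j @[n --> \oo] --> B i j) ->
  (\adj (A n)) i j @[n --> \oo] --> (\adj B) i j.
Proof.
move=> AB; rewrite mxE; under eq_cvg do rewrite mxE.
apply: cvgM; first exact: cvg_cst.
by apply: cvg_det => k l; rewrite !mxE; under eq_cvg do rewrite !mxE; exact: AB.
Qed.

(** Vanishing of an integral is detected only at interior points; an endpoint is reached by pushing
    it slightly towards [1 / 2]. *)
Lemma continuous_eq0_closed (f : R -> R) : continuous f ->
  (forall t, 0 < t < 1 -> f t = 0) -> forall t, 0 <= t <= 1 -> f t = 0.
Proof.
move=> cf f0 t /andP[t0 t1]; apply: contrapT => /eqP ft.
have ft0 : 0 < `|f t| by rewrite normr_gt0.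
have /cvgrPdist_lt/(_ _ ft0)/nbhs_ballP[d /= d0 hd] := cf t.
pose m := Num.min (d / 2) (1 / 4).
have m0 : 0 < m by rewrite lt_min !divr_gt0.
have m1 : m <= d / 2 by rewrite ge_min lexx.
have m2 : m <= 1 / 4 by rewrite ge_min lexx orbT.
have := hd (t + m * (1 - 2 * t)); rewrite /ball/= (f0 (t + m * (1 - 2 * t))) ?subr0 ?ltxx; last first.
  have q0 : 0 <= t * (1 - 2 * m) by rewrite mulr_ge0//; lra.
  have q1 : 0 <= (1 - t) * (1 - 2 * m) by rewrite mulr_ge0//; lra.
  have E0 : t + m * (1 - 2 * t) = t * (1 - 2 * m) + m by ring.
  have E1 : 1 - (t + m * (1 - 2 * t)) = (1 - t) * (1 - 2 * m) + m by ring.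
  by apply/andP; split; [rewrite E0 ltr_wpDl|rewrite -subr_gt0 E1 ltr_wpDl].
suff -> : `|t - (t + m * (1 - 2 * t))| < d by move=> /(_ isT).
rewrite opprD addrA subrr add0r normrN normrM gtr0_norm//.
have : `|1 - 2 * t| <= 1 by rewrite ler_norml; apply/andP; split; lra.
by move=> h; apply: le_lt_trans (_ : m * 1 < _); [rewrite ler_pM2l|lra].
Qed.

Lemma bounded_family d (phi : 'I_d -> R -> R) : (forall j, continuous (phi j)) ->
  exists2 B, 0 < B & forall j t, 0 <= t <= 1 -> `|phi j t| <= B.
Proof.
move=> cphi; elim: d phi cphi => [|d IH] phi cphi; first by exists 1 => // -[].
have [B B0 hB] := IH (fun j => phi (lift ord0 j)) (fun j => cphi _).
have cn : {within `[(0 : R), 1], continuous (fun t => `|phi ord0 t|)}.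
  by apply: continuous_subspaceT => t; apply: cvg_norm; exact: cphi.
have [c c01 hc] := EVT_max ler01 cn.
exists (Num.max B `|phi ord0 c|); first by rewrite lt_max B0.
move=> j t t01; rewrite le_max; case: (unliftP ord0 j) => [k|] ->.
  by rewrite hB.
by rewrite hc ?orbT// in_itv.
Qed.

(* For linearly independent phi, correct the Riemann weights 1/N by the factors
   1 + sum_j c_j phi_j(x), where c solves the Riemann-Gram system whose right-hand
   side is the Riemann error; c tends to 0, so the weights are eventually positive. *)
Lemma positive_quadrature_free d (phi : 'I_d -> R -> R) :
  (forall j, continuous (phi j)) ->
  (forall u : 'rV[R]_d,
     (forall t, 0 <= t <= 1 -> \sum_j u 0 j * phi j t = 0) -> u = 0) ->
  exists n (x w : 'I_n -> R), [/\ forall i, 0 <= x i <= 1, forall i, 0 < w i &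
    forall j, \sum_(i < n) w i * phi j (x i) = rint 0 1 (phi j)].
Proof.
move=> cphi free.
have cphi2 j l : continuous (fun t => phi j t * phi l t).
  by move=> t; apply: cvgM; exact: cphi.
pose G := \matrix_(j < d, l < d) rint 0 1 (fun t => phi j t * phi l t).
pose Gn n := \matrix_(j < d, l < d) riemann n (fun t => phi j t * phi l t).
pose e n := \row_(j < d) (rint 0 1 (phi j) - riemann n (phi j)).
(* Cramer's rule for [c *m Gn = e]: determinant and adjugate are polynomial in the entries, so
   convergence passes through them. *)
pose c n := (\det (Gn n))^-1 *: (e n *m \adj (Gn n)).
have cGn j l : Gn n j l @[n --> \oo] --> G j l.
  by rewrite mxE; under eq_cvg do rewrite mxE; exact: cvg_riemann.
have ce j : e n 0 j @[n --> \oo] --> (0 : R).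
  under eq_cvg do rewrite mxE.
  have h : rint 0 1 (phi j) - riemann n (phi j) @[n --> \oo] -->
      rint 0 1 (phi j) - rint 0 1 (phi j).
    by apply: cvgB; [exact: cvg_cst|exact: cvg_riemann].
  by rewrite subrr in h.
(* A kernel vector of the Gram matrix gives a combination [f] of the [phi j] for which the integral
   of [f^2] is 0. *)
have G0 : \det G != 0.
  apply/det0P => -[u u0 uG]; move/negP: u0; apply; apply/eqP; apply: free.
  pose f t := \sum_j u 0 j * phi j t.
  have cf : continuous f.
    apply: (@continuous_bigsum _ _ _ (fun j t => u 0 j * phi j t)) => j t.
    by apply: cvgM; [exact: cvg_cst|exact: cphi].
  have cf2 : continuous (fun t => f t * f t) by move=> t; apply: cvgM; exact: cf.
  have f20 : rint 0 1 (fun t => f t * f t) = 0.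
    have -> : rint 0 1 (fun t => f t * f t) = (u *m G *m u^T) 0 0.
      rewrite mxE.
      have cfl l : continuous (fun t => u 0 l * (f t * phi l t)).
        by move=> t; apply: cvgM; [exact: cvg_cst|apply: cvgM; [exact: cf|exact: cphi]].
      rewrite (_ : rint 0 1 _ = rint 0 1 (fun t => \sum_l u 0 l * (f t * phi l t))); last first.
        by apply: eq_rint => t _; rewrite {2}/f mulr_sumr; apply: eq_bigr => l _; rewrite mulrCA.
      rewrite rint_sum//; apply: eq_bigr => l _.
      rewrite rintZ; last by move=> t; apply: cvgM; [exact: cf|exact: cphi].
      rewrite mulrC [u^T _ _]mxE; congr (_ * _); rewrite mxE.
      have cjl j : continuous (fun t => u 0 j * (phi j t * phi l t)).
        by move=> t; apply: cvgM; [exact: cvg_cst|exact: cphi2].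
      rewrite (_ : rint 0 1 _ = rint 0 1 (fun t => \sum_j u 0 j * (phi j t * phi l t))); last first.
        by apply: eq_rint => t _; rewrite /f mulr_suml; apply: eq_bigr => j _; rewrite mulrA.
      rewrite rint_sum//; apply: eq_bigr => j _.
      by rewrite rintZ// mxE.
    by rewrite uG mul0mx mxE.
  have f0 : forall t, 0 < t < 1 -> f t = 0.
    move=> t t01; apply/eqP.
    have := rint_ge0_eq0 cf2 _ f20 t01 => /(_ (fun t _ => sqr_ge0 (f t)))/eqP.
    by rewrite mulf_eq0 orbb.
  by move=> t t01; exact: (continuous_eq0_closed cf f0).
have cc j : c n 0 j @[n --> \oo] --> (0 : R).
  have h1 : (e n *m \adj (Gn n)) 0 j @[n --> \oo] --> \sum_(l < d) 0 * (\adj G) l j.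
    under eq_cvg do rewrite mxE.
    apply: cvg_big => [|l _]; first exact: add_continuous.
    by apply: cvgM; [exact: ce|exact: cvg_adj].
  have h2 : (\det (Gn n))^-1 * (e n *m \adj (Gn n)) 0 j @[n --> \oo] -->
      (\det G)^-1 * \sum_(l < d) 0 * (\adj G) l j.
    by apply: cvgM => //; apply: cvgV => //; exact: cvg_det.
  rewrite big1 ?mulr0 in h2; last by move=> l _; rewrite mul0r.
  by under eq_cvg do rewrite mxE.
have [B B0 hB] := bounded_family cphi.
(* This size of the coefficients keeps the sum of the [c_j phi_j] below [d / (2 (d + 1)) < 1];
   [d.+1] also covers the empty family. *)
have eps0 : 0 < (2 * d.+1%:R * B)^-1 by rewrite invr_gt0 !mulr_gt0.
have [n [cn detn]] : exists n, (forall j, `|c n 0 j| <= (2 * d.+1%:R * B)^-1) /\ \det (Gn n) != 0.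
  have h1 : \forall n \near \oo, forall j, `|c n 0 j| <= (2 * d.+1%:R * B)^-1.
    apply: filter_forall => j.
    have /cvgrPdist_le/(_ _ eps0) := cc j.
    by apply: filterS => n; rewrite sub0r normrN.
  have h2 : \forall n \near \oo, \det (Gn n) != 0.
    have d0 : 0 < `|\det G| by rewrite normr_gt0.
    have /cvgrPdist_lt/(_ _ d0) := cvg_det cGn.
    apply: filterS => n h; apply/eqP => h0; move: h; rewrite h0 subr0 ltxx//.
  by have [n [a1 a2]] := filter_ex (filterI h1 h2); exists n.
pose x (i : 'I_n.+1) : R := i%:R / n.+1%:R.
have x01 i : 0 <= x i <= 1.
  by rewrite divr_ge0//= ler_pdivrMr// mul1r ler_nat ltnW.
exists n.+1, x, (fun i => n.+1%:R^-1 * (1 + \sum_j c n 0 j * phi j (x i))).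
split=> // [i|l].
  rewrite mulr_gt0 ?invr_gt0// -ltrBlDl sub0r.
  suff : `|\sum_j c n 0 j * phi j (x i)| < 1 by rewrite ltr_norml => /andP[].
  apply: le_lt_trans (ler_norm_sum _ _ _) _.
  apply: (@le_lt_trans _ _ (\sum_(j < d) (2 * d.+1%:R * B)^-1 * B)).
    by apply: ler_sum => j _; rewrite normrM; apply: ler_pM => //; exact: hB.
  rewrite sumr_const card_ord invfM -mulrA mulVf ?gt_eqF// mulr1 -[X in X < _]mulr_natr.
  rewrite mulrC ltr_pdivrMr ?mulr_gt0// mul1r -natrM ltr_nat.
  by rewrite mulSn mul1n ltn_addr.
have -> : rint 0 1 (phi l) = riemann n (phi l) + (c n *m Gn n) 0 l.
  by rewrite /c -scalemxAl -mulmxA mul_adj_mx mul_mx_scalar scalerA mulVf// scale1r mxE addrC subrK.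
rewrite /riemann mxE.
under eq_bigr do rewrite -mulrA mulrDl mul1r mulrDr.
rewrite big_split/= -mulr_sumr; congr (_ + _).
under [RHS]eq_bigr do rewrite [Gn _ _ _]mxE /riemann mulrCA mulr_sumr.
rewrite -!mulr_sumr; congr (_ * _).
rewrite exchange_big/=; apply: eq_bigr => i _; rewrite mulr_suml.
by apply: eq_bigr => j _; rewrite mulrA.
Qed.

(** A linear relation on [[0, 1]] makes one function redundant, and it passes to the quadrature
    because the nodes lie in [[0, 1]]. When no relation is left, the free case applies. *)
Lemma positive_quadrature d (phi : 'I_d -> R -> R) :
  (forall j, continuous (phi j)) ->
  exists n (x w : 'I_n -> R), [/\ forall i, 0 <= x i <= 1, forall i, 0 < w i &
    forall j, \sum_(i < n) w i * phi j (x i) = rint 0 1 (phi j)].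
Proof.
elim: d phi => [|d IH] phi cphi.
  by exists 0%N, (fun=> 0), (fun=> 0); split=> // -[].
have [dep|free] := pselect (exists2 u : 'rV[R]_d.+1, u != 0 &
    forall t, 0 <= t <= 1 -> \sum_j u 0 j * phi j t = 0); last first.
  apply: positive_quadrature_free => // u hu; apply/eqP; apply: contrapT => /negP u0.
  by apply: free; exists u.
have [u /rV0Pn[k uk] hu] := dep.
have [n [x [w [x01 w0 hw]]]] := IH (fun j => phi (lift k j)) (fun j => cphi _).
exists n, x, w; split=> // j; case: (unliftP k j) => [l ->|->]; first exact: hw.
have E t : 0 <= t <= 1 -> phi k t = \sum_(l < d) - (u 0 k)^-1 * u 0 (lift k l) * phi (lift k l) t.
  move=> /hu; rewrite (bigD1_ord k)//= => /eqP; rewrite addr_eq0 => /eqP h.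
  apply: (mulfI uk); rewrite h mulr_sumr -sumrN; apply: eq_bigr => l _.
  by rewrite !mulrA mulrN mulfV// !mulN1r mulNr.
have cl (l : 'I_d) : continuous (fun t => - (u 0 k)^-1 * u 0 (lift k l) * phi (lift k l) t).
  by move=> t; apply: cvgM; [exact: cvg_cst|exact: cphi].
rewrite (eq_rint E) rint_sum//.
under eq_bigr => i _ do rewrite (E (x i))// mulr_sumr.
rewrite exchange_big/=; apply: eq_bigr => l _.
rewrite rintZ// -hw mulr_sumr; apply: eq_bigr => i _; rewrite mulrCA//.
Qed.

End Quadrature.

(** * Dilation *)

Section DotSpaces.
Variable R : realType.
Local Notation C := (Cx R).
Variable V : vectType C.

Lemma dot_of_sesquilinear (op : V -> V -> C) :
  (forall a u v w, op (a *: u + v) w = a * op u w + op v w) ->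
  (forall u v, op u v = (op v u)^*%R) ->
  (forall u, u != 0 -> 0 < op u u) ->
  exists d : {dot V for Num.conj}, forall u v, d u v = op u v.
Proof.
move=> opl oph opp.
have hb : bilinear_for *%R (Num.conj \; *%R) op.
  split=> [w a u v|w a u v] /=; first exact: opl.
  by rewrite oph opl rmorphD rmorphM /= -!oph.
have hh u v : op u v = (-1) ^+ false * (op v u)^*%R by rewrite expr0 mul1r.
pose d : {dot V for Num.conj} := HB.pack op (bilinear_isBilinear.Build _ _ _ _ _ _ op hb)
  (isHermitianSesquilinear.Build _ _ _ _ op hh) (isDotProduct.Build _ _ op opp).
by exists d.
Qed.

Variable form : {dot V for Num.conj}.
Implicit Types (u v w : V) (T S : 'End(V)) (U : {vspace V}).

Lemma formC_dot u v : form u v = (form v u)^*%R.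
Proof. by rewrite hermC expr0 mul1r. Qed.

Lemma dotDl u v w : form (u + v) w = form u w + form v w.
Proof. exact: linearDl. Qed.
Lemma dotZl a u w : form (a *: u) w = a * form u w.
Proof. exact: linearZl_LR. Qed.
Lemma dotDr u v w : form w (u + v) = form w u + form w v.
Proof. exact: linearDr. Qed.
Lemma dotZr a u w : form w (a *: u) = a^*%R * form w u.
Proof. exact: linearZr_LR. Qed.
Lemma dotBr u v w : form w (u - v) = form w u - form w v.
Proof. exact: linearBr. Qed.
Lemma dot_gt0 u : u != 0 -> 0 < form u u.
Proof. by move=> u0; rewrite (dnorm_gt0 form). Qed.
Lemma dot_eq0 u : form u u = 0 -> u = 0.
Proof. by move/eqP; rewrite (dnorm_eq0 form) => /eqP. Qed.

Lemma dot0r w : form w 0 = 0. Proof. exact: linear0r. Qed.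

Lemma dot_sumr (I : Type) (r : seq I) (F : I -> V) w :
  form w (\sum_(i <- r) F i) = \sum_(i <- r) form w (F i).
Proof.
apply: (big_morph (form w)) => [u v|]; first exact: dotDr.
exact: dot0r.
Qed.

Lemma form_inj u v : (forall w, form w u = form w v) -> u = v.
Proof.
move=> uv; apply/eqP; rewrite -subr_eq0; apply/eqP/dot_eq0.
by rewrite dotBr uv subrr.
Qed.

Lemma orthogonal_decomposition U v : exists2 u, u \in U &
  forall w, w \in U -> form (v - u) w = 0.
Proof.
have [u uS [y [vE _ /orthoPl yS]]] := orthogonal_split form (vbasis U) v.
exists u; first by rewrite -(span_basis (vbasisP U)).
move=> w wU; rewrite vE addrC addKr [w](coord_vbasis wU) dot_sumr big1// => i _.
by rewrite dotZr yS ?mulr0// mem_nth// size_tuple.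
Qed.

(** A vector off the kernel, made orthogonal to the kernel, represents [phi] up to a scalar; the
    scalar is conjugated because the form is antilinear on the right. *)
Lemma riesz (phi : V -> C) : (forall a u v, phi (a *: u + v) = a * phi u + phi v) ->
  exists y, forall u, phi u = form u y.
Proof.
move=> phiL.
have phi0 : phi 0 = 0 by have := phiL (-1) 0 0; rewrite scaler0 addr0 mulN1r addNr.
have [h|] := pselect (forall u, phi u = 0).
  by exists 0 => u; rewrite h dot0r.
move=> /existsNP[w /eqP phiw].
have hL : linear (phi : V -> C^o) by move=> a u v; exact: phiL.
pose phi' : {linear V -> C^o} := HB.pack (phi : V -> C^o)
  (GRing.isSemilinear.Build C V C^o *:%R (phi : V -> C^o) (GRing.semilinear_linear hL)).
have kerE u : (u \in lker (linfun phi')) = (phi u == 0) by rewrite memv_ker lfunE.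
have [u + uw] := orthogonal_decomposition (lker (linfun phi')) w.
rewrite kerE => /eqP phiu; set y := w - u in uw.
have phiB a v1 v2 : phi (v1 - a *: v2) = phi v1 - a * phi v2.
  by rewrite addrC -scaleNr phiL mulNr addrC.
have phiy : phi y = phi w by rewrite /y -[u]scale1r phiB phiu mulr0 subr0.
have yy : form y y != 0.
  by apply/eqP => /dot_eq0 y0; move: phiw; rewrite -phiy y0 phi0 eqxx.
exists ((phi w / form y y)^*%R *: y) => v.
rewrite dotZr conjCK.
have : form (v - (phi v / phi w) *: y) y = 0.
  by rewrite formC_dot uw ?rmorph0// kerE phiB phiy divfK ?subrr.
rewrite -scaleNr addrC dotDl dotZl mulNr addrC => /eqP; rewrite subr_eq0 => /eqP ->.
by field; rewrite yy phiw.
Qed.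

(** Guarantees that the [xget] in [adjoint] is not its default 0. *)
Lemma adjoint_exists T : exists S, forall u v, form (T u) v = form u (S v).
Proof.
have /choice[f hf] : forall v, exists y, forall u, form (T u) v = form u y.
  move=> v; apply: riesz => a u w.
  by rewrite linearP dotDl dotZl.
have fL : linear f.
  move=> a u v; apply: form_inj => w.
  by rewrite -hf !dotDr !dotZr !hf.
pose f' : {linear V -> V} := HB.pack f
  (GRing.isSemilinear.Build C V V *:%R f (GRing.semilinear_linear fL)).
by exists (linfun f') => u v; rewrite lfunE; exact: hf.
Qed.

Lemma adjointP T u v : form (T u) v = form u (adjoint form T v).
Proof. exact: (xgetPex 0 (adjoint_exists T)). Qed.

Lemma adjoint_unique T S : (forall u v, form (T u) v = form u (S v)) -> adjoint form T = S.
Proof.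
move=> TS; apply/lfunP => v; apply: form_inj => u.
by rewrite -adjointP TS.
Qed.

(** [daddv_pi] projects along [orthov form U], which meets [U] trivially since the form is definite;
    so [u] and [v - u] are the components it computes. *)
Lemma orth_proj_unique U v u : u \in U -> (forall w, w \in U -> form (v - u) w = 0) ->
  orth_proj form U v = u.
Proof.
move=> uU vu; rewrite /orth_proj.
have disj : (U :&: orthov form U = 0)%VS.
  apply/eqP; rewrite -subv0; apply/subvP => w; rewrite memv_cap memv0 => /andP[wU].
  by move=> /mem_orthovP/(_ w wU)/dot_eq0 ->.
have vuO : v - u \in orthov form U by apply/mem_orthovP => w; exact: vu.
have vE : v = u + (v - u) by rewrite addrC subrK.
have := daddv_pi_add disj (w := v); rewrite {1}vE memv_add// => /(_ isT) E.
set p := daddv_pi U _ v in E *; set q := daddv_pi _ U v in E.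
have pU : p \in U by exact: memv_pi.
have qO : q \in orthov form U by exact: memv_pi.
have : p - u \in (U :&: orthov form U)%VS.
  rewrite memv_cap memvB//=.
  have -> : p - u = (v - u) - q by rewrite -E addrAC addrK.
  exact: memvB.
by rewrite disj memv0 subr_eq0 => /eqP.
Qed.

End DotSpaces.

(** * Quadrature for complex functions *)

Section ComplexQuadrature.
Variable R : realType.
Local Notation C := (Cx R).
Local Notation re := (@complex.Re R).
Local Notation im := (@complex.Im R).
Local Notation rc := (real_complex R : R -> C).

Lemma continuous_bigsum_seq (I : Type) (r : seq I) (f : I -> R -> C) :
  (forall j, continuous (f j)) -> continuous (fun t => \sum_(j <- r) f j t).
Proof.
move=> cf; elim: r => [|j r IH].
  rewrite (_ : (fun _ => _) = fun=> 0); first exact: continuous_cstC.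
  by apply/funext => t; rewrite big_nil.
rewrite (_ : (fun _ => _) = fun t => f j t + \sum_(l <- r) f l t).
  exact: (continuousD_C (cf j) IH).
by apply/funext => t; rewrite big_cons.
Qed.

Lemma cint_sum_seq (I : Type) (r : seq I) (f : I -> R -> C) :
  (forall j, continuous (f j)) ->
  cint 0 1 (fun t => \sum_(j <- r) f j t) = \sum_(j <- r) cint 0 1 (f j).
Proof.
move=> cf; elim: r => [|j r IH].
  by rewrite big_nil -[RHS](cint0 0 1); apply: eq_cint => t _; rewrite big_nil.
rewrite big_cons -IH -(cintD 0 1 (cf j) (@continuous_bigsum_seq I r f cf)).
by apply: eq_cint => t _; rewrite big_cons.
Qed.

(** The real quadrature is run on all real and imaginary parts, told apart by the boolean. Nodes and
    weights come before the coefficients [a], so exactness holds on the whole complex span. *)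
Lemma positive_quadratureC (I : finType) (F : I -> R -> C) :
  (forall j, continuous (F j)) ->
  exists n (x w : 'I_n -> R), (forall i, 0 < w i) /\
    forall a : I -> C, \sum_(i < n) rc (w i) * (\sum_j a j * F j (x i)) =
      cint 0 1 (fun t => \sum_j a j * F j t).
Proof.
move=> cF; pose G (jb : I * bool) : R -> R :=
  if jb.2 then re \o F jb.1 else im \o F jb.1.
have cG jb : continuous (G jb).
  by case: jb => j [] /=; [exact: continuous_Re|exact: continuous_Im].
have [n [x [w [_ w0 hw]]]] :=
  positive_quadrature (phi := fun k : 'I_#|{: I * bool}| => G (enum_val k)) (fun k => cG _).
have {}hw jb : \sum_(i < n) w i * G jb (x i) = rint 0 1 (G jb).
  by have := hw (enum_rank jb); rewrite enum_rankK.
exists n, x, w; split=> // a.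
have Fw j : \sum_(i < n) rc (w i) * F j (x i) = cint 0 1 (F j).
  apply: complex_eq.
    rewrite (big_morph re (@cReD R) (id1 := 0))// -[RHS](hw (j, true)).
    by apply: eq_bigr => i _; rewrite cReM /= mul0r subr0.
  rewrite (big_morph im (@cImD R) (id1 := 0))// -[RHS](hw (j, false)).
  by apply: eq_bigr => i _; rewrite cImM /= mul0r addr0.
have caF j := continuousM_C (@continuous_cstC R R (a j)) (cF j).
rewrite (cint_sum_seq _ caF).
under eq_bigr do rewrite mulr_sumr.
rewrite exchange_big/=; apply: eq_bigr => j _.
rewrite (cintZ 0 1 _ (cF j)) -Fw mulr_sumr.
by apply: eq_bigr => i _; rewrite mulrCA.
Qed.

End ComplexQuadrature.

(** * Diagonal operators on a direct sum *)

Section DirectSum.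
Variables (R : realType) (H : vectType (Cx R)) (n : nat).
Local Notation C := (Cx R).
Local Notation K := {ffun 'I_n -> H}.

Lemma direct_sum_dot (D : 'I_n -> H -> H -> C) :
  (forall i a u v w, D i (a *: u + v) w = a * D i u w + D i v w) ->
  (forall i u v, D i u v = (D i v u)^*%R) ->
  (forall i u, u != 0 -> 0 < D i u u) ->
  exists d : {dot K for Num.conj}, forall x y, d x y = \sum_i D i (x i) (y i).
Proof.
move=> Dl Dh Dp.
have D0 i u : D i 0 u = 0.
  by have := Dl i (-1) 0 0 u; rewrite scaler0 addr0 mulN1r addNr.
apply: (dot_of_sesquilinear (op := fun x y : K => \sum_i D i (x i) (y i))).
- move=> a x y z; rewrite mulr_sumr -big_split/=; apply: eq_bigr => i _.
  by rewrite !ffunE Dl.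
- by move=> x y; rewrite rmorph_sum; apply: eq_bigr => i _; exact: Dh.
- move=> x x0; have [i xi] : exists i, x i != 0.
    apply: contrapT => /forallNP h; move/eqP: x0; apply; apply/ffunP => i.
    by rewrite ffunE; apply: contrapT => /eqP; exact: h.
  rewrite (bigD1 i)//=; apply: ltr_wpDr; last exact: Dp.
  apply: sumr_ge0 => j _; have [->|xj] := eqVneq (x j) 0; first by rewrite D0.
  exact: ltW (Dp _ _ _).
Qed.

Lemma linfun_exists (U W : vectType C) (f : U -> W) : linear f ->
  exists F : 'Hom(U, W), forall u, F u = f u.
Proof.
move=> fL; pose f' : {linear U -> W} := HB.pack f
  (GRing.isSemilinear.Build C U W *:%R f (GRing.semilinear_linear fL)).
by exists (linfun f') => u; rewrite lfunE.
Qed.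

Variables (D : 'I_n -> H -> H -> C) (dotK : {dot K for Num.conj}).
Hypothesis dotKE : forall x y, dotK x y = \sum_i D i (x i) (y i).
Variables (zeta : 'I_n -> C) (N : 'End(K)).
Hypothesis NE : forall x i, N x i = zeta i *: x i.
Hypothesis Dl : forall i a u w, D i (a *: u) w = a * D i u w.
Hypothesis Dr : forall i a u w, D i u (a *: w) = a^*%R * D i u w.
Hypothesis D0 : forall i u, D i u 0 = 0 /\ D i 0 u = 0.

(** [N] is a scalar on each summand and the summands are orthogonal, so the adjoint acts by the
    conjugate scalars whatever the forms [D i] are. *)
Lemma diagonal_normal : normal_op dotK N.
Proof.
have [S SE] : exists S : 'End(K), forall x, S x = [ffun i => (zeta i)^*%R *: x i].
  apply: linfun_exists => a x y; apply/ffunP => i.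
  by rewrite !ffunE scalerDr !scalerA mulrC.
rewrite /normal_op; have -> : adjoint dotK N = S.
  apply: adjoint_unique => x y; rewrite !dotKE; apply: eq_bigr => i _.
  by rewrite NE SE ffunE Dl Dr conjCK.
apply/lfunP => x; apply/ffunP => i.
by rewrite !comp_lfunE NE !SE !ffunE NE !scalerA mulrC.
Qed.

Lemma mem_diagonal_eigenspace x z :
  x \in passmx.leigenspace N z <-> forall i, zeta i != z -> x i = 0.
Proof.
rewrite memv_ker add_lfunE opp_lfunE scale_lfunE id_lfunE subr_eq0; split.
  move=> /eqP/ffunP h i zi; have := h i; rewrite NE ffunE => /eqP.
  by rewrite -subr_eq0 -scalerBl scaler_eq0 subr_eq0 (negbTE zi) => /eqP.
move=> h; apply/eqP/ffunP => i; rewrite NE ffunE.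
by have [->//|/h ->] := eqVneq (zeta i) z; rewrite !scaler0.
Qed.

Lemma diagonal_spectrum z : spectrum N z -> exists i, z = zeta i.
Proof.
move=> Nz; apply: contrapT => /forallNP h.
have E : passmx.leigenspace N z = 0%VS.
  apply/eqP; rewrite -subv0; apply/subvP => x /mem_diagonal_eigenspace hx.
  rewrite memv0; apply/eqP/ffunP => i; rewrite ffunE; apply: hx.
  by apply/eqP => zi; apply: (h i).
by move: Nz; rewrite /spectrum/= /passmx.leigenvalue E eqxx.
Qed.

Lemma diagonal_orth_proj x z i :
  orth_proj dotK (passmx.leigenspace N z) x i = if zeta i == z then x i else 0.
Proof.
rewrite (@orth_proj_unique _ _ dotK _ x [ffun i => if zeta i == z then x i else 0]).
- by rewrite ffunE.
- by apply/mem_diagonal_eigenspace => j /negbTE zj; rewrite ffunE zj.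
- move=> y /mem_diagonal_eigenspace hy; rewrite dotKE big1// => j _.
  rewrite !ffunE; have [zj|zj] := eqVneq (zeta j) z.
    by rewrite subrr (D0 _ _).2.
  by rewrite (hy _ zj) (D0 _ _).1.
Qed.

Lemma diagonal_cont_calculus (f : C -> C) x i :
  cont_calculus dotK f N x i = f (zeta i) *: x i.
Proof.
(* The [zeta j] may repeat, hence [undup]; and for [H = 0] they are not eigenvalues, in which case
   the added terms project onto the zero space. *)
rewrite /cont_calculus; pose s := undup [seq zeta j | j <- enum 'I_n].
rewrite (fsbig_widen (spectrum N) [set` s]); first last.
- move=> z [_ /negP]; rewrite negbK => /eqP z0 /=.
  rewrite (_ : orth_proj _ _ = 0) ?scaler0//.
  apply/lfunP => y; rewrite zero_lfunE z0; apply: orth_proj_unique; first exact: mem0v.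
  by move=> w; rewrite memv0 => /eqP ->; rewrite dot0r.
- by move=> z /diagonal_spectrum[j ->] /=; rewrite mem_undup map_f// mem_enum.
rewrite -fsbig_seq ?undup_uniq// sum_lfunE.
have -> (r : seq C) (F : C -> K) : (\sum_(z <- r) F z) i = \sum_(z <- r) F z i.
  by apply: (big_morph (fun y : K => y i)) => [y z|]; rewrite ffunE.
have si : zeta i \in s by rewrite mem_undup map_f// mem_enum.
have T z : (f z *: orth_proj dotK (passmx.leigenspace N z))%VF x i =
    if z == zeta i then f (zeta i) *: x i else 0.
  rewrite scale_lfunE ffunE diagonal_orth_proj eq_sym.
  by case: eqP => [->//|_]; rewrite scaler0.
rewrite (eq_bigr _ (fun z _ => T z)) -big_mkcond/= -big_filter.
by rewrite filter_pred1_uniq ?undup_uniq// big_seq1.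
Qed.

End DirectSum.

(** * The positive density on the boundary *)

Section OperatorMeasure.
Variables (R : realType) (Omega : set (Cx R)) (gamma : R -> Cx R).
Variables (H : vectType (Cx R)) (dotH : {dot H for Num.conj}) (T : 'End(H)).
Local Notation C := (Cx R).
Local Notation re := (@complex.Re R).
Local Notation im := (@complex.Im R).
Local Notation rc := (real_complex R : R -> C).
Hypothesis Oopen : open Omega.
Hypothesis Oconvex : @convex_set _ C^o Omega.
Hypothesis Ogamma : boundary_param Omega gamma.
Hypothesis WT : numerical_range dotH T `<=` Omega.

Let gC : C1_closed_curve gamma := boundary_C1 Ogamma.
Let cg : continuous gamma := continuous_C1_curve gC.
Let cdg : continuous (curve_deriv gamma) := continuous_curve_deriv gC.

Lemma rayleigh_quotient v : v != 0 -> Omega (dotH (T v) v / dotH v v).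
Proof.
move=> v0; have n0 := dot_gt0 dotH v0; set n := dotH v v in n0 *.
pose a := (sqrtC n)^-1.
have ar : a^*%R = a by apply: geC0_conj; rewrite invr_ge0 sqrtC_ge0 ltW.
have a2 : a * a = n^-1 by rewrite /a -invfM -expr2 sqrtCK.
apply: WT; exists (a *: v).
  by rewrite dotZl dotZr ar mulrA a2 mulVf// gt_eqF.
have -> : T (a *: v) = a *: T v by exact: linearZ.
by rewrite dotZl dotZr ar mulrA a2 mulrC.
Qed.

Lemma spectrum_in_Omega z : spectrum T z -> Omega z.
Proof.
move=> Tz; have [v vl v0] : exists2 v, T v = z *: v & v != 0.
  exists (vpick (passmx.leigenspace T z)); last by rewrite vpick0.
  have := memv_pick (passmx.leigenspace T z).
  rewrite memv_ker add_lfunE opp_lfunE scale_lfunE id_lfunE subr_eq0.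
  by move=> /eqP.
have := rayleigh_quotient v0; rewrite vl dotZl mulfK// gt_eqF//.
exact: dot_gt0.
Qed.

Let gT t : ~ spectrum T (gamma t) := boundary_spectrum Oopen Ogamma spectrum_in_Omega (t := t).

Definition cauchy_density t u v : C :=
  (two_pi_i R)^-1 * (curve_deriv gamma t * dotH (resolvent T (gamma t) u) v).

(** For a scalar [T = z] this is [u] times the conjugate of [v] times the derivative of
    [arg (gamma t - z)], divided by [pi]: the density of the double-layer potential. *)
Definition poisson_density t u v : C :=
  cauchy_density t u v + (cauchy_density t v u)^*%R.

Let ellD u v (X Y : 'End(H)) : dotH ((X + Y) u) v = dotH (X u) v + dotH (Y u) v.
Proof. by rewrite add_lfunE dotDl. Qed.

Let ellZ u v a (X : 'End(H)) : dotH ((a *: X) u) v = a * dotH (X u) v.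
Proof. by rewrite scale_lfunE dotZl. Qed.

Let cR u v : continuous (fun t => dotH (resolvent T (gamma t) u) v).
Proof.
have h := @continuous_functional_resolvent _ _ T (fun X => dotH (X u) v)
  (ellD u v) (ellZ u v) _ \1%VF cg gT.
rewrite (_ : (fun _ => _) = fun t => dotH ((resolvent T (gamma t) \o \1)%VF u) v)//.
by apply/funext => t; rewrite comp_lfun1r.
Qed.

Lemma continuous_cauchy_density u v : continuous (fun t => cauchy_density t u v).
Proof.
exact: (continuousM_C (@continuous_cstC R R (two_pi_i R)^-1) (continuousM_C cdg (@cR u v))).
Qed.

Lemma continuous_poisson_density u v : continuous (fun t => poisson_density t u v).
Proof.
exact: (continuousD_C (@continuous_cauchy_density u v)
  (continuous_conj (@continuous_cauchy_density v u))).
Qed.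

Lemma cauchy_density_linearl t a u v w :
  cauchy_density t (a *: u + v) w = a * cauchy_density t u w + cauchy_density t v w.
Proof. by rewrite /cauchy_density linearP dotDl dotZl; ring. Qed.

Lemma cauchy_density_linearr t a u v w :
  cauchy_density t w (a *: u + v) = a^*%R * cauchy_density t w u + cauchy_density t w v.
Proof. by rewrite /cauchy_density dotDr dotZr; ring. Qed.

Lemma poisson_density_linearl t a u v w :
  poisson_density t (a *: u + v) w = a * poisson_density t u w + poisson_density t v w.
Proof.
rewrite /poisson_density cauchy_density_linearl cauchy_density_linearr.
by rewrite rmorphD rmorphM /= conjCK; ring.
Qed.

Lemma poisson_density_herm t u v : poisson_density t u v = (poisson_density t v u)^*%R.
Proof. by rewrite /poisson_density rmorphD /= conjCK addrC. Qed.

Lemma poisson_density_linearr t a u v w :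
  poisson_density t w (a *: u + v) = a^*%R * poisson_density t w u + poisson_density t w v.
Proof.
rewrite poisson_density_herm poisson_density_linearl rmorphD rmorphM /=.
by rewrite -!poisson_density_herm.
Qed.

(** With [v] the resolvent applied to [u] and [w] its Rayleigh quotient, [<v, u>] is [<v, v>] times
    the conjugate of [gamma t - w], so the density is [<v, v> / pi] times the tangent cross product
    at [w]. Here the whole numerical range, and not just the spectrum, has to lie in [Omega]. *)
Lemma poisson_density_gt0 t u : u != 0 -> 0 < poisson_density t u u.
Proof.
move=> u0; pose v := resolvent T (gamma t) u.
have uE : u = gamma t *: v - T v.
  have /lfunP/(_ u) := resolventVK (spectrumNP (@gT t)).
  by rewrite comp_lfunE add_lfunE opp_lfunE scale_lfunE !id_lfunE.
have v0 : v != 0 by apply: contra_neq u0 => v0; rewrite uE v0 scaler0 linear0 subrr.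
pose w := dotH (T v) v / dotH v v.
have q0 := tangent_cross_gt0 Oopen Oconvex Ogamma t (rayleigh_quotient v0).
have n0 := dot_gt0 dotH v0.
have nr : (dotH v v)^*%R = dotH v v by rewrite -formC_dot.
have vu : dotH v u = dotH v v * (gamma t - w)^*%R.
  rewrite uE dotBr dotZr rmorphB /= mulrBr [X in X - _]mulrC; congr (_ - _).
  rewrite formC_dot /w rmorphM fmorphV /= nr mulrCA mulfV ?mulr1// gt_eqF//.
have [n n1 nE] := gt0_rc n0.
rewrite /poisson_density /cauchy_density -/v vu nE conjCE.
set q := curve_deriv gamma t * _ in q0.
have -> : (two_pi_i R)^-1 * (curve_deriv gamma t * (rc n * conjc (gamma t - w))) =
    rc n * ((two_pi_i R)^-1 * q).
  by rewrite (mulrCA (curve_deriv gamma t)) (mulrCA _ (rc n)).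
have p0 : 0 < (pi *+ 2 : R) by rewrite pmulrn_lgt0// pi_gt0.
have iE : (two_pi_i R)^-1 = Complex 0 (- (pi *+ 2)^-1).
  apply: (mulfI (two_pi_i_neq0 R)); rewrite mulfV ?two_pi_i_neq0//.
  apply: complex_eq => /=; first by rewrite mul0r sub0r mulrN opprK mulfV// gt_eqF.
  by rewrite !mul0r mulr0 addr0.
rewrite iE ltcE conjCE; case: q q0 => q1 q2 /= q0.
apply/andP; split; first by apply/eqP; ring.
have : 0 < n * (q2 / (pi *+ 2)) by rewrite mulr_gt0// divr_gt0.
move=> h; apply: (lt_le_trans (addr_gt0 h h)); rewrite le_eqVlt; apply/orP; left.
by apply/eqP; ring.
Qed.

(** The residue computation applies to [gamma] itself, taken as a one-curve cycle that avoids the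
    spectrum and winds once around it. *)
Lemma cint_cauchy_density u v : cint 0 1 (fun t => cauchy_density t u v) = dotH u v.
Proof.
have G1 l : spectrum T l -> \sum_(k < 1) winding gamma l = 1.
  by move=> Tl; rewrite big_ord1; apply: (winding_in Ogamma); exact: spectrum_in_Omega.
have := @cycle_int_resolvent _ _ T (fun X => dotH (X u) v) (ellD u v) (ellZ u v)
  1%N (fun=> gamma) (fun=> gC) (fun=> gT) G1.
rewrite /cycle_int big_ord1 contour_intE id_lfunE => E.
apply: (mulfI (two_pi_i_neq0 R)); rewrite -E.
rewrite -(cintZ 0 1 _ (@continuous_cauchy_density u v)); apply: eq_cint => t _.
by rewrite /cauchy_density mulVKf ?two_pi_i_neq0// mulrC.
Qed.

Lemma cint_poisson_density u v : cint 0 1 (fun t => poisson_density t u v) = 2 * dotH u v.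
Proof.
rewrite (cintD 0 1 (@continuous_cauchy_density u v)
  (continuous_conj (@continuous_cauchy_density v u))).
rewrite (cint_conj 0 1 (@continuous_cauchy_density v u)) !cint_cauchy_density.
by rewrite -formC_dot mulr_natl mulr2n.
Qed.

Section Symbol.
Variable f : C -> C.
Hypothesis fA : in_A Omega f.

Lemma continuous_symbol : continuous (fun t => f (gamma t)).
Proof.
apply: (continuous_comp_within cg _ fA.2) => t.
exact: (boundary_closure Ogamma (t := t)).
Qed.

Let cfg := continuous_symbol.

Lemma dot_hol_calculus u v :
  dotH (hol_calculus Omega f T u) v = cint 0 1 (fun t => f (gamma t) * cauchy_density t u v).
Proof.
have fE z : Omega z -> f z = (two_pi_i R)^-1 *
    cint 0 1 (fun s => f (gamma s) * curve_deriv gamma s * (gamma s - z)^-1).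
  move=> Oz.
  have := cauchy_formula Oopen Oconvex gC (@boundary_closure _ _ _ Ogamma)
    (@boundary_out _ _ _ Oopen Ogamma) Oz fA.
  rewrite (winding_in Ogamma Oz) mulr1 contour_intE => E.
  apply: (mulfI (two_pi_i_neq0 R)); rewrite -E mulVKf ?two_pi_i_neq0//.
  by apply: eq_cint => t _; rewrite mulrAC.
rewrite (@functional_hol_calculus _ _ _ _ T Oopen Oconvex Ogamma spectrum_in_Omega
  (fun X => dotH (X u) v) (ellD u v) (ellZ u v) _ _ cfg fE).
rewrite -(cintZ 0 1 _ (continuousM_C (continuousM_C cfg cdg) (@cR u v))).
by apply: eq_cint => t _; rewrite /cauchy_density -mulrA mulrCA.
Qed.

(** The Cauchy transform is by definition a Cauchy integral, with the conjugate of [f] as boundary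
    data. *)
Lemma dot_hol_calculus_cauchy_conj u v :
  dotH (hol_calculus Omega (cauchy_conj gamma f) T u) v =
  cint 0 1 (fun t => (f (gamma t))^*%R * cauchy_density t u v).
Proof.
have cfc := continuous_conj cfg.
have fE z : Omega z -> cauchy_conj gamma f z = (two_pi_i R)^-1 *
    cint 0 1 (fun s => (f (gamma s))^*%R * curve_deriv gamma s * (gamma s - z)^-1).
  move=> Oz; rewrite /cauchy_conj contour_intE; apply: (congr1 ( *%R (two_pi_i R)^-1)).
  by apply: eq_cint => t _; rewrite mulrAC.
rewrite (@functional_hol_calculus _ _ _ _ T Oopen Oconvex Ogamma spectrum_in_Omega
  (fun X => dotH (X u) v) (ellD u v) (ellZ u v) _ _ cfc fE).
rewrite -(cintZ 0 1 _ (continuousM_C (continuousM_C cfc cdg) (@cR u v))).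
by apply: eq_cint => t _; rewrite /cauchy_density -mulrA mulrCA.
Qed.

(** Passing to the adjoint exchanges [u] and [v] and conjugates the integral, which turns the
    conjugate of [f] back into [f]: both terms then share this factor. *)
Lemma dot_double_layer u v :
  dotH ((hol_calculus Omega f T
         + adjoint dotH (hol_calculus Omega (cauchy_conj gamma f) T)) u) v =
  cint 0 1 (fun t => f (gamma t) * poisson_density t u v).
Proof.
rewrite add_lfunE dotDl dot_hol_calculus.
rewrite [X in _ + X]formC_dot -adjointP dot_hol_calculus_cauchy_conj.
have c1 := continuousM_C cfg (@continuous_cauchy_density u v).
have c2 := continuousM_C (continuous_conj cfg) (@continuous_cauchy_density v u).
rewrite -(cint_conj 0 1 c2) -(cintD 0 1 c1 (continuous_conj c2)).
by apply: eq_cint => t _; rewrite /poisson_density mulrDr rmorphM /= conjCK.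
Qed.

End Symbol.

(** Separates [t] from [u] and [v]: finitely many functions of [t] occur, so one quadrature can be
    exact for all vectors. *)
Lemma poisson_density_coord t u v : poisson_density t u v =
  \sum_(pq : 'I_(\dim {:H}) * 'I_(\dim {:H}))
    (coord (vbasis {:H}) pq.1 u * (coord (vbasis {:H}) pq.2 v)^*%R) *
    poisson_density t (vbasis {:H})`_pq.1 (vbasis {:H})`_pq.2.
Proof.
have P0l w : poisson_density t 0 w = 0.
  by have := poisson_density_linearl t (-1) 0 0 w; rewrite scaler0 addr0 mulN1r addNr.
have P0r w : poisson_density t w 0 = 0 by rewrite poisson_density_herm P0l rmorph0.
have suml n (a : 'I_n -> C) (e : 'I_n -> H) w :
    poisson_density t (\sum_i a i *: e i) w = \sum_i a i * poisson_density t (e i) w.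
  apply: (big_ind2 (fun x y => poisson_density t x w = y)) => // [x1 x2 y1 y2 <- <-|i _].
    by rewrite -[x1]scale1r poisson_density_linearl mul1r scale1r.
  by rewrite -[_ *: _]addr0 poisson_density_linearl P0l addr0.
have sumr n (a : 'I_n -> C) (e : 'I_n -> H) w :
    poisson_density t w (\sum_i a i *: e i) = \sum_i (a i)^*%R * poisson_density t w (e i).
  rewrite poisson_density_herm suml rmorph_sum; apply: eq_bigr => i _.
  by rewrite rmorphM /= -poisson_density_herm.
rewrite {1}(coord_vbasis (memvf u)) {1}(coord_vbasis (memvf v)) suml.
rewrite -(pair_bigA _ (fun p q => (coord (vbasis {:H}) p u * (coord (vbasis {:H}) q v)^*%R) *
    poisson_density t (vbasis {:H})`_p (vbasis {:H})`_q)) /=.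
apply: eq_bigr => p _; rewrite sumr mulr_sumr; apply: eq_bigr => q _.
by rewrite mulrA.
Qed.

Lemma operator_quadrature m (b : 'I_m -> C -> C) :
  (forall k, continuous (fun t => b k (gamma t))) ->
  exists n (x w : 'I_n -> R), (forall i, 0 < w i) /\ forall (c : 'I_m -> C) u v,
    \sum_(i < n) rc (w i) * ((\sum_k c k * b k (gamma (x i))) * poisson_density (x i) u v) =
    cint 0 1 (fun t => (\sum_k c k * b k (gamma t)) * poisson_density t u v).
Proof.
move=> cb; pose d := \dim {:H}.
pose F (kpq : 'I_m * ('I_d * 'I_d)) t := b kpq.1 (gamma t) *
  poisson_density t (vbasis {:H})`_kpq.2.1 (vbasis {:H})`_kpq.2.2.
have cF kpq : continuous (F kpq).
  exact: (continuousM_C (cb kpq.1) (@continuous_poisson_density _ _)).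
have [n [x [w [w0 hw]]]] := positive_quadratureC cF.
exists n, x, w; split=> // c u v.
pose a (kpq : 'I_m * ('I_d * 'I_d)) := c kpq.1 *
  (coord (vbasis {:H}) kpq.2.1 u * (coord (vbasis {:H}) kpq.2.2 v)^*%R).
have E t : (\sum_k c k * b k (gamma t)) * poisson_density t u v = \sum_kpq a kpq * F kpq t.
  rewrite poisson_density_coord big_distrlr /=.
  rewrite (pair_bigA _ (fun k (pq : 'I_d * 'I_d) => c k * b k (gamma t) *
    (coord (vbasis {:H}) pq.1 u * (coord (vbasis {:H}) pq.2 v)^*%R *
      poisson_density t (vbasis {:H})`_pq.1 (vbasis {:H})`_pq.2))) /=.
  by apply: eq_bigr => kpq _; rewrite /a /F mulrACA.
under eq_bigr do rewrite E.
by rewrite hw; apply: eq_cint => t _; rewrite E.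
Qed.

End OperatorMeasure.

(** * Assembly of the dilation *)

Theorem theorem1p6 (R : realType) (Omega : set (Cx R)) (gamma : R -> Cx R)
    (H : vectType (Cx R)) (dotH : {dot H for Num.conj}) (T : 'End(H))
    (A : set (Cx R -> Cx R)) :
  open Omega -> bounded_set Omega -> @convex_set _ (Cx R)^o Omega ->
  boundary_param Omega gamma ->
  numerical_range dotH T `<=` Omega ->
  fin_dim_subspace_of_A Omega A ->
  exists (K : vectType (Cx R)) (dotK : {dot K for Num.conj})
         (iota : 'Hom(H, K)) (N : 'End(K)),
    [/\ isometry dotK dotH iota,
        normal_op dotK N,
        spectrum N `<=` boundary Omega &
        forall f, A f -> forall u : H,
          iota ((hol_calculus Omega f T
                 + adjoint dotH (hol_calculus Omega (cauchy_conj gamma f) T)) u)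
          = 2 *: orth_proj dotK (limg iota) (cont_calculus dotK f N (iota u))].
Proof.
move=> Oopen _ Oconvex Ogamma WT [AO _ _ [m [b [bA bspan]]]].
(* The constant 1 joins the generators of [A] at index 0; exactness for it is what makes the
   embedding isometric. *)
pose B (k : 'I_m.+1) : Cx R -> Cx R := if unlift ord0 k is Some j then b j else fun=> 1.
have cB k : continuous (fun t => B k (gamma t)).
  rewrite /B; case: (unlift ord0 k) => [j|]; last exact: continuous_cstC.
  exact: (continuous_symbol Ogamma (AO _ (bA j))).
have [n [x [w [w0 hw]]]] := operator_quadrature Oopen Ogamma WT cB.
pose rc (r : R) : Cx R := real_complex R r.
pose D (i : 'I_n) u v : Cx R := rc (w i / 2) * poisson_density gamma dotH T (x i) u v.
have rcw i : 0 < rc (w i / 2) by rewrite ltcR divr_gt0.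
have Dl i a u v y : D i (a *: u + v) y = a * D i u y + D i v y.
  by rewrite /D poisson_density_linearl; ring.
have Dr i a u v y : D i y (a *: u + v) = (a^*)%R * D i y u + D i y v.
  by rewrite /D poisson_density_linearr; ring.
have Dh i u v : D i u v = ((D i v u)^*)%R.
  rewrite /D rmorphM /= -poisson_density_herm; congr (_ * _).
  by rewrite conjCE conjc_real.
have Dp i u : u != 0 -> 0 < D i u u.
  by move=> u0; rewrite mulr_gt0// (poisson_density_gt0 Oopen Oconvex Ogamma WT).
have D0l i u : D i 0 u = 0.
  by have := Dl i (-1) 0 0 u; rewrite scaler0 addr0 mulN1r addNr.
have D0r i u : D i u 0 = 0 by rewrite Dh D0l rmorph0.
have DZl i a u v : D i (a *: u) v = a * D i u v.
  by rewrite -[a *: u]addr0 Dl D0l addr0.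
have DZr i a u v : D i u (a *: v) = (a^*)%R * D i u v.
  by rewrite -[a *: v]addr0 Dr D0r addr0.
have [dotK dotKE] := direct_sum_dot Dl Dh Dp.
have [iota iotaE] : exists iota : 'Hom(H, {ffun 'I_n -> H}), forall u, iota u = [ffun=> u].
  by apply: linfun_exists => a u v; apply/ffunP => i; rewrite !ffunE.
have [N NE] : exists N : 'End({ffun 'I_n -> H}), forall y, N y = [ffun i => gamma (x i) *: y i].
  apply: linfun_exists => a y z; apply/ffunP => i.
  by rewrite !ffunE scalerDr !scalerA mulrC.
have {}NE y i : N y i = gamma (x i) *: y i by rewrite NE ffunE.
have Q (c : 'I_m.+1 -> Cx R) u v :
    \sum_i (\sum_k c k * B k (gamma (x i))) * D i u v =
    2^-1 * cint 0 1 (fun t => (\sum_k c k * B k (gamma t)) * poisson_density gamma dotH T t u v).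
  rewrite -hw mulr_sumr; apply: eq_bigr => i _.
  rewrite /D /rc rmorphM fmorphV rmorph_nat; ring.
have iso : isometry dotK dotH iota.
  move=> u v; apply: (etrans (dotKE _ _)).
  pose c (k : 'I_m.+1) : Cx R := if k == ord0 then 1 else 0.
  have cE z : \sum_k c k * B k z = 1.
    rewrite big_ord_recl /c eqxx /B unlift_none mul1r big1 ?addr0// => k _.
    by rewrite mul0r.
  transitivity (\sum_i (\sum_k c k * B k (gamma (x i))) * D i u v).
    by apply: eq_bigr => i _; rewrite !iotaE !ffunE cE mul1r.
  rewrite Q (eq_cint (G := fun t => poisson_density gamma dotH T t u v)).
    by rewrite (cint_poisson_density Oopen Ogamma WT) mulKf// pnatr_eq0.
  by move=> t _; rewrite cE mul1r.
exists {ffun 'I_n -> H}, dotK, iota, N; split=> //.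
- exact: (diagonal_normal dotKE NE DZl DZr).
- move=> z /(diagonal_spectrum NE)[i ->]; exact: boundary_curve.
- move=> f Af u; set X := (_ + _ : 'End(H)).
  have fE := dot_double_layer Oopen Oconvex Ogamma WT (AO _ Af).
  have [c0 c0E] := bspan f Af.
  pose c (k : 'I_m.+1) : Cx R := if unlift ord0 k is Some j then c0 j else 0.
  have cE t : \sum_k c k * B k (gamma t) = f (gamma t).
    rewrite big_ord_recl /c /B unlift_none mul0r add0r c0E; last exact: boundary_closure.
    by apply: eq_bigr => k _; rewrite liftK.
  (* The projection is [iota (X u / 2)]: tested against any [iota v], it and
     [cont_calculus dotK f N (iota u)] both give half the integral of [f] times the density. *)
  rewrite (@orth_proj_unique _ _ dotK _ _ (iota (2^-1 *: X u))).
  + by rewrite linearZ /= scalerA mulfV ?scale1r// pnatr_eq0.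
  + exact: memv_img (memvf _).
  + move=> _ /memv_imgP[v _ ->].
    have -> (y1 y2 : {ffun 'I_n -> H}) y3 : dotK (y1 - y2) y3 = dotK y1 y3 - dotK y2 y3.
      by rewrite -scaleN1r dotDl dotZl mulN1r.
    apply/eqP; rewrite subr_eq0; apply/eqP.
    transitivity (\sum_i (\sum_k c k * B k (gamma (x i))) * D i u v).
      rewrite dotKE; apply: eq_bigr => i _.
      by rewrite (diagonal_cont_calculus dotKE NE (fun i u => conj (D0r i u) (D0l i u))) !iotaE !ffunE DZl cE.
    rewrite Q (eq_cint (G := fun t => f (gamma t) * poisson_density gamma dotH T t u v)).
      by rewrite -fE -dotZl; exact: (esym (iso _ _)).
    by move=> t _; rewrite cE.
Qed.
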